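(* Let $(m,k,E,J)$ be a $\mathbb{Z}$-spectral system, $n=m+2$, let $q\in(0,\infty)\smallsetminus\{1\}$ satisfy $q+q^{-1}\in\mathbb{Z}$, let $f:(0,\infty)\to\mathbb{R}$ be a $C^\infty$ function satisfying conditions (f1) and (f2) of the context, and let $(V,\langle\cdot,\cdot\rangle,e_1,\dots,e_m,A,C)$, $(\widehat M,\widehat g)$, $\mathcal{E}$, $\mathcal{P}$ be the objects built from these data as in the context. Fix a pair $(\hat r,\hat u)\in\mathbb{R}\times\mathcal{E}$, and let $\hat\gamma$ and $\Pi$ be the associated isometry and linear operator. If $\mathcal{L}$ and $\Sigma$ are any objects satisfying conditions (A)--(E) of the context, then the group $\Gamma\subseteq\mathrm{Iso}(\widehat M,\widehat g)$ generated by $\hat\gamma$ and $\Sigma$ acts on $\widehat M$ freely and properly discontinuously with a compact quotient manifold $M=\widehat M/\Gamma$. In addition, $M$ is the total space of a torus bundle over the circle, with the leaves of $\mathcal{P}^\perp$ serving as the fibres, and its fundamental group $\Gamma$ has no Abelian subgroup of finite index, so that $M$ cannot be diffeomorphic to a torus, or even covered by a torus.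
   Context: **$\mathbb{Z}$-spectral systems.** A $\mathbb{Z}$-spectral system is a quadruple $(m,k,E,J)$ of integers $m,k\ge2$, an injective function $E:\mathcal{V}\to\mathbb{Z}\smallsetminus\{-1\}$, where $\mathcal{V}=\{1,\dots,2m\}$, and a function $J:\mathcal{V}\to\{0,1\}$, such that for all $i,i'\in\mathcal{V}$: (a) $k+1=2E(1)$; (b) $E(i)+E(i')=-1$ and $J(i)\ne J(i')$ whenever $i+i'=2m+1$; (c) $E(i)-E(i')=k$ and $J(i)\ne J(i')$ whenever $i'=i+1$ is even; (d) the set $Y=\{-1\}\cup\{E(i): i\in\mathcal{V},\ J(i)=1\}$ is symmetric about $0$. **Conditions on $f$.** Let $\mathcal{W}$ be the two-dimensional space of $C^2$ functions $y:(0,\infty)\to\mathbb{R}$ with $\ddot y=fy$, and let $[Tu](t)=u(t/q)$ for functions $u$ on $(0,\infty)$ with values anywhere. (f1) $f(t)=q^2f(qt)$ for all $t\in(0,\infty)$ (so $T$ preserves $\mathcal{W}$). (f2) $T:\mathcal{W}\to\mathcal{W}$ has the two distinct eigenvalues $\mu^\pm=q^{(-1\pm k)/2}$, with everywhere positive eigenfunctions $y^+,y^-\in\mathcal{W}$, so that $Ty^\pm=\mu^\pm y^\pm$. **The algebraic data.** $V$ is a real vector space of dimension $m=n-2$ with an inner product $\langle\cdot,\cdot\rangle$ and a basis $e_1,\dots,e_m$ such that, for some $\varepsilon\in\{1,-1\}$, $\langle e_i,e_j\rangle=\varepsilon$ if $i+j=m+1$ and $\langle e_i,e_j\rangle=0$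 otherwise. Put $a(j)=E(2j-1)+(1-k)/2$ for $j=1,\dots,m$ (equivalently $a(j)=E(2j)+(1+k)/2$), and define linear maps $A,C:V\to V$ by $Ae_m=e_1$, $Ae_i=0$ for $i<m$, and $Ce_i=q^{a(i)}e_i$ for all $i$. **The model.** $\widehat M=(0,\infty)\times\mathbb{R}\times V$ with points $(t,s,v)$, and $\widehat g=\kappa\,dt^2+dt\,ds+\langle\cdot,\cdot\rangle$, where $\kappa(t,s,v)=f(t)\langle v,v\rangle+\langle Av,v\rangle$, $\langle\cdot,\cdot\rangle$ is the flat metric on $V$, $dt,ds,\langle\cdot,\cdot\rangle$ are identified with their pullbacks to $\widehat M$, and $dt\,ds$ is the symmetric product with $\widehat g(\partial_t,\partial_s)=1/2$. $\mathcal{P}$ is the null parallel line distribution on $\widehat M$ spanned by $\partial/\partial s$; it is invariant under the isometries below, and the same symbol denotes the induced distribution on the quotient $M$. **Isometries.** $\mathcal{E}$ is the $2m$-dimensional space of $C^2$ functions $u:(0,\infty)\to V$ with $\ddot u=fu+Au$. The operator $CT:\mathcal{E}\to\mathcal{E}$ is $[(CT)u](t)=C\,u(t/q)$, and $\Omega(u_1,u_2)=\langle\dot u_1,u_2\rangle-\langle u_1,\dot u_2\rangle$ (constant in $t$) is a symplectic form on $\mathcal{E}$. Given $(\hat r,\hat u)\in\mathbb{R}\times\mathcal{E}$, put $\hat w=d\hat u/dt$ and $$\hat\gamma(t,s,v)=(qt,\,-\langle\hat w(qt),2Cv+\hat u(qt)\rangle+\hat r+s/q,\,Cv+\hat u(qt)).$$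 Each $(r,u)\in\mathbb{R}\times\mathcal{E}$ is identified with the map $$\gamma(t,s,v)=(t,\,-\langle\dot u(t),2v+u(t)\rangle+r+s,\,v+u(t)).$$ All these maps are isometries of $(\widehat M,\widehat g)$. The operator $\Pi:\mathbb{R}\times\mathcal{E}\to\mathbb{R}\times\mathcal{E}$ is $\Pi(r,u)=(2\Omega(CTu,\hat u)+r/q,\,CTu)$; it represents the conjugation $\gamma\mapsto\hat\gamma\gamma\hat\gamma^{-1}$. **Conditions on $\mathcal{L}$ and $\Sigma$.** (A) $\mathcal{L}\subseteq\mathcal{E}$ is a vector subspace of dimension $n-2$. (B) $CT$ leaves $\mathcal{L}$ invariant. (C) $\Sigma$ is a (full) lattice in $\mathbb{R}\times\mathcal{L}$ and $\Pi(\Sigma)=\Sigma$. (D) $\Omega(u,u')=0$ whenever $u,u'\in\mathcal{L}$. (E) $u\mapsto u(t)$ is an isomorphism $\mathcal{L}\to V$ for every $t\in(0,\infty)$. *)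

(* Defs.v *)
From HB Require Import structures.
From mathcomp Require Import all_boot all_order all_algebra.
From mathcomp Require Import generic_quotient.
From mathcomp Require Import all_classical all_reals all_analysis.
Set Implicit Arguments.
Unset Strict Implicit.
Unset Printing Implicit Defensive.
Import Order.TTheory GRing.Theory Num.Theory.
Import numFieldNormedType.Exports.
Local Open Scope quotient_scope.
Local Open Scope classical_set_scope.
Local Open Scope ring_scope.

(** * Z-spectral systems *)

Definition inV (m i : nat) : bool := (1 <= i <= 2 * m)%N.

(* E and J are functions on V = {1, ..., 2m}: their values elsewhere are junk
   and are never used. J takes values in {0,1} = bool. *)
Definition Z_spectral_system (m k : nat) (E : nat -> int) (J : nat -> bool) :=
  [/\ [/\ (2 <= m)%N, (2 <= k)%N,
          {in inV m &, injective E} & {in inV m, forall i, E i != -1}],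
      k%:Z + 1 = 2 * E 1%N,
      {in inV m &, forall i i', (i + i' = 2 * m + 1)%N ->
         E i + E i' = -1 /\ J i != J i'},
      {in inV m &, forall i i', i' = i.+1 -> ~~ odd i' ->
         E i - E i' = k%:Z /\ J i != J i'} &
      let Y := [set z : int | z = -1 \/ exists i, [/\ inV m i, J i & z = E i]] in
      forall z, Y z -> Y (- z)].

(** * Linear algebra *)

Section LinearAlgebra.
Context {R : realType}.

Definition is_basis (U : lmodType R) n (b : 'I_n -> U) (S : set U) :=
  (forall a : 'I_n -> R, \sum_(i < n) a i *: b i = 0 -> forall i, a i = 0) /\
  S = [set u | exists a : 'I_n -> R, u = \sum_(i < n) a i *: b i].

(* a subset equal to the span of n vectors is automatically a subspace *)
Definition subspace_of_dim (U : lmodType R) (n : nat) (S : set U) :=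
  exists b : 'I_n -> U, is_basis b S.

Definition full_lattice (U : lmodType R) (S Sigma : set U) :=
  exists n, exists2 b : 'I_n -> U, is_basis b S &
    Sigma = [set u | exists z : 'I_n -> int, u = \sum_(i < n) (z i)%:~R *: b i].

End LinearAlgebra.

(** * Groups of transformations, orbit spaces *)

Section Groups.
Context {X : Type}.
Implicit Types (G H S : set (X -> X)).

Definition transformation_group G :=
  [/\ G idfun, forall g h, G g -> G h -> G (g \o h) &
      forall g, G g -> exists h, [/\ G h, cancel g h & cancel h g]].

(* the smallest transformation group containing S *)
Definition generated_group S : set (X -> X) :=
  [set g | forall G, transformation_group G -> S `<=` G -> G g].

Definition orbit_rel S (x y : X) := exists2 g, generated_group S g & g x = y.

Definition orbit_relb S : rel X := fun x y => `[< orbit_rel S x y >].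

Lemma orbit_relb_refl S : reflexive (orbit_relb S).
Proof. by move=> x; apply/asboolP; exists idfun => // G []. Qed.

Lemma orbit_rel_sym S x y : orbit_rel S x y -> orbit_rel S y x.
Proof.
move=> [g gS <-]; have [[G GG SG]|noG] :=
    pselect (exists2 G, transformation_group G & S `<=` G); last first.
  by exists (fun=> x) => // G GG SG; case: noG; exists G.
case: (GG) => _ _ /(_ _ (gS _ GG SG)) [h [_ gh hg]].
exists h => // G' GG' SG'; case: (GG') => _ _ /(_ _ (gS _ GG' SG')).
move=> [h' [G'h' _ h'g]]; suff -> : h = h' by [].
by apply/funext => z; rewrite -{1}(h'g z) gh.
Qed.

Lemma orbit_relb_sym S : symmetric (orbit_relb S).
Proof.
by move=> x y; apply/asboolP/asboolP => /orbit_rel_sym.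
Qed.

Lemma orbit_relb_trans S : transitive (orbit_relb S).
Proof.
move=> y x z /asboolP[g gS <-] /asboolP[h hS <-]; apply/asboolP.
exists (h \o g) => // G GG SG.
by case: (GG) => _ /(_ h g (hS _ GG SG) (gS _ GG SG)).
Qed.

Canonical orbit_equiv S :=
  EquivRel (orbit_relb S) (orbit_relb_refl S) (@orbit_relb_sym S)
           (@orbit_relb_trans S).

Definition acts_freely G := forall g, G g -> forall x, g x = x -> g = idfun.

Definition abelian_group G :=
  forall g h, G g -> G h -> g \o h = h \o g.

Definition finite_index H G :=
  exists F : set (X -> X), [/\ finite_set F, F `<=` G &
    forall g, G g -> exists2 f, F f & exists2 h, H h & g = f \o h].

Definition has_abelian_subgroup_of_finite_index G :=
  exists H, [/\ transformation_group H, H `<=` G, abelian_group H &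
                finite_index H G].

End Groups.

Definition acts_properly_discontinuously (X : topologicalType)
    (G : set (X -> X)) :=
  forall K : set X, compact K ->
    finite_set [set g | G g /\ (g @` K) `&` K !=set0].

(* X / <S>, the space of orbits of the group generated by S *)
Definition orbit_space (X : topologicalType) (S : set (X -> X)) :
    topologicalType :=
  quotient_topology {eq_quot (orbit_equiv S)}.

Definition orbit_proj (X : topologicalType) (S : set (X -> X)) (x : X) :
    orbit_space S :=
  (\pi_({eq_quot (orbit_equiv S)}) x)%qT.

Lemma orbit_projE (X : topologicalType) (S : set (X -> X)) x y :
  (orbit_proj S x = orbit_proj S y) <-> orbit_rel S x y.
Proof.
split; first by move=> /eqmodP/asboolP.
by move=> xy; apply/eqmodP/asboolP.
Qed.

Lemma orbit_space_openE (X : topologicalType) (S : set (X -> X))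
    (A : set (orbit_space S)) :
  open A <-> open (orbit_proj S @^-1` A).
Proof. by []. Qed.

(** * Smooth manifolds *)

Section Manifolds.
Context {R : realType}.

(* All iterated directional derivatives of g are differentiable at x. When this
   holds on an open subset of a finite-dimensional space, g is C^oo there. *)
Definition cinfty_at (E F : normedModType R) (g : E -> F) (x : E) :=
  forall vs : seq E, differentiable (foldr (fun v h => 'D_v h) g vs) x.

(* An atlas is a set of local parametrizations (U, phi), with U open in the
   model space E and phi (used only on U) an open embedding U -> X, whose
   inverse is a chart in the usual sense. *)
Definition atlas (X : topologicalType) (E : normedModType R) :=
  set (set E * (E -> X)).

Definition parametrization (X : topologicalType) (E : normedModType R)
    (c : set E * (E -> X)) :=
  [/\ open c.1, {in c.1, continuous c.2}, set_inj c.1 c.2 &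
      forall A, A `<=` c.1 -> open A -> open (c.2 @` A)].

Definition smooth_compatible (X : topologicalType) (E : normedModType R)
    (c c' : set E * (E -> X)) :=
  forall x x', c.1 x -> c'.1 x' -> c.2 x = c'.2 x' ->
  exists2 g : E -> E, g x = x' &
    \forall y \near x, c.2 y = c'.2 (g y) /\ cinfty_at g y.

Definition smooth_manifold (X : topologicalType) (E : normedModType R)
    (A : atlas X E) :=
  [/\ hausdorff_space X, @second_countable X,
      forall c, A c -> parametrization c,
      \bigcup_(c in A) (c.2 @` c.1) = setT &
      forall c c', A c -> A c' -> smooth_compatible c c'].

Section SmoothMaps.
Context {X Y : topologicalType} {E F : normedModType R}.
Variables (A : atlas X E) (B : atlas Y F).

(* g represents h near a in the parametrizations c and c' *)
Definition local_expression (h : X -> Y) (c : set E * (E -> X))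
    (c' : set F * (F -> Y)) (a : E) (g : E -> F) :=
  [/\ c.1 a, c'.1 (g a) &
      \forall y \near a, h (c.2 y) = c'.2 (g y) /\ cinfty_at g y].

Definition smooth_map_at (h : X -> Y) (x : X) :=
  exists c c' a g, [/\ A c, B c', c.2 a = x & local_expression h c c' a g].

Definition smooth_map (h : X -> Y) := forall x, smooth_map_at h x.

End SmoothMaps.

Definition diffeomorphic {X Y : topologicalType} {E F : normedModType R}
    (A : atlas X E) (B : atlas Y F) :=
  exists h h', [/\ cancel h h', cancel h' h,
                   smooth_map A B h & smooth_map B A h'].

Definition model_atlas (E : normedModType R) : atlas E E := [set (setT, id)].

Arguments model_atlas : clear implicits.

Definition product_atlas {X Y : topologicalType} {E F : normedModType R}
    (A : atlas X E) (B : atlas Y F) : atlas (X * Y)%type (E * F)%type :=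
  [set c | exists c1 c2, [/\ A c1, B c2 &
     c = (c1.1 `*` c2.1, fun x : E * F => (c1.2 x.1, c2.2 x.2))]].

(* the smooth structure for which X -> X / <S> is a local diffeomorphism *)
Definition quotient_atlas {X : topologicalType} {E : normedModType R}
    (A : atlas X E) (S : set (X -> X)) : atlas (orbit_space S) E :=
  [set d | exists c, [/\ A c, open d.1, d.1 `<=` c.1,
                        d.2 = orbit_proj S \o c.2 & set_inj d.1 d.2]].

Arguments quotient_atlas {X E} A S.

(* the torus R^d / Z^d; the circle is the case d = 1 *)
Definition integer_translations d : set ('rV[R]_d -> 'rV[R]_d) :=
  [set g | exists2 z : 'rV[R]_d, (forall i, z 0 i \is a Num.int) &
           g = fun x => x + z].

Definition torus d := orbit_space (@integer_translations d).

Definition torus_atlas d : atlas (torus d) 'rV[R]_d :=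
  quotient_atlas (model_atlas 'rV[R]_d) (@integer_translations d).

Arguments torus_atlas : clear implicits.

Definition smooth_fibre_bundle {X B Z : topologicalType}
    {E F G : normedModType R}
    (AX : atlas X E) (AB : atlas B F) (AZ : atlas Z G) (pi : X -> B) :=
  smooth_map AX AB pi /\
  forall b, exists U : set B, [/\ open U, U b &
    exists (h : B * Z -> X) (h' : X -> B * Z),
      (forall w, U w.1 -> [/\ pi (h w) = w.1, h' (h w) = w &
                             smooth_map_at (product_atlas AB AZ) AX h w]) /\
      (forall x, U (pi x) -> [/\ (h' x).1 = pi x, h (h' x) = x &
                             smooth_map_at AX (product_atlas AB AZ) h' x])].

(** Distributions and leaves. A distribution is given by its coordinate
    expression D : E -> set E in the parametrizations of the atlas A; for it to
    be well defined it must be the same in all of them, as is the case below,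
    where D comes from a distribution invariant under the group divided out. *)

Definition integral_immersion {X N : topologicalType} {E F : normedModType R}
    (A : atlas X E) (B : atlas N F) (D : E -> set E) (i : N -> X) :=
  injective i /\
  forall z, exists c c' a g, [/\ B c, A c', c.2 a = z,
    local_expression i c c' a g &
    \forall y \near a, injective ('d g y) /\ range ('d g y) = D (g y)].

Definition connected_integral_manifold {X : topologicalType}
    {E : normedModType R} (A : atlas X E) (D : E -> set E) (N : set X) :=
  exists d (Y : topologicalType) (B : atlas Y 'rV[R]_d) (i : Y -> X),
    [/\ smooth_manifold B, connected [set: Y],
        integral_immersion A B D i & N = range i].

Definition leaf {X : topologicalType} {E : normedModType R}
    (A : atlas X E) (D : E -> set E) (N : set X) :=
  connected_integral_manifold A D N /\
  forall N', connected_integral_manifold A D N' -> N `<=` N' -> N' = N.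

End Manifolds.

Arguments torus : clear implicits.
Arguments model_atlas {R} E.
Arguments quotient_atlas {R X E} A S.
Arguments torus_atlas : clear implicits.

(** * Fundamental group and coverings *)

Section Homotopy.
Context (R : realType) {X : topologicalType}.
Implicit Types c : R -> X.

Definition loop_at (x0 : X) c :=
  [/\ {within `[0, 1], continuous c}, c 0 = x0 & c 1 = x0].

Definition homotopic_loops (x0 : X) c c' :=
  exists H : R * R -> X,
    [/\ {within `[0, 1] `*` `[0, 1], continuous H},
        {in `[0, 1], forall t, H (0, t) = c t},
        {in `[0, 1], forall t, H (1, t) = c' t} &
        {in `[0, 1], forall s, H (s, 0) = x0 /\ H (s, 1) = x0}].

Definition concat_loops c c' : R -> X :=
  fun t => if t <= 2^-1 then c (2 * t) else c' (2 * t - 1).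

(* pi_1(X, x0) is isomorphic to the transformation group G: phi induces a group
   isomorphism from homotopy classes of loops onto G *)
Definition fundamental_group_is {Z : Type} (G : set (Z -> Z)) (x0 : X) :=
  exists phi : (R -> X) -> (Z -> Z),
    [/\ phi @` loop_at x0 = G,
        forall c c', loop_at x0 c -> loop_at x0 c' ->
          (phi c = phi c' <-> homotopic_loops x0 c c') &
        forall c c', loop_at x0 c -> loop_at x0 c' ->
          phi (concat_loops c c') = phi c \o phi c'].

End Homotopy.

Definition covering_map {Y X : topologicalType} (p : Y -> X) :=
  [/\ continuous p, range p = setT &
      forall x, exists U : set X, [/\ open U, U x &
        exists W : set (set Y),
          [/\ p @^-1` U = \bigcup_(V in W) V, trivIset W id &
              forall V, W V -> [/\ open V, set_bij V U p &
                forall O, O `<=` V -> open O -> open (p @` O)]]]].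

(** * The model manifold and its isometries *)

(* Functions on (0, oo) are represented by functions R -> V that vanish on
   (-oo, 0], so that equality of functions is equality on (0, oo). *)
Definition solution_space {R : realType} {V : normedModType R}
    (f : R -> R) (A : V -> V) : set (R -> V) :=
  [set u : R -> V | (forall t : R, t <= 0 -> u t = 0) /\
    forall t : R, 0 < t ->
      [/\ derivable u t 1, derivable (derive1 u) t 1,
          {for t, continuous (derive1 (derive1 u))} &
          derive1 (derive1 u) t = f t *: u t + A (u t)]].

Definition T_op {R : realType} {V : Type} (q : R) (u : R -> V) : R -> V :=
  fun t => u (t / q).

Section ConditionsOnF.
Context {R : realType}.
Variables (q : R) (k : nat) (f : R -> R).

Definition smooth_on_pos :=
  forall n t, 0 < t -> derivable (derive1n n f) t 1.

Definition condition_f1 := forall t, 0 < t -> f t = q ^+ 2 * f (q * t).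

Definition W_space : set (R -> R) := solution_space f (fun=> 0).

Definition positive_eigenfunction (mu : R) (y : R -> R) :=
  [/\ W_space y, forall t, 0 < t -> 0 < y t & T_op q y = mu *: y].

(* T is T_op q; both its eigenvalues are simple, since W is 2-dimensional *)
Definition mu_plus : R := q `^ ((-1 + k%:R) / 2).
Definition mu_minus : R := q `^ ((-1 - k%:R) / 2).

Definition condition_f2 :=
  mu_plus != mu_minus /\
  exists yp ym, positive_eigenfunction mu_plus yp /\
                positive_eigenfunction mu_minus ym.

End ConditionsOnF.

Section Model.
Context {R : realType} {V : normedModType R}.
Variables (ip : V -> V -> R) (f : R -> R) (A : V -> V).

(* coordinates ((t, s), v); the norm of the finite-dimensional space V serves
   only to give its usual topology *)
Local Notation space := (R * R * V)%type.

Definition half_space : set space := [set x | 0 < x.1.1].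

Lemma half_space_base : ((1, 0), 0) \in half_space.
Proof. by rewrite inE /half_space /= ltr01. Qed.

Definition Mhat : topologicalType := set_type half_space.

(* x itself if x is in (0, oo) x R x V, and a fixed point otherwise *)
Definition to_Mhat (x : space) : Mhat := 
  insubd (SigSub half_space_base : set_type half_space) x.

Definition Mhat_atlas : atlas Mhat space := [set (half_space, to_Mhat)].

Definition Mhat_map (F : space -> space) : Mhat -> Mhat :=
  fun x => to_Mhat (F (val x)).

Definition kappa (x : space) : R := f x.1.1 * ip x.2 x.2 + ip (A x.2) x.2.

Definition ghat (x X Y : space) : R :=
  kappa x * (X.1.1 * Y.1.1) + (X.1.1 * Y.1.2 + X.1.2 * Y.1.1) / 2 +
  ip X.2 Y.2.

Definition P_line (x : space) : set space :=
  [set X | exists c : R, X = ((0, c), 0)].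

Definition P_perp (x : space) : set space :=
  [set X | forall Y, P_line x Y -> ghat x X Y = 0].

Definition isometry_group : set (Mhat -> Mhat) :=
  [set g | (exists h, [/\ cancel g h, cancel h g,
                          smooth_map Mhat_atlas Mhat_atlas g &
                          smooth_map Mhat_atlas Mhat_atlas h]) /\
    forall (x : Mhat) X Y,
      let dg := 'd (fun y => val (g (to_Mhat y))) (val x) in
      ghat (val (g x)) (dg X) (dg Y) = ghat (val x) X Y].

Definition E_space : set (R -> V) := solution_space f A.

Variables (q : R) (C : V -> V).

Definition CT (u : R -> V) : R -> V := C \o T_op q u.

(* constant in t for u1, u2 in E_space; evaluated here at t = 1 *)
Definition Omega (u1 u2 : R -> V) : R :=
  ip (derive1 u1 1) (u2 1) - ip (u1 1) (derive1 u2 1).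

Definition gamma (ru : R * (R -> V)) : Mhat -> Mhat :=
  Mhat_map (fun x : space =>
    let t := x.1.1 in let s := x.1.2 in let v := x.2 in
    let u := ru.2 in
    ((t, - ip (derive1 u t) (2 *: v + u t) + ru.1 + s), v + u t)).

Variables (rhat : R) (uhat : R -> V).

Definition gamma_hat : Mhat -> Mhat :=
  Mhat_map (fun x : space =>
    let t := x.1.1 in let s := x.1.2 in let v := x.2 in
    let what := derive1 uhat in
    ((q * t, - ip (what (q * t)) (2 *: C v + uhat (q * t)) + rhat + s / q),
     C v + uhat (q * t))).

Definition Pi_op (ru : R * (R -> V)) : R * (R -> V) :=
  (2 * Omega (CT ru.2) uhat + ru.1 / q, CT ru.2).

Section Data.
Variables (L : set (R -> V)) (Sigma : set (R * (R -> V))).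

Definition conditions_A_E (m : nat) :=
  [/\ L `<=` E_space /\ subspace_of_dim m L,
      forall u, L u -> L (CT u),
      full_lattice (setT `*` L) Sigma /\ Pi_op @` Sigma = Sigma,
      forall u u', L u -> L u' -> Omega u u' = 0 &
      forall t, 0 < t -> set_bij L setT (fun u => u t)].

Definition Gamma_generators : set (Mhat -> Mhat) :=
  [set gamma_hat] `|` gamma @` Sigma.

Definition Gamma : set (Mhat -> Mhat) := generated_group Gamma_generators.

Definition M : topologicalType := orbit_space Gamma_generators.

Definition M_atlas : atlas M space :=
  quotient_atlas Mhat_atlas Gamma_generators.

End Data.
End Model.

Arguments Mhat {R} V.
Arguments Mhat_atlas {R} V.
Arguments M_atlas {R V} ip q C rhat uhat Sigma.

Definition algebraic_data {R : realType} {V : normedModType R}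
    (m k : nat) (E : nat -> int) (q : R) (ip : V -> V -> R) (e : 'I_m -> V)
    (A C : V -> V) :=
  (* e is 0-based: e i is the basis vector e_(i+1); a is 1-based *)
  let a (j : nat) : R := (E (2 * j - 1)%N)%:~R + (1 - k%:R) / 2 in
  [/\ is_basis e setT,
      exists2 eps : R, eps = 1 \/ eps = -1 &
        forall i j : 'I_m,
          ip (e i) (e j) = if (i.+1 + j.+1 == m.+1)%N then eps else 0,
      forall i j : 'I_m, i.+1 = m -> j.+1 = 1%N -> A (e i) = e j,
      forall i : 'I_m, (i.+1 < m)%N -> A (e i) = 0 &
      forall i : 'I_m, C (e i) = q `^ (a i.+1) *: e i].

(* Main.v *)
Require Import Defs.
From HB Require Import structures.
From mathcomp Require Import all_boot all_order all_algebra.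
From mathcomp Require Import all_classical all_reals all_analysis.
From mathcomp Require Import lra zify.
Import Order.TTheory GRing.Theory Num.Theory.
Import numFieldNormedType.Exports.
Local Open Scope classical_set_scope.
Local Open Scope ring_scope.
Set Implicit Arguments.
Unset Strict Implicit.
Unset Printing Implicit Defensive.

(** In suitable global coordinates the quotient [M] is the mapping torus of an
automorphism of a torus, and every claim can be read off from this picture.

Coordinates. Write [t = q ^ tau] with [tau] real. Evaluation at [t] is an
isomorphism from [L] to [V], so a point [((t, s), v)] determines one [u] in [L]
with [u t = v]; put [r = s + <u' t, v>]. Expressing [(r, u)] in the basis of
[R * L] that generates [Sigma] gives a global diffeomorphism [chart_coord] from
the half space to [R * R^(m+1)], with inverse [param]. Because [L] is isotropic
for [Omega], the isometry given by an element of [R * L] adds the coordinates of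
that element ([gamma_translation]); hence [Sigma] acts by the integer
translations of [R^(m+1)]. The isometry [gamma_hat] raises [tau] by [1]
([height_gamma_hat]), and conjugation by it induces [Pi] ([gamma_conj]), so it
normalizes the integer translations, since [Pi] maps [Sigma] onto itself
([gamma_hat_translation], [translation_gamma_hat]).

Mapping tori. A group generated by the integer translations and by a
diffeomorphism [a] that normalizes them and raises the height by [1] consists of
the maps [translation z \o a ^ k] ([mt_generated]). This normal form gives
freeness, proper discontinuity and compactness of the quotient. The height
modulo [1] is the bundle projection ([mt_bundle]), whose fibres are tori
[R^(m+1) / Z^(m+1)]. The distribution [P_perp] is the kernel of [dt], hence of
[dtau]: the height is constant along its connected integral manifolds, and the
fibres are such manifolds, so the leaves are the fibres ([mt_leaf]).

Fundamental group. The half space is convex, so paths with common end points in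
it are homotopic. Unique lifting of paths and homotopies along the covering by
the half space identifies the loops of [M] up to homotopy with [Gamma]
([orbit_space_fundamental_group]).

No Abelian subgroup of finite index. Such a subgroup would contain a positive
power [gamma_hat ^ p] and a positive multiple of each element of [Sigma], and
these would commute, so that [Pi ^ p] would be the identity on [R * L]. But
[Pi (1, 0) = (1 / q, 0)] and [q != 1] ([Gamma_not_virtually_abelian]). If a torus
covered [M], lifting paths to both universal covers would make [Gamma] contain a
quotient of [Z^d] whose index is at most the number of points in a fibre, which
is finite ([covering_finite_fibre], [abelian_cover_finite_index]). A diffeomorphism is a covering, so this
also excludes diffeomorphic tori.

Isometries. What the spectral system contributes is that [A] is self-adjoint,
[C] is an isometry, and [C \o A = q ^ 2 (A \o C)]; these come from
[a j + a (m + 1 - j) = 0] and [a 1 = 1] ([spectral_exponents]). Together with the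
equation [u'' = f u + A u] and the scaling of [f] they make [gamma] and
[gamma_hat] isometries ([model_map_isometry]). *)

(** * Smooth maps between normed spaces *)

Section SmoothCalculus.
Context {R : realType}.
Implicit Types E F G : normedModType R.

(** Directional derivatives keep the same source and target as [g], so this form
of n-fold differentiability goes through inductions on [n], and for all [n]
it is [cinfty_at] on [U]. *)
Fixpoint Ck E F (n : nat) (U : set E) (g : E -> F) : Prop :=
  (forall x, U x -> differentiable g x) /\
  if n is n'.+1 then forall v, Ck n' U ('D_v g) else True.

Definition smooth_on E F (U : set E) (g : E -> F) := forall n, Ck n U g.

Lemma Ck_diff E F n (U : set E) (g : E -> F) x :
  Ck n U g -> U x -> differentiable g x.
Proof. by case: n => [|n] [H _]; apply: H. Qed.

Lemma CkS E F n (U : set E) (g : E -> F) : Ck n.+1 U g -> Ck n U g.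
Proof.
elim: n g => [|n IH] g; first by move=> [].
by move=> [dg Dg]; split=> // v; apply/IH/Dg.
Qed.

Lemma smooth_on_cinfty E F (U : set E) (g : E -> F) x :
  smooth_on U g -> U x -> cinfty_at g x.
Proof.
move=> sg Ux vs; have {}sg := sg (size vs); move: sg.
elim/last_ind: vs g => [|vs v IH] g; first by move=> [/(_ _ Ux)].
by rewrite size_rcons foldr_rcons => -[_ /(_ v)]; exact: IH.
Qed.

Lemma cinfty_smooth_on E F (U : set E) (g : E -> F) :
  (forall x, U x -> cinfty_at g x) -> smooth_on U g.
Proof.
move=> cg n; elim: n g cg => [|n IH] g cg; split=> //.
- by move=> x Ux; apply: (cg x Ux [::]).
- by move=> x Ux; apply: (cg x Ux [::]).
- move=> v; apply: IH => x Ux vs; have := cg x Ux (rcons vs v).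
  by rewrite foldr_rcons.
Qed.

Lemma near_eq_differentiable E F (f g : E -> F) (x : E) :
  (\near x, f x = g x) -> differentiable f x -> differentiable g x.
Proof.
move=> fg df; have fgx : f x = g x by exact: nbhs_singleton fg.
have [dfc dfx] := (diff_locallyP x f).1 df.
suff dgx : g \o shift x = cst (g x) + 'd f x +o_ 0 id.
  by apply/diff_locallyP; rewrite (diff_unique dfc dgx).
apply/eqaddoP => e e0; have /eqaddoP /(_ e e0) := dfx.
have : \forall y \near 0, f (y + x) = g (y + x).
  by move: fg; rewrite (near_shift 0 x); apply: filterS => y /=; rewrite subr0.
by apply: filterS2 => y yfg; rewrite !fctE /= -fgx yfg.
Qed.

Lemma eq_Ck E F n (U : set E) (f g : E -> F) : open U ->
  (forall x, U x -> f x = g x) -> Ck n U f -> Ck n U g.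
Proof.
move=> oU; elim: n f g => [|n IH] f g fg [df Df].
  split=> // x Ux; apply: near_eq_differentiable (df x Ux).
  by near=> y; apply: fg; near: y; apply: open_nbhs_nbhs.
have fgn x : U x -> \near x, f x = g x.
  by move=> Ux; near=> y; apply: fg; near: y; apply: open_nbhs_nbhs.
split=> [x Ux|v]; first exact: near_eq_differentiable (fgn x Ux) (df x Ux).
by apply: IH (Df v) => x Ux; apply: near_eq_derive; apply: fgn.
Unshelve. all: by end_near. Qed.

Lemma Ck_cst E F n (U : set E) (c : F) : Ck n U (fun=> c).
Proof.
elim: n c => [|n IH] c; split; try by move=> *.
move=> v.
have -> : 'D_v (fun=> c) = (fun=> 0) :> (E -> F) by apply/funext=> x; exact: derive_cst.
exact: IH.
Qed.

Lemma Ck_D E F n (U : set E) (f g : E -> F) : open U ->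
  Ck n U f -> Ck n U g -> Ck n U (fun x => f x + g x).
Proof.
move=> oU; elim: n f g => [|n IH] f g [df Df] [dg Dg].
  by split=> // x Ux; apply: differentiableD; [exact: df|exact: dg].
split=> [x Ux|v]; first by apply: differentiableD; [exact: df|exact: dg].
apply: eq_Ck (IH _ _ (Df v) (Dg v)) => // x Ux.
by rewrite -deriveD //; apply: diff_derivable; [exact: df|exact: dg].
Qed.

Lemma Ck_lin_comp E F G n (U : set E) (f : E -> F) (l : {linear F -> G}) :
  open U -> continuous l -> Ck n U f -> Ck n U (l \o f).
Proof.
move=> oU lc; elim: n f => [|n IH] f [df Df].
  split=> // x Ux; apply: differentiable_comp; first exact: df.
  exact: linear_differentiable.
split=> [x Ux|v].
  by apply: differentiable_comp; [exact: df|exact: linear_differentiable].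
apply: eq_Ck (IH _ (Df v)) => // x Ux.
have dl y : differentiable l y by exact: linear_differentiable.
rewrite /= !deriveE; [|exact: differentiable_comp (df _ Ux) (dl _)|exact: df].
by rewrite (diff_comp (df _ Ux) (dl _)) /= diff_lin.
Qed.

Lemma smooth_lin E F (U : set E) (l : {linear E -> F}) : continuous l -> smooth_on U l.
Proof.
move=> lc n; case: n => [|n]; split; try by [].
- by move=> x _; exact: linear_differentiable.
- by move=> x _; exact: linear_differentiable.
move=> v.
have -> : 'D_v l = (fun=> l v).
  by apply/funext => x; rewrite deriveE ?diff_lin //; exact: linear_differentiable.
exact: Ck_cst.
Qed.

Lemma Ck_Zl E F n (U : set E) (k : E -> R) (c : F) : open U ->
  Ck n U k -> Ck n U (fun x => k x *: c).
Proof.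
move=> oU; pose l := ( *:%R ^~ c : R -> F).
have ll : linear l by move=> a x y; rewrite /l scalerDl scalerA.
pose lM := GRing.isLinear.Build _ _ _ _ _ ll.
pose lL : {linear R -> F} := HB.pack l lM.
apply: (@Ck_lin_comp E R F n U k lL) => //; exact: scalel_continuous.
Qed.

Lemma Ck_M E n (U : set E) (f g : E -> R) : open U ->
  Ck n U f -> Ck n U g -> Ck n U (fun x => f x * g x).
Proof.
move=> oU; elim: n f g => [|n IH] f g [df Df] [dg Dg].
  by split=> // x Ux; apply: differentiableM; [exact: df|exact: dg].
split=> [x Ux|v]; first by apply: differentiableM; [exact: df|exact: dg].
have := Ck_D oU (IH _ _ (CkS (conj df Df)) (Dg v)) (IH _ _ (CkS (conj dg Dg)) (Df v)).
apply: eq_Ck => // x Ux.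
by rewrite deriveM //; apply: diff_derivable; [exact: df|exact: dg].
Qed.

Lemma Ck_V E n (U : set E) (f : E -> R) : open U -> (forall x, U x -> f x != 0) ->
  Ck n U f -> Ck n U (fun x => (f x)^-1).
Proof.
move=> oU f0; elim: n => [|n IH] [df Df].
  by split=> // x Ux; apply: differentiableV; [exact: df|exact: f0].
split=> [x Ux|v]; first by apply: differentiableV; [exact: df|exact: f0].
have iV := IH (CkS (conj df Df)).
have := Ck_M oU (Ck_M oU (Ck_cst _ _ (-1 : R)) (Ck_M oU iV iV)) (Df v).
apply: eq_Ck => // x Ux.
rewrite deriveV ?f0 //; last by apply: diff_derivable; exact: df.
by rewrite /GRing.scale /= mulN1r -invfM -expr2.
Qed.

Lemma Ck_sum E F n (U : set E) (I : Type) (r : seq I) (P : pred I) (f : I -> E -> F) : open U ->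
  (forall i, P i -> Ck n U (f i)) -> Ck n U (fun x => \sum_(i <- r | P i) f i x).
Proof.
move=> oU Cf; elim: r => [|i r IH].
  by rewrite (_ : (fun _ => _) = fun=> 0); [exact: Ck_cst|apply/funext => x; rewrite big_nil].
case Pi : (P i); last first.
  by rewrite (_ : (fun _ => _) = fun x => \sum_(i <- r | P i) f i x) //; apply/funext => x; rewrite big_cons Pi.
rewrite (_ : (fun _ => _) = fun x => f i x + \sum_(i <- r | P i) f i x);
  last by apply/funext => x; rewrite big_cons Pi.
by apply: Ck_D => //; exact: Cf.
Qed.

Lemma Ck_prod E n (U : set E) (I : Type) (r : seq I) (P : pred I) (f : I -> E -> R) : open U ->
  (forall i, P i -> Ck n U (f i)) -> Ck n U (fun x => \prod_(i <- r | P i) f i x).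
Proof.
move=> oU Cf; elim: r => [|i r IH].
  by rewrite (_ : (fun _ => _) = fun=> 1); [exact: Ck_cst|apply/funext => x; rewrite big_nil].
case Pi : (P i); last first.
  by rewrite (_ : (fun _ => _) = fun x => \prod_(i <- r | P i) f i x) //; apply/funext => x; rewrite big_cons Pi.
rewrite (_ : (fun _ => _) = fun x => f i x * \prod_(i <- r | P i) f i x);
  last by apply/funext => x; rewrite big_cons Pi.
by apply: Ck_M => //; exact: Cf.
Qed.

Lemma Ck_pair E F G n (U : set E) (f : E -> F) (g : E -> G) : open U ->
  Ck n U f -> Ck n U g -> Ck n U (fun x => (f x, g x)).
Proof.
move=> oU; elim: n f g => [|n IH] f g [df Df] [dg Dg].
  by split=> // x Ux; apply: differentiable_pair; [exact: df|exact: dg].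
split=> [x Ux|v]; first by apply: differentiable_pair; [exact: df|exact: dg].
apply: eq_Ck (IH _ _ (Df v) (Dg v)) => // x Ux.
have dfg := differentiable_pair (df x Ux) (dg x Ux).
rewrite /= (deriveE _ (df x Ux)) (deriveE _ (dg x Ux)) (deriveE _ dfg).
by rewrite diff_pair //; [exact: df|exact: dg].
Qed.

Lemma scale_is_bilinear F :
  bilinear_for
    (GRing.Scale.Law.clone _ _ *:%R _) (GRing.Scale.Law.clone _ _ *:%R _)
    (@GRing.scale R F).
Proof.
split=> [u'|u] a x y /=; first by rewrite scalerDl scalerA.
by rewrite scalerDr !scalerA mulrC.
Qed.

Lemma Ck_Z E F n (U : set E) (k : E -> R) (g : E -> F) : open U ->
  Ck n U k -> Ck n U g -> Ck n U (fun x => k x *: g x).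
Proof.
move=> oU.
pose bM := bilinear_isBilinear.Build R R F F _ _ (@GRing.scale R F) (scale_is_bilinear F).
pose b : {bilinear R -> F -> F} := HB.pack (@GRing.scale R F) bM.
have bc : continuous (fun p : R * F => b p.1 p.2) by move=> p; exact: scale_continuous.
have dZ (l : E -> R) (h : E -> F) x : differentiable l x -> differentiable h x ->
    differentiable (fun x => l x *: h x) x.
  move=> dl dh; have := differentiable_comp (differentiable_pair dl dh)
    (@differentiable_bilin R R F F b (l x, h x) bc).
  by [].
have DZ (l : E -> R) (h : E -> F) x v : differentiable l x -> differentiable h x ->
    l x *: 'D_v h x + 'D_v l x *: h x = 'D_v (fun x => l x *: h x) x.
  move=> dl dh; rewrite [RHS]deriveE; last exact: dZ.
  have db := @differentiable_bilin R R F F b (l x, h x) bc.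
  have dc := diff_comp (differentiable_pair dl dh) db.
  have db' := @diff_bilin R R F F b (l x, h x) bc.
  have dp := diff_pair dl dh.
  transitivity ('d ((fun p => b p.1 p.2) \o (fun y => (l y, h y))) x v); last by [].
  by rewrite dc [RHS]/= db' dp /= !deriveE.
elim: n k g => [|n IH] k g [dk Dk] [dg Dg].
  by split=> // x Ux; apply: dZ; [exact: dk|exact: dg].
split=> [x Ux|v]; first by apply: dZ; [exact: dk|exact: dg].
have := Ck_D oU (IH _ _ (CkS (conj dk Dk)) (Dg v)) (IH _ _ (Dk v) (CkS (conj dg Dg))).
by apply: eq_Ck => // x Ux; apply: DZ; [exact: dk|exact: dg].
Qed.

(** Finite dimension, in the form that differentiation needs: a vector is
recovered from finitely many coefficients that are linear and also
continuous. *)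
Definition has_coords E := exists n (b : 'I_n -> E) (phi : 'I_n -> {linear E -> R}),
  (forall i, continuous (phi i)) /\ forall w, w = \sum_i phi i w *: b i.

(** The derivative of [g] at [f x] is taken in the direction [D_v f x], which
varies with [x]. Expanding this direction in coordinates leaves derivatives
of [g] in finitely many fixed directions, to which the induction hypothesis
applies. *)
Lemma Ck_comp E F G n (U : set E) (W : set F) (f : E -> F) (g : F -> G) :
  has_coords F -> open U -> (forall x, U x -> W (f x)) ->
  Ck n U f -> Ck n W g -> Ck n U (g \o f).
Proof.
move=> hF oU UW.
have dgf : (forall x, U x -> differentiable f x) ->
    (forall x, W x -> differentiable g x) ->
    (forall x, U x -> differentiable (g \o f) x).
  by move=> df dg x Ux; apply: differentiable_comp; [exact: df|exact/dg/UW].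
elim: n f g UW dgf => [|n IH] f g UW dgf [df Df] [dg Dg]; first by split=> //; exact: dgf.
split=> [|v]; first exact: dgf.
have [d [b [phi [phic phib]]]] := hF.
have Dgf x : U x -> \sum_i phi i ('D_v f x) *: 'D_(b i) g (f x) = 'D_v (g \o f) x.
  move=> Ux; rewrite (deriveE _ (dgf df dg x Ux)) (diff_comp (df x Ux) (dg _ (UW x Ux))).
  rewrite /= -(deriveE _ (df x Ux)) [in RHS](phib ('D_v f x)) linear_sum.
  by apply: eq_bigr => i _; rewrite linearZ (deriveE _ (dg _ (UW x Ux))).
apply: (eq_Ck oU Dgf).
apply: Ck_sum => // i _; apply: Ck_Z => //.
  by apply: (@Ck_lin_comp E F R) => //; exact: Df.
apply: (IH f ('D_(b i) g)) => //; [|exact: CkS (conj df Df)|exact: Dg].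
move=> df' dg' x Ux; apply: differentiable_comp; [exact: df'|exact/dg'/UW].
Qed.

End SmoothCalculus.

(** * Finite-dimensional spaces *)

Section Sums.
Context {R : realType}.

Lemma fct_sumE (T : Type) (W : lmodType R) I (r : seq I) (F : I -> T -> W) t :
  (\sum_(i <- r) F i) t = \sum_(i <- r) F i t.
Proof.
by elim: r => [|i r IH]; rewrite ?big_nil // !big_cons -IH.
Qed.

Lemma fst_sum (W1 W2 : lmodType R) I (r : seq I) (F : I -> W1 * W2) :
  (\sum_(i <- r) F i).1 = \sum_(i <- r) (F i).1.
Proof. exact: (big_morph (@fst W1 W2)). Qed.

Lemma snd_sum (W1 W2 : lmodType R) I (r : seq I) (F : I -> W1 * W2) :
  (\sum_(i <- r) F i).2 = \sum_(i <- r) (F i).2.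
Proof. exact: (big_morph (@snd W1 W2)). Qed.

End Sums.

Section FiniteDimension.
Context {R : realType}.
Implicit Types E F : normedModType R.

Lemma lin_rV_continuous (V : normedModType R) m (l : {linear 'rV[R]_m -> V}) : continuous l.
Proof.
have -> : (l : 'rV[R]_m -> V) = fun x => \sum_i x 0 i *: l (delta_mx 0 i).
  apply/funext => x; rewrite {1}(row_sum_delta x) linear_sum.
  by apply: eq_bigr => i _; rewrite linearZ.
apply: continuous_big => [|i _]; first exact: add_continuous.
move=> x; apply: (@continuous_comp _ R _ (fun x : 'rV[R]_m => x 0 i) ( *:%R ^~ (l (delta_mx 0 i)))).
  exact: coord_continuous.
exact: scalel_continuous.
Qed.

(** Continuity of the coefficients: the norm of [\sum_i x_i e_i] has a positive
minimum on the unit sphere of [R^m], so it dominates a multiple of the norm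
of [x]. *)
Lemma basis_coords (V : normedModType R) m (e : 'I_m -> V) : is_basis e setT ->
  exists phi : 'I_m -> {linear V -> R},
    [/\ forall i, continuous (phi i), forall w, w = \sum_i phi i w *: e i &
        forall a i, phi i (\sum_j a j *: e j) = a i].
Proof.
move=> [efree espan].
have ex (w : V) : exists a : 'I_m -> R, w = \sum_i a i *: e i.
  by have : [set: V] w by []; rewrite espan.
pose c w := sval (cid (ex w)).
have cE w : w = \sum_i c w i *: e i by rewrite /c; case: (cid _).
have uniq (a a' : 'I_m -> R) : \sum_i a i *: e i = \sum_i a' i *: e i -> forall i, a i = a' i.
  move=> aa' i; apply/eqP; rewrite -subr_eq0; apply/eqP; apply: (efree (fun i => a i - a' i)).
  under eq_bigr do rewrite scalerBl.
  by rewrite sumrB aa' subrr.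
have clin i : linear (fun w => c w i).
  move=> k x y; apply: (uniq (c (k *: x + y)) (fun i => k * c x i + c y i)).
  under [RHS]eq_bigr do rewrite scalerDl -scalerA.
  by rewrite big_split /= -scaler_sumr -!cE.
pose cM i := GRing.isLinear.Build _ _ _ _ _ (clin i).
pose phi i : {linear V -> R} := HB.pack (fun w => c w i) (cM i).
exists phi; split=> [i|w|a i]; [|exact: cE|by apply: uniq; rewrite -cE].
pose L (x : 'rV[R]_m) : V := \sum_i x 0 i *: e i.
have Llin : linear L.
  move=> k x y; rewrite /L scaler_sumr -big_split /=; apply: eq_bigr => j _.
  by rewrite !mxE scalerDl scalerA.
pose LM := GRing.isLinear.Build _ _ _ _ _ Llin.
pose LL : {linear 'rV[R]_m -> V} := HB.pack L LM.
have Lc : continuous L by apply (@lin_rV_continuous V m LL).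
pose S : set 'rV[R]_m := [set x | `|x| = 1].
have cS : compact S.
  apply: bounded_closed_compact.
    exists 1; split => // r r1 x /=; rewrite /S /= => ->; exact: ltW.
  rewrite /S (_ : [set x | _] = (fun x : 'rV[R]_m => `|x|) @^-1` [set 1]) //.
  by apply: preimage_closed => //= x _; exact: norm_continuous.
have [S0|S0] := pselect (S !=set0); last first.
  have phi0 w : phi i w = 0.
    apply: contrapT => /eqP wi; apply: S0.
    pose x : 'rV[R]_m := \row_j phi j w.
    have x0 : x != 0 by apply: contra wi => /eqP/rowP/(_ i); rewrite !mxE => ->.
    by exists (`|x|^-1 *: x); rewrite /S /= normrZ normfV normr_id mulVf ?normr_eq0.
  by move=> x; rewrite (_ : (phi i : V -> R) = cst 0); [exact: cvg_cst|apply/funext].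
have [x0 /set_mem x0S xmin] : exists2 c, c \in S & forall t, t \in S -> `|L c| <= `|L t|.
  apply: (@EVT_min_rV R m (fun x => `|L x|) S S0 cS).
  apply: continuous_subspaceT => x; apply: continuous_comp (Lc x) _; exact: norm_continuous.
have Lx0 : 0 < `|L x0|.
  rewrite normr_gt0; apply: contra_eqT x0S => /negPn/eqP Lx0.
  have -> : x0 = 0 by apply/rowP => j; rewrite mxE; exact: (efree (x0 0) Lx0).
  by rewrite normr0 eq_sym oner_eq0.
apply: bounded_linear_continuous; apply/linear_boundedP.
near=> r => w.
pose x : 'rV[R]_m := \row_j phi j w.
have Lx : L x = w.
  by rewrite /L [RHS](cE w); apply: eq_bigr => j _; rewrite mxE.
have phix : `|phi i w| <= `|x|.
  rewrite (_ : phi i w = x 0 i); last by rewrite mxE.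
  by rewrite [leRHS]/Num.norm /= mx_normrE; apply/bigmax_geP; right => /=; exists (0, i).
have xw : `|x| * `|L x0| <= `|w|.
  have [->|xn0] := eqVneq x 0; first by rewrite normr0 mul0r.
  have nx : 0 < `|x| by rewrite normr_gt0.
  have : `|L x0| <= `|L (`|x|^-1 *: x)|.
    by apply: xmin; rewrite inE /S /= normrZ normfV normr_id mulVf ?normr_eq0.
  have -> : L (`|x|^-1 *: x) = `|x|^-1 *: w.
    rewrite -[in RHS]Lx /L scaler_sumr; apply: eq_bigr => j _.
    by rewrite mxE scalerA.
  by rewrite normrZ normfV normr_id ler_pdivlMl.
apply: le_trans phix _; apply: (@le_trans _ _ (`|L x0|^-1 * `|w|)).
  by rewrite ler_pdivlMl // mulrC.
by apply: ler_wpM2r => //; near: r; exact: nbhs_pinfty_ge.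
Unshelve. all: by end_near. Qed.

Lemma basis_has_coords (V : normedModType R) m (e : 'I_m -> V) :
  is_basis e setT -> has_coords V.
Proof. by move=> /basis_coords [phi [phic phiE _]]; exists m, e, phi. Qed.

Lemma R_has_coords : has_coords (R : normedModType R).
Proof.
exists 1, (fun=> 1), (fun=> idfun : {linear R -> R}); split=> [i x|w]; first exact: cvg_id.
by rewrite big_ord1 [_ *: _]mulr1.
Qed.

Lemma rV_has_coords d : has_coords 'rV[R]_d.
Proof.
apply: (@basis_has_coords _ d (fun i => delta_mx 0 i)); split.
  move=> a /rowP a0 i; have := a0 i; rewrite mxE summxE (bigD1 i) //= big1.
    by rewrite !mxE !eqxx mulr1 addr0.
  by move=> j ji; rewrite !mxE eq_sym (negbTE ji) andbF mulr0.
rewrite eqEsubset; split=> // x _; exists (x 0); exact: row_sum_delta.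
Qed.

Lemma prod_has_coords E F : has_coords E -> has_coords F -> has_coords (E * F)%type.
Proof.
move=> [n [b [phi [phic phiE]]]] [n' [b' [phi' [phic' phiE']]]].
pose B (i : 'I_(n + n')) : E * F :=
  match fintype.split i with inl j => (b j, 0) | inr j => (0, b' j) end.
pose l1 i : {linear (E * F)%type -> R} := phi i \o fst.
pose l2 i : {linear (E * F)%type -> R} := phi' i \o snd.
pose Phi (i : 'I_(n + n')) : {linear (E * F)%type -> R} :=
  match fintype.split i with inl j => l1 j | inr j => l2 j end.
exists (n + n')%N, B, Phi; split.
  move=> i; rewrite /Phi; case: (fintype.split i) => j x; rewrite /l1 /l2 /=.
    by apply: continuous_comp; [exact: cvg_fst|exact: phic].
  by apply: continuous_comp; [exact: cvg_snd|exact: phic'].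
have splitl i : fintype.split (lshift n' i) = inl i :> 'I_n + 'I_n' by rewrite -[lshift _ _]/(unsplit (inl i)) unsplitK.
have splitr i : fintype.split (rshift n i) = inr i :> 'I_n + 'I_n' by rewrite -[rshift _ _]/(unsplit (inr i)) unsplitK.
move=> [x y]; rewrite big_split_ord /=; apply: injective_projections => /=.
  rewrite !fst_sum [X in _ + X]big1 ?addr0; last by move=> i _; rewrite /B splitr /= scaler0.
  by rewrite [LHS]phiE; apply: eq_bigr => i _; rewrite /B /Phi splitl.
rewrite !snd_sum [X in X + _]big1 ?add0r; last by move=> i _; rewrite /B splitl /= scaler0.
by rewrite [LHS]phiE'; apply: eq_bigr => i _; rewrite /B /Phi splitr.
Qed.

(** * Solutions of second-order equations, inverse matrices *)

Definition pos : set R := [set t | 0 < t].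

Lemma open_pos : open pos.
Proof. exact: open_gt. Qed.

Lemma smooth_on_pos_smooth (f : R -> R) : smooth_on_pos f -> smooth_on pos f.
Proof.
move=> hf n; have : forall j, Ck n pos (derive1n j f).
  elim: n => [|n IH] j; split; try by [].
  - by move=> t /hf /derivable1_diffP.
  - by move=> t /hf /derivable1_diffP.
  move=> v; have := Ck_Z open_pos (Ck_cst n pos v) (IH j.+1).
  apply: eq_Ck open_pos _ => t /(hf j)/derivable1_diffP dt.
  by rewrite deriveE // diff1E // derive1nS.
by move/(_ 0%N).
Qed.

(** Bootstrapping: if [u] and [u'] are n times differentiable, then so is [u'' =
f u + A u]. *)
Lemma solution_smooth (V : normedModType R) (f : R -> R) (A : {linear V -> V}) u :
  continuous A -> smooth_on_pos f -> solution_space f A u ->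
  smooth_on pos u /\ smooth_on pos (derive1 u).
Proof.
move=> Ac /smooth_on_pos_smooth sf [_ hu].
have du t : pos t -> differentiable u t by move=> /hu [/derivable1_diffP].
have du' t : pos t -> differentiable (derive1 u) t by move=> /hu [_ /derivable1_diffP].
suff H n : Ck n pos u /\ Ck n pos (derive1 u) by split=> n; case: (H n).
elim: n => [|n [IH IH']]; first by split; split.
split; split => // v.
  have := Ck_Z open_pos (Ck_cst n pos v) IH'.
  by apply: eq_Ck open_pos _ => t /du dt; rewrite deriveE // diff1E.
have := Ck_Z open_pos (Ck_cst n pos v)
  (Ck_D open_pos (Ck_Z open_pos (sf n) IH) (Ck_lin_comp open_pos Ac IH)).
apply: eq_Ck open_pos _ => t tp; have [_ _ _ Et] := hu t tp.
by rewrite deriveE ?diff1E ?Et //; exact: du'.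
Qed.

Lemma Ck_det E n (U : set E) d (B : E -> 'M[R]_d) : open U ->
  (forall i j, Ck n U (fun x => B x i j)) -> Ck n U (fun x => \det (B x)).
Proof.
move=> oU CB; rewrite /determinant; apply: Ck_sum => // s _.
apply: Ck_M => //; first exact: Ck_cst.
by apply: Ck_prod.
Qed.

(** By the cofactor formula the entries of the inverse are quotients of
polynomials in those of [B]. *)
Lemma Ck_invmx E n (U : set E) d (B : E -> 'M[R]_d) : open U ->
  (forall x, U x -> B x \in unitmx) ->
  (forall i j, Ck n U (fun x => B x i j)) ->
  forall i j, Ck n U (fun x => invmx (B x) i j).
Proof.
move=> oU uB CB i j.
apply: (@eq_Ck _ _ _ _ _ (fun x => (\det (B x))^-1 * cofactor (B x) j i)) => //.
  by move=> x Ux; rewrite /invmx uB // !mxE.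
apply: Ck_M => //.
  apply: Ck_V => //; last exact: Ck_det.
  by move=> x /uB; rewrite unitmxE unitfE.
rewrite /cofactor; apply: Ck_M => //; first exact: Ck_cst.
apply: Ck_det => // k l.
by rewrite (_ : (fun _ => _) = fun x => B x (lift j k) (lift i l)) //; apply/funext => x; rewrite !mxE.
Qed.

Lemma Ck_rV E n (U : set E) d (g : E -> 'rV[R]_d) : open U ->
  (forall i, Ck n U (fun x => g x 0 i)) -> Ck n U g.
Proof.
move=> oU Cg; have -> : g = fun x => \sum_i g x 0 i *: (delta_mx 0 i : 'rV[R]_d).
  by apply/funext => x; exact: row_sum_delta.
by apply: Ck_sum => // i _; apply: Ck_Zl.
Qed.

Lemma Ck_coord E n (U : set E) d (g : E -> 'rV[R]_d) i : open U ->
  Ck n U g -> Ck n U (fun x => g x 0 i).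
Proof.
move=> oU Cg.
have cl : linear (fun x : 'rV[R]_d => x 0 i) by move=> a x y; rewrite !mxE.
pose cM := GRing.isLinear.Build _ _ _ _ _ cl.
pose c : {linear 'rV[R]_d -> R} := HB.pack (fun x : 'rV[R]_d => x 0 i) cM.
apply: (@Ck_lin_comp _ E _ R n U g c) => //; exact: coord_continuous.
Qed.

End FiniteDimension.

(** * Local constancy *)

Section LocalConstancy.
Context {R : realType}.

(** Mean value theorem along the segment from [a0] to [y]. *)
Lemma zero_differential_cst (V : normedModType R) (u : V -> R) (a0 : V) (e : R) :
  (forall y, ball a0 e y -> differentiable u y /\ forall v, 'd u y v = 0) ->
  forall y, ball a0 e y -> u y = u a0.
Proof.
move=> du y ay; pose f (s : R) := u (a0 + s *: (y - a0)).
have seg s : 0 <= s <= 1 -> ball a0 e (a0 + s *: (y - a0)).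
  move=> /andP[s0 s1]; move: ay; rewrite -ball_normE /= !opprD addrA subrr add0r normrN normrZ.
  rewrite (ger0_norm s0) -normrN opprB => ay; apply: le_lt_trans ay.
  by rewrite ler_piMl.
have df (s : R) : 0 <= s <= 1 -> is_derive s 1 f 0.
  move=> s01; have [du1 du0] := du _ (seg s s01).
  pose l (r : R) := a0 + r *: (y - a0).
  have dl : differentiable l s.
    have cl : smooth_on setT l.
      move=> n; apply: Ck_D; [exact: openT|exact: Ck_cst|].
      apply: Ck_Zl; first exact: openT.
      exact: (@smooth_lin R _ _ setT idfun (fun x => cvg_id)).
    exact: Ck_diff (cl 0%N) _.
  have dul : differentiable (u \o l) s by exact: differentiable_comp.
  apply: DeriveDef; first exact: diff_derivable.
  by rewrite deriveE // (diff_comp dl du1) /= du0.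
have [|||c _] := @MVT_segment R f (fun=> 0) 0 1 _ _ _ => //.
- by move=> s; rewrite in_itv /= => /andP[s0 s1]; apply: df; rewrite !ltW.
- apply: derivable_within_continuous => s; rewrite in_itv /= => s01.
  by case: (df s s01).
by rewrite /f mul0r scale1r scale0r addr0 subrKC => /subr0_eq.
Qed.

Lemma locally_constant_connected (Y T : topologicalType) (k : Y -> T) :
  connected [set: Y] -> (forall y, \forall y' \near y, k y' = k y) -> forall y y', k y = k y'.
Proof.
move=> cY kl y0 y1.
have op (P : T -> Prop) : open [set y | P (k y)].
  by rewrite openE => y Py; apply: filterS (kl y) => y' /= ->.
have E0 : [set y | k y = k y0] = setT.
  apply: cY; first by exists y0.
    by exists [set y | k y = k y0]; [exact: (op (fun t => t = k y0))|rewrite setTI].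
  exists [set y | k y = k y0]; last by rewrite setTI.
  rewrite -[X in closed X]setCK; apply: open_closedC.
  exact: (op (fun t => t <> k y0)).
have : [set: Y] y1 by [].
by rewrite -E0.
Qed.

End LocalConstancy.

(** * Orbit spaces *)

Lemma filter_finite T I (D : set I) (F : set_system T) (f : I -> set T) : Filter F ->
  finite_set D -> (forall i, D i -> F (f i)) -> F (\bigcap_(i in D) f i).
Proof.
elim/Pchoice: I => I in D f *; move=> FF /finite_fsetP[X ->] Df.
exact: filter_bigI.
Qed.

Section GeneratedGroup.
Context {X : Type}.
Implicit Types (G S : set (X -> X)).

Lemma generated_group_group S G0 : transformation_group G0 -> S `<=` G0 ->
  transformation_group (generated_group S).
Proof.
move=> GG0 SG0; split.
- by move=> G [].
- move=> g h gS hS G GG SG; case: (GG) => _ Gc _.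
  by apply: Gc; [apply: gS|apply: hS].
- move=> g gS; case: (GG0) => _ _ /(_ _ (gS _ GG0 SG0)) [h [G0h gh hg]].
  exists h; split=> // G GG SG; case: (GG) => _ _ /(_ _ (gS _ GG SG)) [h' [Gh' gh' hg']].
  suff -> : h = h' by [].
  by apply/funext => z; rewrite -{1}(hg' z) gh.
Qed.

Lemma generated_group_sub S : S `<=` generated_group S.
Proof. by move=> g Sg G _; apply. Qed.

Lemma generated_group_min S G0 : transformation_group G0 -> S `<=` G0 ->
  generated_group S `<=` G0.
Proof. by move=> GG0 SG0 g; apply. Qed.

End GeneratedGroup.

Section OrbitSpace.
Context {X : topologicalType} (S : set (X -> X)).
Local Notation G := (generated_group S).
Local Notation proj := (orbit_proj S).
Hypothesis GG : transformation_group G.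
Hypothesis Gc : forall g, G g -> continuous g.

Lemma orbit_proj_surj (m : orbit_space S) : exists x, proj x = m.
Proof.
by exists (repr m : X); rewrite /orbit_proj; exact: reprK.
Qed.

Lemma orbit_proj_continuous : continuous proj.
Proof. by apply/continuousP => A /orbit_space_openE. Qed.

Lemma orbit_proj_act g x : G g -> proj (g x) = proj x.
Proof. by move=> Gg; apply/esym/orbit_projE; exists g. Qed.

Lemma orbit_proj_open A : open A -> open (proj @` A).
Proof.
move=> oA; apply/orbit_space_openE.
have -> : proj @^-1` (proj @` A) = \bigcup_(g in G) (g @^-1` A).
  rewrite eqEsubset; split=> x /=.
    by move=> [y Ay /esym/orbit_projE [g Gg gx]]; exists g => //=; rewrite gx.
  by move=> [g Gg /= Agx]; exists (g x) => //; exact: orbit_proj_act.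
by apply: bigcup_open => g Gg; apply: open_comp => // x _; exact: Gc.
Qed.

Hypothesis Xlc : forall x : X, exists2 K, nbhs x K & compact K.
Hypothesis XT2 : hausdorff_space X.
Hypothesis Gpd : acts_properly_discontinuously G.

(** Only finitely many elements of the group move the union of two compact
neighbourhoods of [x] and [y] to a set that meets it. Each of them is dealt
with by separating [g x] from [y], and finitely many neighbourhoods can be
intersected. *)
Lemma orbit_separation x y : exists U W, [/\ open_nbhs x U, open_nbhs y W &
  forall g, G g -> g x <> y -> forall u, U u -> ~ W (g u)].
Proof.
have [Kx nKx cKx] := Xlc x; have [Ky nKy cKy] := Xlc y.
pose D := [set g | G g /\ (g @` (Kx `|` Ky)) `&` (Kx `|` Ky) !=set0].
have fD : finite_set D by apply: Gpd; exact: compactU.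
pose P g (p : X * X) := g x <> y -> g p.1 <> p.2.
have nearP g : D g -> nbhs (x, y) (P g).
  move=> [Gg _]; have [gxy|gxy] := pselect (g x = y); first by apply: filterE => p /(_ gxy).
  have gxy' : g x != y by apply/eqP.
  have := XT2; rewrite open_hausdorff => /(_ (g x) y gxy') [[A B] /= [/set_mem Ax /set_mem By] [oA oB AB]].
  have nA : nbhs x (g @^-1` A) by exact: (Gc Gg (open_nbhs_nbhs (conj oA Ax))).
  have nB : nbhs y B by exact: (open_nbhs_nbhs (conj oB By)).
  exists (g @^-1` A, B); first by split.
  move=> [u w] [/= Au Bw] _ guw; move/eqP: AB; apply/eqP/set0P; exists w; split=> //.
  by rewrite -[w]guw.
have := filter_finite _ fD nearP.
move=> [[U0 W0] /= [nU nW] UW].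
have [U oU US] : exists2 U, open_nbhs x U & U `<=` U0 `&` Kx.
  by have : nbhs x (U0 `&` Kx) by [apply: filterI]; rewrite nbhsE => -[U ? ?]; exists U.
have [W oW WS] : exists2 W, open_nbhs y W & W `<=` W0 `&` Ky.
  by have : nbhs y (W0 `&` Ky) by [apply: filterI]; rewrite nbhsE => -[W ? ?]; exists W.
exists U, W; split=> // g Gg gxy u Uu Wgu.
have Dg : D g.
  split=> //; exists (g u); split; last by right; have [] := WS _ Wgu.
  by exists u => //; left; have [] := US _ Uu.
by apply: (UW (u, g u)) Dg gxy _ => //; split; [have [] := US _ Uu|have [] := WS _ Wgu].
Qed.

Lemma orbit_space_hausdorff : hausdorff_space (orbit_space S).
Proof.
rewrite open_hausdorff => m m'.
have [x <-] := orbit_proj_surj m; have [y <-] := orbit_proj_surj m'.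
move=> /eqP xy; have [U [W [[oU Ux] [oW Wy] UW]]] := orbit_separation x y.
exists (proj @` U, proj @` W); first by split; rewrite inE; [exists x|exists y].
split; [exact: orbit_proj_open|exact: orbit_proj_open|].
apply/eqP/seteqP; split => // z [[u Uu <-] [w Ww /esym/orbit_projE [g Gg guw]]].
apply: (UW g Gg) Uu _ => [gxy|]; last by rewrite guw.
by apply: xy; apply/orbit_projE; exists g.
Qed.

Hypothesis Gfree : acts_freely G.

(** By [orbit_separation] with [y = x], only elements that fix [x] can return
points to a small neighbourhood, and the action is free. *)
Lemma wandering_nbhs x : exists2 U, open_nbhs x U &
  forall g, G g -> forall u, U u -> U (g u) -> g = idfun.
Proof.
have [U [W [[oU Ux] [oW Wx] UW]]] := orbit_separation x x.
exists (U `&` W); first by split; [exact: openI|].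
move=> g Gg u [Uu _] [_ Wgu]; have [gx|gx] := pselect (g x = x); first exact: Gfree gx.
by case: (UW g Gg gx u Uu).
Qed.

(** The sheets over the image of a wandering neighbourhood are its translates. *)
Lemma orbit_proj_covering : covering_map proj.
Proof.
split; [exact: orbit_proj_continuous|by rewrite -subTset => m _; have [x <-] := orbit_proj_surj m; exists x|].
move=> m; have [x <-] := orbit_proj_surj m.
have [U [oU Ux] Uw] := wandering_nbhs x.
have gU g : G g -> exists h, [/\ G h, cancel g h, cancel h g & g @` U = h @^-1` U].
  move=> Gg; case: (GG) => _ _ /(_ _ Gg) [h [Gh gh hg]]; exists h; split=> //.
  rewrite eqEsubset; split=> z /=; first by move=> [u Uu <-]; rewrite gh.
  by move=> Uhz; exists (h z).
exists (proj @` U); split; [exact: orbit_proj_open|by exists x|].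
exists [set g @` U | g in G]; split.
- rewrite eqEsubset; split=> z /=.
    move=> [u Uu /orbit_projE [g Gg guz]].
    by exists (g @` U); [exists g|exists u].
  by move=> [_ [g Gg <-]] [u Uu <-]; exists u => //; rewrite orbit_proj_act.
- move=> _ _ [g Gg <-] [g' Gg' <-] [z [[u Uu <-] [u' Uu' guu]]].
  have [h [Gh gh hg _]] := gU _ Gg.
  have hg'1 : h \o g' = idfun.
    apply: (Uw _ _ u' Uu'); last by rewrite /= guu gh.
    by case: (GG) => _ Gcomp _; exact: Gcomp.
  suff -> : g' = g by [].
  by apply/funext => z'; rewrite -(hg (g' z')); have /= -> := congr1 (@^~ z') hg'1.
- move=> _ [g Gg <-]; have [h [Gh gh hg gUE]] := gU _ Gg; split.
  + by rewrite gUE; apply: open_comp => // z _; exact: Gc.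
  + split=> [_ [u Uu <-]|_ _ /set_mem [u Uu <-] /set_mem [u' Uu' <-]|_ [u Uu <-]] /=.
    * by exists u => //; rewrite orbit_proj_act.
    * rewrite !orbit_proj_act // => /orbit_projE [g' Gg' g'u].
      have g'1 : g' = idfun by apply: (Uw _ Gg' u Uu); rewrite g'u.
      by rewrite -g'u g'1.
    * by exists (g u); [exists u|rewrite orbit_proj_act].
  + by move=> O _ oO; exact: orbit_proj_open.
Qed.

End OrbitSpace.

(** * Quotients of a space with one global chart *)

Section Topology.
Context {R : realType}.
Implicit Types E : normedModType R.

Lemma second_countable_embed (X Y : topologicalType) (i : X -> Y) (r : Y -> X) :
  continuous i -> (forall x, {for i x, continuous r}) -> cancel i r ->
  @second_countable Y -> @second_countable X.
Proof.
move=> ic rc ir [B cB [Bo Bb]]; exists [set i @^-1` b | b in B].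
  exact: sub_countable (card_image_le _ _) cB.
split=> [_ [b /Bo ob <-]|x A nA]; first by apply: open_comp ob => z _; exact: ic.
have nrA : nbhs (i x) (r @^-1` A) by apply: rc; rewrite /= ir.
have [b [Bb' bx] bA] := Bb (i x) _ nrA.
exists (i @^-1` b); first by split=> //; exists b.
by move=> z /bA; rewrite /= ir.
Qed.

Lemma second_countable_open_image (X Y : topologicalType) (p : X -> Y) :
  continuous p -> (forall A, open A -> open (p @` A)) -> (forall y, exists x, p x = y) ->
  @second_countable X -> @second_countable Y.
Proof.
move=> pc po ps [B cB [Bo Bb]]; exists [set p @` b | b in B].
  exact: sub_countable (card_image_le _ _) cB.
split=> [_ [b /Bo ob <-]|y A nA]; first exact: po.
have [x xy] := ps y; have npA : nbhs x (p @^-1` A) by apply: pc; rewrite /= xy.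
have [b [Bb' bx] bA] := Bb x _ npA.
exists (p @` b); first by split; [exists b|exists x].
by move=> _ [z /bA Az <-].
Qed.

Lemma second_countable_rV d : @second_countable 'rV[R]_d.
Proof.
pose c (p : 'rV[rat]_d * nat) : set 'rV[R]_d := ball (map_mx ratr p.1 : 'rV[R]_d) (p.2.+1%:R^-1).
exists (range c); first exact: sub_countable (card_image_le _ _) (countableP _).
split=> [_ [p _ <-]|x A /nbhs_ballP [e /= e0 xeA]]; first exact: ball_open.
have [k ke] : exists k, (k.+1%:R^-1 : R) < e / 2.
  have e2 : 0 < e / 2 by rewrite divr_gt0.
  exists (Num.truncn ((e / 2)^-1)).
  rewrite invf_plt ?posrE //; exact: truncnS_gt.
have r0 : 0 < (k.+1%:R^-1 : R) by rewrite invr_gt0 ltr0n.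
have exq i : exists y : rat, `|x 0 i - ratr y| < k.+1%:R^-1.
  have := @dense_rat R (ball (x 0 i) (k.+1%:R^-1)).
  case; [by exists (x 0 i); exact: ballxx|exact: ball_open|].
  by move=> z [xq [y _ yE]]; exists y; rewrite yE.
pose y : 'rV[rat]_d := \row_i sval (cid (exq i)).
have xy : ball (map_mx ratr y : 'rV[R]_d) (k.+1%:R^-1) x.
  by split=> // i j; rewrite ord1 !mxE /ball /= distrC; case: (cid _).
exists (c (y, k)); first by split=> //; exists (y, k).
move=> z zk; apply: xeA; rewrite (splitr e); apply: ball_triangle (ball_sym _) _.
  by apply: le_ball (ltW ke) _ xy.
by apply: le_ball (ltW ke) _ zk.
Qed.

Lemma continuous_rV (T : topologicalType) d (g : T -> 'rV[R]_d) :
  (forall i, continuous (fun x => g x 0 i)) -> continuous g.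
Proof.
move=> gc; have -> : g = fun x => \sum_i g x 0 i *: (delta_mx 0 i : 'rV[R]_d).
  by apply/funext => x; exact: row_sum_delta.
apply: continuous_big => [|i _]; first exact: add_continuous.
move=> x; apply: (@continuous_comp _ R _ _ ( *:%R ^~ (delta_mx 0 i : 'rV[R]_d))).
  exact: gc.
exact: scalel_continuous.
Qed.

(** A finite-dimensional space is a retract of some [R^d], which is how it
inherits second countability and compact neighbourhoods. *)
Lemma coords_maps E : has_coords E -> exists d (L : 'rV[R]_d -> E) (P : E -> 'rV[R]_d),
  [/\ continuous L, continuous P & cancel P L].
Proof.
move=> [d [b [phi [phic phiE]]]].
pose L (x : 'rV[R]_d) : E := \sum_i x 0 i *: b i.
exists d, L, (fun w => \row_i phi i w); split.
- rewrite /L; apply: continuous_big => [|i _]; first exact: add_continuous.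
  move=> x; apply: (@continuous_comp _ R _ (fun x : 'rV[R]_d => x 0 i) ( *:%R ^~ (b i))).
    exact: coord_continuous.
  exact: scalel_continuous.
- apply: continuous_rV => i; rewrite (_ : (fun _ => _) = phi i) //.
  by apply/funext => x; rewrite mxE.
- by move=> w; rewrite /L [RHS]phiE; apply: eq_bigr => i _; rewrite mxE.
Qed.

Lemma compact_nbhs E (w : E) A : has_coords E -> nbhs w A ->
  exists K, [/\ nbhs w K, compact K & K `<=` A].
Proof.
move=> /coords_maps [d [L [P [Lc Pc PL]]]] /nbhs_closedballP [r rA].
pose B := closed_ball (P w) 1.
have cB : compact B.
  apply: bounded_closed_compact; last exact: closed_ball_closed.
  rewrite /B closed_ballE //; exists (`|P w| + 1); split; first exact: num_real.
  move=> x x1 y /= Pwy; rewrite -(subrK (P w) y); apply: le_trans (ltW x1).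
  by rewrite addrC; apply: le_trans (ler_normD _ _) _; rewrite lerD2l distrC.
exists (closed_ball w r%:num `&` (P @^-1` B)); split.
- apply: filterI; first by apply/nbhs_closedballP; exists r.
  by apply: Pc; apply/nbhs_closedballP; exists (1%:pos)%R.
- have cLB : compact (L @` B) by apply: continuous_compact => //; exact: continuous_subspaceT.
  apply: (subclosed_compact _ cLB).
    apply: closedI; first exact: closed_ball_closed.
    by apply: preimage_closed; [move=> x _; exact: Pc|exact: closed_ball_closed].
  by move=> x [_ /= PxB]; exists (P x).
- by move=> x [/rA].
Qed.

End Topology.

Section OneChart.
Context {R : realType}.

(** The model manifold and [R^d] are covered by a single chart; topological
properties and smoothness of maps are checked in it. *)
Definition global_chart (X : topologicalType) (E : normedModType R)
    (U : set E) (phi : E -> X) (psi : X -> E) :=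
  [/\ open U, {in U, continuous phi}, continuous psi,
      forall x, U (psi x) /\ phi (psi x) = x & forall y, U y -> psi (phi y) = y].

Variables (X : topologicalType) (E : normedModType R) (U : set E) (phi : E -> X) (psi : X -> E).
Hypothesis Ec : has_coords E.
Hypothesis ch : global_chart U phi psi.

Lemma global_chart_lcompact (x : X) : exists2 K, nbhs x K & compact K.
Proof.
case: ch => oU phic psic psiK phiK; have [Ux xE] := psiK x.
have [K [nK cK KU]] : exists K, [/\ nbhs (psi x) K, compact K & K `<=` U].
  by apply: compact_nbhs => //; exact: open_nbhs_nbhs.
exists (phi @` K).
  suff : nbhs x (psi @^-1` K).
    by apply: filterS => z /= Kz; exists (psi z) => //; case: (psiK z).
  exact: psic.
apply: continuous_compact => //.
apply: continuous_in_subspaceT => z /set_mem /KU Uz; exact/phic/mem_set.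
Qed.

Lemma global_chart_hausdorff : hausdorff_space X.
Proof.
case: ch => oU phic psic psiK phiK.
rewrite open_hausdorff => x y xy.
have pxy : psi x != psi y.
  by apply: contra_neq xy => pxy; rewrite -(psiK x).2 pxy (psiK y).2.
have := @norm_hausdorff _ E; rewrite open_hausdorff => /(_ _ _ pxy).
move=> [[A B] /= [/set_mem Ax /set_mem By] [oA oB /eqP AB]].
exists (psi @^-1` A, psi @^-1` B) => /=; first by rewrite !inE.
split; [by apply: open_comp => // z _; exact: psic|by apply: open_comp => // z _; exact: psic|].
by rewrite -preimage_setI AB preimage_set0.
Qed.

Lemma global_chart_second_countable : @second_countable X.
Proof.
case: ch => oU phic psic psiK phiK.
have [d [L [P [Lc Pc PL]]]] := coords_maps Ec.
apply: (@second_countable_embed _ _ (P \o psi) (phi \o L)) (second_countable_rV d).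
- by move=> x; apply: continuous_comp; [exact: psic|exact: Pc].
- move=> x; apply: continuous_comp; first exact: Lc.
  by rewrite /= PL; apply: phic; rewrite inE; case: (psiK x).
- by move=> x /=; rewrite PL; case: (psiK x).
Qed.

Lemma global_chart_open A : A `<=` U -> open A -> open (phi @` A).
Proof.
case: ch => oU phic psic psiK phiK AU oA.
have -> : phi @` A = psi @^-1` A.
  rewrite eqEsubset; split=> z /=; first by move=> [y Ay <-]; rewrite phiK //; exact: AU.
  by move=> Az; exists (psi z) => //; case: (psiK z).
by apply: open_comp => // z _; exact: psic.
Qed.

Variable S : set (X -> X).
Local Notation G := (generated_group S).
Local Notation proj := (orbit_proj S).
Hypothesis GG : transformation_group G.
Hypothesis Gs : forall g, G g -> smooth_on U (psi \o g \o phi).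

Lemma chart_action_continuous g : G g -> continuous g.
Proof.
case: ch => oU phic psic psiK phiK Gg x.
have -> : g = phi \o (psi \o g \o phi) \o psi.
  by apply/funext => z /=; rewrite (psiK z).2 (psiK (g z)).2.
have [Ux xE] := psiK x.
apply: continuous_comp; first exact: psic.
apply: continuous_comp; last by apply: phic; rewrite inE; case: (psiK (g (phi (psi x)))).
by apply: differentiable_continuous; exact: Ck_diff (Gs Gg 0%N) Ux.
Qed.

Hypothesis Gpd : acts_properly_discontinuously G.
Hypothesis Gfree : acts_freely G.

Local Notation A := [set (U, phi)].

Lemma quotient_parametrization c : quotient_atlas A S c -> parametrization c.
Proof.
case: ch => oU phic psic psiK phiK [c' [-> oc cU cE cinj]]; split => //.
- rewrite cE => y /set_mem /cU Uy; apply: continuous_comp; first exact/phic/mem_set.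
  exact: orbit_proj_continuous.
- move=> O Oc oO; rewrite cE -image_comp; apply: orbit_proj_open => //.
    exact: chart_action_continuous.
  by apply: global_chart_open => // y /Oc /cU.
Qed.

Lemma quotient_chart_at y : U y -> exists c, [/\ quotient_atlas A S c, c.1 y & c.2 = proj \o phi].
Proof.
case: ch => oU phic psic psiK phiK Uy.
have [W [oW Wy] Ww] := wandering_nbhs chart_action_continuous global_chart_lcompact global_chart_hausdorff Gpd Gfree (phi y).
exists (U `&` phi @^-1` W, proj \o phi); split => //.
exists (U, phi); split=> //=.
  rewrite openE => z [Uz Wz]; apply: filterI; first exact: open_nbhs_nbhs.
  by apply: (phic z (mem_set Uz)); exact: open_nbhs_nbhs.
move=> z z' /set_mem [Uz Wz] /set_mem [Uz' Wz'] /= /orbit_projE [g Gg gz].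
have g1 : g = idfun by apply: (Ww g Gg (phi z)) => //; rewrite gz.
by rewrite -(phiK z Uz) -(phiK z' Uz') -gz g1.
Qed.

(** Two parametrizations of the quotient differ, near a common point, by one
element of the group, which is smooth in the chart. *)
Lemma quotient_smooth_manifold : smooth_manifold (quotient_atlas A S).
Proof.
case: (ch) => oU phic psic psiK phiK.
have Gc := chart_action_continuous.
split.
- by apply: orbit_space_hausdorff => //; [exact: global_chart_lcompact|exact: global_chart_hausdorff].
- apply: second_countable_open_image global_chart_second_countable.
  + exact: orbit_proj_continuous.
  + exact: orbit_proj_open.
  + exact: orbit_proj_surj.
- exact: quotient_parametrization.
- rewrite -subTset => m _; have [x <-] := orbit_proj_surj m.
  have [Ux xE] := psiK x; have [c [Ac cx cE]] := quotient_chart_at Ux.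
  by exists c => //; exists (psi x) => //; rewrite cE /= xE.
- move=> c c' [_ [-> oc cU cE cinj]] [_ [-> oc' cU' cE' cinj']] x x' cx cx'.
  rewrite cE cE' /= => /orbit_projE [g Gg gx]; exists (psi \o g \o phi).
    by rewrite /= gx phiK //; exact: cU'.
  near=> y; have Uy : U y by near: y; apply: open_nbhs_nbhs; split=> //; exact: cU.
  split; last exact: smooth_on_cinfty (Gs Gg) Uy.
  by rewrite /= (psiK (g (phi y))).2 orbit_proj_act.
Unshelve. all: by end_near. Qed.

End OneChart.

(** * Lifting of paths and homotopies *)

Section IntervalInduction.
Context {R : realType}.

(** The supremum of the [x] with [P a x] cannot stop before [b]. Applied to
suitable [P], this takes the place of subdividing an interval into pieces
shorter than a Lebesgue number. *)
Lemma interval_additive (P : R -> R -> Prop) :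
  (forall a b c, a <= b -> b <= c -> P a b -> P b c -> P a c) ->
  (forall t, exists2 d, 0 < d & forall a b, t - d < a -> a <= b -> b < t + d -> P a b) ->
  forall a b, a <= b -> P a b.
Proof.
move=> Padd Ploc a b ab; pose A := [set x | [/\ a <= x, x <= b & P a x]].
have Aa : A a.
  have [d d0 dP] := Ploc a; split=> //; apply: dP => //.
    by rewrite ltrBlDr ltrDl.
  by rewrite ltrDl.
have ubA : ubound A b by move=> x [].
have supA : has_sup A by split; [exists a|exists b].
set s := sup A; have [d d0 dP] := Ploc s.
have as_ : a <= s by apply: ub_le_sup => //; exists b.
have [x [ax xb Pax] sx] : exists2 x, A x & s - d < x by apply: sup_adherent.
have xs : x <= s by apply: ub_le_sup; [exists b|].
have sd2 : s < s + d / 2 by rewrite ltrDl divr_gt0.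
have Pmin : P a (Num.min b (s + d / 2)).
  apply: (Padd _ x) => //; first by rewrite le_min xb (le_trans xs) // ltW.
  apply: dP => //; first by rewrite le_min xb (le_trans xs) // ltW.
  rewrite gt_min; apply/orP; right; rewrite ltrD2l.
  by rewrite ltr_pdivrMr // ltr_pMr // ltr1n.
have [bs|sb] := leP b (s + d / 2); first by move: Pmin; rewrite min_l.
have : A (s + d / 2).
  split; [|exact: ltW|by move: Pmin; rewrite min_r // ltW].
  by rewrite (le_trans as_) // ltW.
move=> /(ub_le_sup (ex_intro _ b ubA)).
by rewrite leNgt sd2.
Qed.

(** Paths and homotopies on [[0, 1]] are extended to the real line, constant
outside the interval, so that continuity needs no restriction to a subspace. *)
Definition clamp (a b t : R) := Num.max a (Num.min b t).

Lemma clamp_continuous a b : continuous (clamp a b).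
Proof.
move=> t; rewrite /clamp.
apply: (@continuous_max _ _ (cst a) (fun t => Num.min b t)); first exact: cvg_cst.
apply: (@continuous_min _ _ (cst b) id); [exact: cvg_cst|exact: cvg_id].
Qed.

Lemma clamp_itv a b t : a <= b -> a <= clamp a b t <= b.
Proof. by move=> ab; rewrite /clamp le_max lexx ge_max ab ge_min lexx. Qed.

Lemma clamp_id a b t : a <= t <= b -> clamp a b t = t.
Proof. by move=> /andP[at_ tb]; rewrite /clamp min_r // max_r. Qed.

Lemma continuous_near_itv (T : topologicalType) (c : R -> T) t A : {for t, continuous c} ->
  nbhs (c t) A -> exists2 d, 0 < d & forall x, t - d < x -> x < t + d -> A (c x).
Proof.
move=> cc /cc /nbhs_ballP [d d0 dA]; exists d => // x tx xt; apply: dA.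
by rewrite /ball /= ltr_distlC; apply/andP.
Qed.

Lemma glue_continuous (T : topologicalType) (b : R) (m1 m2 : R -> T) :
  continuous m1 -> continuous m2 -> m1 b = m2 b ->
  continuous (fun t => if t <= b then m1 t else m2 t).
Proof.
move=> c1 c2 m12 t.
have [tb|bt|->] := ltgtP t b.
- have : {for t, continuous m1} by exact: c1.
  rewrite /prop_for /continuous_at (ltW tb); apply: cvg_trans; apply: near_eq_cvg.
  by near=> x; rewrite ifT //; near: x; exact: lt_le_nbhsl.
- have : {for t, continuous m2} by exact: c2.
  rewrite /prop_for /continuous_at leNgt bt /=; apply: cvg_trans; apply: near_eq_cvg.
  by near=> x; rewrite leNgt ifN // negbK; near: x; exact: lt_nbhsr.
- move=> A; rewrite lexx => nA.
  have n1 := c1 b _ nA; have n2 : nbhs b (m2 @^-1` A) by apply: c2; rewrite -m12.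
  have : nbhs b ((m1 @^-1` A) `&` (m2 @^-1` A)) by exact: filterI.
  by apply: filterS => x [A1 A2] /=; case: ifP.
Unshelve. all: by end_near. Qed.

Lemma concat_continuous (T : topologicalType) (m m' : R -> T) :
  continuous m -> continuous m' -> m 1 = m' 0 -> continuous (concat_loops m m').
Proof.
move=> mc mc' mm'.
apply: (glue_continuous (m1 := fun t => m (2 * t)) (m2 := fun t => m' (2 * t - 1))).
- by move=> t; apply: (@continuous_comp _ _ _ (fun t : R => 2 * t) m); [exact: mulrl_continuous|exact: mc].
- move=> t; apply: (@continuous_comp _ _ _ (fun t : R => 2 * t - 1) m'); last exact: mc'.
  by apply: cvgB; [exact: mulrl_continuous|exact: cvg_cst].
- by rewrite mulfV // subrr.
Qed.

Lemma concat0 (T : topologicalType) (m m' : R -> T) : concat_loops m m' 0 = m 0.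
Proof. by rewrite /concat_loops invr_ge0 ler0n mulr0. Qed.

Lemma concat1 (T : topologicalType) (m m' : R -> T) : concat_loops m m' 1 = m' 1.
Proof.
have -> : concat_loops m m' 1 = m' (2 * 1 - 1).
  by rewrite /concat_loops ifF //; apply/negbTE; rewrite -ltNge invf_lt1 // ltr1n.
by congr m'; lra.
Qed.

Lemma concat_clamp (T X : topologicalType) (p : T -> X) (m m' : R -> T) (c c' : R -> X) :
  (forall t, p (m t) = c (clamp 0 1 t)) -> (forall t, p (m' t) = c' (clamp 0 1 t)) ->
  forall t, p (concat_loops m m' t) = concat_loops c c' (clamp 0 1 t).
Proof.
move=> mp mp' t; rewrite /concat_loops; have [t2|t2] := leP t 2^-1.
  rewrite mp ifT; last by rewrite /clamp ge_max invr_ge0 ler0n /= ge_min t2 orbT.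
  congr c; rewrite /clamp (min_r (y := 2 * t)); last by lra.
  by rewrite min_r ?maxr_pMr // ?mulr0 //; lra.
have ct2 : 2^-1 < clamp 0 1 t by rewrite /clamp lt_max lt_min t2 invf_lt1 // ltr1n orbT.
rewrite mp' ifF; last by apply/negbTE; rewrite -ltNge.
congr c'; rewrite /clamp (max_r (y := Num.min 1 t)); last by rewrite le_min ler01; lra.
by have [t1|t1] := leP t 1; [rewrite min_r ?max_r //; lra|rewrite min_l ?max_r //; lra].
Qed.

End IntervalInduction.

Section Covering.
Context {R : realType} {Y X : topologicalType} (p : Y -> X).
Hypothesis pcov : covering_map p.
Implicit Types (c : R -> X) (m : R -> Y).

(** [W] is the set of sheets over [U]. *)
Definition evenly_covered (U : set X) (W : set (set Y)) :=
  [/\ open U, p @^-1` U = \bigcup_(V in W) V, trivIset W id &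
      forall V, W V -> [/\ open V, set_bij V U p &
                forall O, O `<=` V -> open O -> open (p @` O)]].

Lemma evenly_coveredP x : exists U W, evenly_covered U W /\ U x.
Proof.
case: pcov => _ _ /(_ x) [U [oU Ux [W [W1 W2 W3]]]].
by exists U, W; split.
Qed.

Lemma sheet_at U W y : evenly_covered U W -> U (p y) -> exists2 V, W V & V y.
Proof.
move=> [_ UW _ _] Upy; have : (p @^-1` U) y by [].
by rewrite UW => -[V WV Vy]; exists V.
Qed.

Lemma sheet_inj U W V y y' : evenly_covered U W -> W V -> V y -> V y' -> p y = p y' -> y = y'.
Proof.
by move=> [_ _ _ H] /H [_ [_ inj _] _] Vy Vy' pyy'; apply: inj => //; exact/mem_set.
Qed.

Lemma sheet_eq U W V V' y : evenly_covered U W -> W V -> W V' -> V y -> V' y -> V = V'.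
Proof. by move=> [_ _ tW _] WV WV' Vy V'y; apply: (tW V V') => //; exists y. Qed.

(** The sheets over [U] are open and disjoint, so the sheet that contains [m t]
is a locally constant function of [t]. *)
Lemma path_in_sheet U W V m a b : evenly_covered U W -> W V -> continuous m ->
  (forall t, U (p (m t))) -> a <= b -> V (m a) -> V (m b).
Proof.
move=> UW WV mc Um ab; apply: (interval_additive (P := fun x y => V (m x) -> V (m y))) ab.
  by move=> x y z _ _ xy yz /xy /yz.
move=> t; have [V' WV' V't] := sheet_at UW (Um t).
have nV' : nbhs (m t) V' by apply: open_nbhs_nbhs; split=> //; case: UW => _ _ _ /(_ _ WV') [].
have [d d0 dV] := continuous_near_itv (mc t) nV'.
exists d => // x y tx xy yt Vx; have V'x : V' (m x) by apply: dV => //; exact: le_lt_trans yt.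
rewrite (sheet_eq UW WV WV' Vx V'x); apply: dV => //; exact: lt_le_trans xy.
Qed.

(** If two lifts agree at one time, they are in the same sheet at nearby times,
and [p] is injective on that sheet. *)
Lemma lift_unique m m' a b : continuous m -> continuous m' -> (forall t, p (m t) = p (m' t)) ->
  a <= b -> m a = m' a -> m b = m' b.
Proof.
move=> mc mc' pm ab; apply: (interval_additive (P := fun x y => m x = m' x -> m y = m' y)) ab.
  by move=> x y z _ _ xy yz /xy /yz.
move=> t; have [U [W [UW Umt]]] := evenly_coveredP (p (m t)).
have [V WV Vt] := sheet_at UW Umt.
have [V' WV' V't] : exists2 V, W V & V (m' t) by apply: sheet_at UW _; rewrite -pm.
have oW O : W O -> open O by case: UW => _ _ _ H /H [].
have nV : nbhs (m t) V by apply: open_nbhs_nbhs; split=> //; exact: oW.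
have nV' : nbhs (m' t) V' by apply: open_nbhs_nbhs; split=> //; exact: oW.
have [d d0 dV] := continuous_near_itv (mc t) nV.
have [d' d'0 dV'] := continuous_near_itv (mc' t) nV'.
exists (Num.min d d'); first by rewrite lt_min d0 d'0.
move=> x y tx xy yt mx.
have [tx1 tx2] : t - d < x /\ t - d' < x.
  by split; apply: le_lt_trans tx; rewrite lerD2l lerN2 ge_min lexx ?orbT.
have [yt1 yt2] : y < t + d /\ y < t + d'.
  by split; apply: lt_le_trans yt _; rewrite lerD2l ge_min lexx ?orbT.
have Vx : V (m x) by apply: dV => //; exact: le_lt_trans yt1.
have V'x : V' (m' x) by apply: dV' => //; exact: le_lt_trans yt2.
rewrite -mx in V'x; have VV' := sheet_eq UW WV WV' Vx V'x.
have Vy : V (m y) by apply: dV => //; exact: lt_le_trans xy.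
have V'y : V' (m' y) by apply: dV' => //; exact: lt_le_trans xy.
by rewrite -VV' in V'y; apply: sheet_inj UW WV Vy V'y (pm y).
Qed.

(** The lift is [c] followed by the inverse of [p] on the sheet through [y],
which is continuous because [p] is open there. *)
Lemma lift_in_evenly_covered U W c y : evenly_covered U W -> continuous c ->
  (forall t, U (c t)) -> forall a, p y = c a -> exists m, [/\ continuous m, m a = y & forall t, p (m t) = c t].
Proof.
move=> UW cc Uc a pya; have Upy : U (p y) by rewrite pya.
have [V WV Vy] := sheet_at UW Upy.
have [oV [_ _ surj] po] : [/\ open V, set_bij V U p & forall O, O `<=` V -> open O -> open (p @` O)].
  by case: UW => _ _ _; apply.
have ex t : exists v, V v /\ p v = c t by have [v Vv pv] := surj _ (Uc t); exists v.
pose m t := sval (cid (ex t)).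
have mP t : V (m t) /\ p (m t) = c t by rewrite /m; case: (cid _).
exists m; split; last by move=> t; case: (mP t).
- move=> t A; rewrite nbhsE => - [Q [oO Ot] OA].
  have oOV : open (p @` (Q `&` V)) by apply: po; [exact: subIsetr|exact: openI].
  have nct : nbhs (c t) (p @` (Q `&` V)).
    by apply: open_nbhs_nbhs; split=> //; exists (m t); [split=> //; case: (mP t)|case: (mP t)].
  have {}nct : nbhs t (c @^-1` (p @` (Q `&` V))) := cc t _ nct.
  suff : nbhs t (m @^-1` A) by [].
  apply: filterS nct => s [v [Ov Vv] pv]; apply: OA.
  have [Vs ps] := mP s.
  by rewrite (sheet_inj UW WV Vs Vv) // ps pv.
- by have [Va pa] := mP a; apply: sheet_inj UW WV Va Vy _; rewrite pa pya.
Qed.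

(** On short intervals the path stays in an evenly covered set; the lifts over
them are glued one after the other. *)
Lemma lift_exists c y : continuous c -> (forall t, c (clamp 0 1 t) = c t) -> p y = c 0 ->
  exists m, [/\ continuous m, m 0 = y, forall t, p (m t) = c t & forall t, m (clamp 0 1 t) = m t].
Proof.
move=> cc cclamp py0.
pose P a b := forall y, p y = c a ->
  exists m, [/\ continuous m, m a = y & forall t, a <= t <= b -> p (m t) = c t].
have : P 0 1.
  apply: interval_additive (ler01) => [a b d ab bd Pab Pbd z pz|t].
    have [m1 [m1c m1a m1p]] := Pab z pz.
    have pm1b : p (m1 b) = c b by apply: m1p; rewrite ab lexx.
    have [m2 [m2c m2b m2p]] := Pbd _ pm1b.
    exists (fun t => if t <= b then m1 t else m2 t); split.
    - exact: glue_continuous.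
    - by rewrite ab.
    - move=> t /andP[at_ td]; have [tb|bt] := leP t b; first by apply: m1p; rewrite at_.
      by apply: m2p; rewrite ltW.
  have [U [W [UW Uct]]] := evenly_coveredP (c t).
  have nU : nbhs (c t) U by apply: open_nbhs_nbhs; split=> //; case: UW.
  have [d d0 dU] := continuous_near_itv (cc t) nU.
  exists d => // a b ta ab bt z pz.
  have caa : clamp a b a = a by rewrite clamp_id // lexx ab.
  have [|||m [mc ma mp]] := @lift_in_evenly_covered U W (fun x => c (clamp a b x)) z UW _ _ a _.
  - by move=> x; apply: continuous_comp; [exact: clamp_continuous|exact: cc].
  - by move=> x; have /andP[ax xb] := clamp_itv x ab; apply: dU; [exact: lt_le_trans ax|exact: le_lt_trans bt].
  - by rewrite caa.
  by exists m; split=> // x axb; rewrite mp clamp_id.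
move=> /(_ y py0) [m [mc m0 mp]].
exists (fun t => m (clamp 0 1 t)); split.
- by move=> x; apply: continuous_comp; [exact: clamp_continuous|exact: mc].
- by rewrite clamp_id // lexx ler01.
- by move=> t; rewrite mp ?clamp_itv.
- by move=> t; rewrite [in LHS](@clamp_id R 0 1 (clamp 0 1 t)) ?clamp_itv.
Qed.

(** The end point of the lift is a locally constant function of the parameter:
for [s] close to [s0] the lift of [H (s, _)] passes through the same sheets
as that of [H (s0, _)], and the last sheet contains only one point over
[x1]. *)
Lemma lift_homotopy (H : R * R -> X) (m : R -> R -> Y) y0 x1 :
  continuous H -> (forall s, continuous (m s)) -> (forall s t, p (m s t) = H (s, t)) ->
  (forall s, m s 0 = y0) -> (forall s, H (s, 1) = x1) ->
  forall s s', s <= s' -> m s 1 = m s' 1.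
Proof.
move=> Hc mc mH m0 H1 s s' ss'.
apply: (interval_additive (P := fun s s' => m s 1 = m s' 1)) ss'.
  by move=> r1 r2 r3 _ _ -> ->.
move=> s0.
(* P a b: the lifts follow [m s0] from time [a] to time [b], up to an
   arbitrarily small neighbourhood of [m s0 b] *)
pose P a b := forall W, open W -> W (m s0 b) -> exists V, [/\ open V, V (m s0 a) &
  \forall s \near s0, V (m s a) -> W (m s b)].
have P01 : P 0 1.
  apply: interval_additive (ler01) => [a b d _ _ Pab Pbd W oW Wd|t].
    have [V [oV Vb sV]] := Pbd W oW Wd; have [V' [oV' V'a sV']] := Pab V oV Vb.
    by exists V'; split=> //; apply: filterS2 sV sV' => r f g /g /f.
  have [U [F [UF Ut]]] := evenly_coveredP (H (s0, t)).
  have [V FV Vt] : exists2 V, F V & V (m s0 t) by apply: sheet_at UF _; rewrite mH.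
  have [oV _ Vp] : [/\ open V, set_bij V U p & forall O, O `<=` V -> open O -> open (p @` O)].
    by case: UF => _ _ _; apply.
  have oU : open U by case: UF.
  have [d1 d10 d1V] := continuous_near_itv (mc s0 t) (open_nbhs_nbhs (conj oV Vt)).
  have [d2 /= d20 d2U] : exists2 e, 0 < e & ball (s0, t) e `<=` H @^-1` U.
    by apply/nbhs_ballP; apply: Hc; exact: open_nbhs_nbhs.
  exists (Num.min d1 d2); first by rewrite lt_min d10 d20.
  move=> a b ta ab bt W oW Wb.
  have tx x : a <= x <= b -> V (m s0 x) /\ ball t d2 x.
    move=> /andP[ax xb]; split; first apply: d1V.
    - by apply: lt_le_trans ax; apply: le_lt_trans ta; rewrite lerD2l lerN2 ge_min lexx.
    - by apply: le_lt_trans xb _; apply: lt_le_trans bt _; rewrite lerD2l ge_min lexx.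
    rewrite /ball /= ltr_distlC; apply/andP; split.
    - by apply: lt_le_trans ax; apply: le_lt_trans ta; rewrite lerD2l lerN2 ge_min lexx orbT.
    - by apply: le_lt_trans xb _; apply: lt_le_trans bt _; rewrite lerD2l ge_min lexx orbT.
  have [Va _] := tx a (introT andP (conj (lexx a) ab)).
  have [Vb _] := tx b (introT andP (conj ab (lexx b))).
  exists V; split=> //.
  have oWV : open (p @` (W `&` V)) by apply: Vp; [exact: subIsetr|exact: openI].
  have nb : \forall s \near s0, (p @` (W `&` V)) (H (s, b)).
    have Hb : {for s0, continuous (fun s => H (s, b))}.
      apply: (@continuous_comp _ _ _ (fun s => (s, b)) H); last exact: Hc.
      exact: (cvg_pair (@cvg_id _ (nbhs s0)) (cvg_cst b)).
    by apply: Hb; apply: open_nbhs_nbhs; split=> //; exists (m s0 b).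
  have nd : \forall s \near s0, ball s0 d2 s by apply: nbhsx_ballx.
  apply: filterS2 nb nd => r [w [Ww Vw] pw] sd Vsa.
  have Vsb : V (m r b).
    rewrite -(@clamp_id R a b b) ?ab ?lexx //.
    apply: (@path_in_sheet U F V (fun x => m r (clamp a b x)) a b UF FV) => //.
    - by move=> x; apply: continuous_comp; [exact: clamp_continuous|exact: mc].
    - move=> x; rewrite mH; apply: d2U; split=> //=.
      by case: (tx _ (clamp_itv x ab)).
    - by rewrite clamp_id // lexx ab.
  by rewrite -(sheet_inj UF FV Vw Vsb) // pw mH.
have [U [F [UF Ut]]] := evenly_coveredP (p (m s0 1)).
have [V FV V1] := sheet_at UF Ut.
have oV : open V by case: UF => _ _ _ /(_ _ FV) [].
have [V' [_ V'0 nV']] := P01 V oV V1.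
have {}nV' : \forall s \near s0, m s 1 = m s0 1.
  apply: filterS nV' => r; rewrite m0 -(m0 s0) => /(_ V'0) Vs1.
  by apply: sheet_inj UF FV Vs1 V1 _; rewrite !mH !H1.
have /nbhs_ballP [e /= e0 eV] := nV'.
exists e => // a b sa ab bs.
rewrite (eV a) ?(eV b) // /ball /= ltr_distlC.
  by rewrite (lt_le_trans sa ab) bs.
by rewrite sa (le_lt_trans ab bs).
Qed.

End Covering.

(** * The fundamental group of an orbit space *)

Section Convex.
Context {R : realType} {Y : topologicalType} {E : normedModType R}.
Variables (U : set E) (phi : E -> Y) (psi : Y -> E).
Hypothesis ch : global_chart U phi psi.
Hypothesis Uconvex : forall x y t, U x -> U y -> 0 <= t <= 1 -> U ((1 - t) *: x + t *: y).

Definition segment_path (y y' : Y) (s : R) : Y :=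
  phi ((1 - clamp 0 1 s) *: psi y + clamp 0 1 s *: psi y').

(** Homotopies along segments of the convex set [U]: they make the space simply
connected. *)
Lemma segment_path_continuous (m m' : R -> Y) : continuous m -> continuous m' ->
  continuous (fun st : R * R => segment_path (m st.2) (m' st.2) st.1).
Proof.
case: ch => oU phic psic psiK phiK mc m'c x; rewrite /segment_path.
have c1 : {for x, continuous (fun st : R * R => clamp 0 1 st.1)}.
  apply: (@continuous_comp _ _ _ fst (clamp 0 1)); first exact: cvg_fst.
  exact: clamp_continuous.
have cm (n : R -> Y) : continuous n -> {for x, continuous (fun st : R * R => psi (n st.2))}.
  move=> nc; apply: (@continuous_comp _ _ _ (fun st => n st.2) psi); last exact: psic.
  apply: (@continuous_comp _ _ _ snd n); [exact: cvg_snd|exact: nc].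
apply: (@continuous_comp _ _ _ (fun st => (1 - clamp 0 1 st.1) *: psi (m st.2) + clamp 0 1 st.1 *: psi (m' st.2)) phi).
  apply: cvgD; apply: cvgZ; [|exact: cm|exact: c1|exact: cm].
  by apply: cvgB; [exact: cvg_cst|exact: c1].
by apply/phic/mem_set; apply: Uconvex; [exact: (psiK _).1|exact: (psiK _).1|exact: clamp_itv].
Qed.

Lemma segment_path_continuous1 y y' : continuous (segment_path y y').
Proof.
move=> x; have := @segment_path_continuous (cst y) (cst y') (@cst_continuous _ _ _) (@cst_continuous _ _ _) (x, 0).
move=> sc; apply: (@continuous_comp _ _ _ (fun s => (s, 0)) (fun st : R * R => segment_path y y' st.1)); last exact: sc.
exact: (cvg_pair (@cvg_id _ (nbhs x)) (cvg_cst (0 : R))).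
Qed.

Lemma segment_path0 y y' s : s <= 0 -> segment_path y y' s = y.
Proof.
move=> s0; case: ch => _ _ _ psiK _.
rewrite /segment_path (_ : clamp 0 1 s = 0) ?subr0 ?scale1r ?scale0r ?addr0; last first.
  by rewrite /clamp min_r ?(le_trans s0) // max_l.
exact: (psiK y).2.
Qed.

Lemma segment_path1 y y' s : 1 <= s -> segment_path y y' s = y'.
Proof.
move=> s1; case: ch => _ _ _ psiK _.
rewrite /segment_path (_ : clamp 0 1 s = 1) ?subrr ?scale1r ?scale0r ?add0r; last first.
  by rewrite /clamp min_l // max_r.
exact: (psiK y').2.
Qed.

Lemma segment_path_same y s : segment_path y y s = y.
Proof.
case: ch => _ _ _ psiK _; rewrite /segment_path -scalerDl subrK scale1r; exact: (psiK y).2.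
Qed.

Lemma segment_path_clamp y y' s : segment_path y y' (clamp 0 1 s) = segment_path y y' s.
Proof. by rewrite /segment_path (@clamp_id R 0 1 (clamp 0 1 s)) ?clamp_itv. Qed.

End Convex.

Section FundamentalGroup.
Context {R : realType} {Y : topologicalType} {E : normedModType R}.
Variables (U : set E) (phi : E -> Y) (psi : Y -> E) (S : set (Y -> Y)).
Hypothesis ch : global_chart U phi psi.
Hypothesis Uconvex : forall x y t, U x -> U y -> 0 <= t <= 1 -> U ((1 - t) *: x + t *: y).
Local Notation G := (generated_group S).
Local Notation proj := (orbit_proj S).
Hypothesis GG : transformation_group G.
Hypothesis Gc : forall g, G g -> continuous g.
Hypothesis pcov : covering_map proj.
Hypothesis Gfree : acts_freely G.

Lemma free_eq g g' y : G g -> G g' -> g y = g' y -> g = g'.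
Proof.
move=> Gg Gg' gy; case: (GG) => _ Gcomp Ginv; have [h [Gh gh hg]] := Ginv _ Gg'.
have h1 : h \o g = idfun by apply: (Gfree (Gcomp _ _ Gh Gg) (x := y)); rewrite /= gy gh.
by apply/funext => z; rewrite -[LHS]hg; have /= -> := congr1 (@^~ z) h1.
Qed.

(** [g] is the deck transformation determined by the loop [c] and the base point
[y0] of the covering space. *)
Definition monodromy (y0 : Y) (c : R -> orbit_space S) (g : Y -> Y) :=
  G g /\ exists m : R -> Y, [/\ continuous m, m 0 = y0, m 1 = g y0 &
                                forall t, proj (m t) = c (clamp 0 1 t)].

Lemma monodromy_unique y0 c g g' : monodromy y0 c g -> monodromy y0 c g' -> g = g'.
Proof.
move=> [Gg [m [mc m0 m1 mp]]] [Gg' [m' [mc' m0' m1' mp']]].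
apply: (free_eq Gg Gg' (y := y0)); rewrite -m1 -m1'.
by apply: (lift_unique pcov mc mc') (ler01) _; [move=> t; rewrite mp mp'|rewrite m0 m0'].
Qed.

Lemma within_clamp (X : topologicalType) (c : R -> X) :
  {within `[0, 1], continuous c} -> continuous (fun t => c (clamp 0 1 t)).
Proof.
move=> /subspace_continuousP cc t A nA.
have ct : `[(0:R), 1]%classic (clamp 0 1 t) by rewrite /= in_itv /= clamp_itv.
have := cc _ ct A nA; rewrite /= => nA'.
have : nbhs t ((clamp 0 1) @^-1` [set x | `[(0:R), 1]%classic x -> A (c x)]).
  exact: clamp_continuous.
by apply: filterS => s; apply; rewrite /= in_itv /= clamp_itv.
Qed.

Lemma within_clamp2 (X : topologicalType) (H : R * R -> X) :
  {within `[0, 1] `*` `[0, 1], continuous H} ->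
  continuous (fun st : R * R => H (clamp 0 1 st.1, clamp 0 1 st.2)).
Proof.
move=> /subspace_continuousP cc t A nA.
have ct : (`[(0:R), 1] `*` `[(0:R), 1]) (clamp 0 1 t.1, clamp 0 1 t.2).
  by split; rewrite /= in_itv /= clamp_itv.
have := cc _ ct A nA; rewrite /= => nA'.
have cl : continuous (fun st : R * R => (clamp 0 1 st.1 : R, clamp 0 1 st.2 : R)).
  move=> z.
  have z1 : {for z, continuous (fun st : R * R => clamp 0 1 st.1)}.
    by apply: (@continuous_comp _ _ _ fst (clamp 0 1)); [exact: cvg_fst|exact: clamp_continuous].
  have z2 : {for z, continuous (fun st : R * R => clamp 0 1 st.2)}.
    by apply: (@continuous_comp _ _ _ snd (clamp 0 1)); [exact: cvg_snd|exact: clamp_continuous].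
  exact: (cvg_pair z1 z2).
have : nbhs t ((fun st : R * R => (clamp 0 1 st.1 : R, clamp 0 1 st.2 : R)) @^-1`
    [set x | (`[(0:R), 1] `*` `[(0:R), 1]) x -> A (H x)]) by exact: cl.
by apply: filterS => s; apply; split; rewrite /= in_itv /= clamp_itv.
Qed.

Lemma monodromy_exists y0 c : loop_at (proj y0) c -> exists g, monodromy y0 c g.
Proof.
move=> [cc c0 c1].
have [||m [mc m0 mp _]] := @lift_exists R _ _ _ pcov (fun t => c (clamp 0 1 t)) y0 (within_clamp cc).
- by move=> t; rewrite (@clamp_id R 0 1 (clamp 0 1 t)) ?clamp_itv.
- by rewrite clamp_id ?lexx ?ler01 // c0.
have : proj y0 = proj (m 1) by rewrite mp clamp_id ?lexx ?ler01 // c1.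
by move=> /orbit_projE [g Gg gy]; exists g; split=> //; exists m.
Qed.

(** The isomorphism is the monodromy. It is onto, since the image of the segment
from [y0] to [g y0] is a loop. Loops with the same monodromy have lifts with
the same end points, which are homotopic along segments; homotopic loops
have the same monodromy by [lift_homotopy]. The lift of a concatenation is
the first lift followed by the [g]-translate of the second, where [g] is the
monodromy of the first loop. *)
Lemma orbit_space_fundamental_group (x : orbit_space S) : fundamental_group_is R G x.
Proof.
have [y0 <-] := orbit_proj_surj x.
have pc : continuous proj by exact: orbit_proj_continuous.
pose Phi c := if pselect (exists g, monodromy y0 c g) is left ex then sval (cid ex) else idfun.
have PhiE c g : monodromy y0 c g -> Phi c = g.
  rewrite /Phi; case: pselect => [ex|nex] cg; last by case: nex; exists g.
  by case: (cid ex) => g' /= cg'; exact: monodromy_unique cg' cg.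
exists Phi.
split.
- rewrite eqEsubset; split=> [_ [c lc <-]|g Gg].
    by have [g cg] := monodromy_exists lc; rewrite (PhiE _ _ cg); case: cg.
  pose m := segment_path phi psi y0 (g y0).
  have mc : continuous m by exact: segment_path_continuous1 ch Uconvex _ _.
  have m0 : m 0 = y0 by exact: segment_path0 ch _ _ _ _.
  have m1 : m 1 = g y0 by exact: segment_path1 ch _ _ _ _.
  exists (proj \o m); last first.
    apply: PhiE; split=> //; exists m; split=> // t; rewrite /= /m segment_path_clamp //.
  split; rewrite /= ?m0 ?m1 ?orbit_proj_act //.
  by apply: continuous_subspaceT => t; apply: continuous_comp; [exact: mc|exact: pc].
- move=> c c' lc lc'; have [g cg] := monodromy_exists lc; have [g' cg'] := monodromy_exists lc'.
  rewrite (PhiE _ _ cg) (PhiE _ _ cg'); split.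
    move=> gg'; rewrite -gg' in cg'; case: cg => Gg [m [mc m0 m1 mp]].
    case: cg' => _ [m' [mc' m0' m1' mp']].
    exists (fun st => proj (segment_path phi psi (m st.2) (m' st.2) st.1)); split.
    + apply: continuous_subspaceT => st; apply: continuous_comp; last exact: pc.
      exact: (segment_path_continuous ch Uconvex).
    + by move=> t t01; rewrite /= (segment_path0 ch) // mp clamp_id.
    + by move=> t t01; rewrite /= (segment_path1 ch) // mp' clamp_id.
    + by move=> s _ /=; rewrite m0 m0' m1 m1' !(segment_path_same ch) orbit_proj_act.
  move=> [H [Hc H0 H1 Hs]].
  pose H' (st : R * R) := H (clamp 0 1 st.1, clamp 0 1 st.2).
  have Hc' : continuous H' by exact: within_clamp2.
  have c01 (s : R) : clamp 0 1 s \in `[0, 1] by rewrite in_itv /= clamp_itv.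
  have cl0 : clamp 0 1 0 = 0 :> R by rewrite clamp_id ?lexx ?ler01.
  have cl1 : clamp 0 1 1 = 1 :> R by rewrite clamp_id ?lexx ?ler01.
  have ex s : exists m : R -> Y, [/\ continuous m, m 0 = y0 & forall t, proj (m t) = H' (s, t)].
    have [|||m [mc m0 mp _]] := @lift_exists R _ _ _ pcov (fun t => H' (s, t)) y0 _ _ _.
    - move=> t; apply: (@continuous_comp _ _ _ (fun t => (s, t)) H'); last exact: Hc'.
      exact: (cvg_pair (cvg_cst s) (@cvg_id _ (nbhs t))).
    - by move=> t; rewrite /H' /= (@clamp_id R 0 1 (clamp 0 1 t)) ?clamp_itv.
    - by rewrite /H' /= cl0 (Hs _ (c01 s)).1.
    by exists m.
  pose m s := sval (cid (ex s)).
  have mP s : [/\ continuous (m s), m s 0 = y0 & forall t, proj (m s t) = H' (s, t)].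
    by rewrite /m; case: (cid _).
  have m01 : m 0 1 = m 1 1.
    apply: (@lift_homotopy R _ _ _ pcov H' m y0 (proj y0)) => //.
    - by move=> s; case: (mP s).
    - by move=> s; case: (mP s).
    - by move=> s; case: (mP s).
    - by move=> s; rewrite /H' /= cl1 (Hs _ (c01 s)).2.
  case: cg cg' => Gg [n [nc n0 n1 np]] [Gg' [n' [nc' n0' n1' np']]].
  have e0 : m 0 1 = n 1.
    have [mc m0 mp] := mP 0; apply: (lift_unique pcov mc nc) (ler01) _; last by rewrite m0 n0.
    by move=> t; rewrite mp np /H' /= cl0 H0.
  have e1 : m 1 1 = n' 1.
    have [mc m0 mp] := mP 1; apply: (lift_unique pcov mc nc') (ler01) _; last by rewrite m0 n0'.
    by move=> t; rewrite mp np' /H' /= cl1 H1.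
  by apply: (free_eq Gg Gg' (y := y0)); rewrite -n1 -n1' -e0 -e1.
- move=> c c' lc lc'; have [g cg] := monodromy_exists lc; have [g' cg'] := monodromy_exists lc'.
  rewrite (PhiE _ _ cg) (PhiE _ _ cg'); apply: PhiE.
  case: cg cg' => Gg [m [mc m0 m1 mp]] [Gg' [m' [mc' m0' m1' mp']]].
  split; first by case: (GG) => _ Gcomp _; exact: Gcomp.
  exists (concat_loops m (g \o m')); split.
  + apply: concat_continuous => //; last by rewrite /= m1 m0'.
    by move=> t; apply: continuous_comp; [exact: mc'|exact: Gc].
  + by rewrite concat0.
  + by rewrite concat1 /= m1'.
  + by apply: concat_clamp => // t; rewrite /= orbit_proj_act.
Qed.

End FundamentalGroup.

(** * Coverings of orbit spaces by compact orbit spaces of abelian groups *)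

(** Every point has a neighbourhood on which [q] is injective, so it contains at
most one point of the fibre; finitely many of these neighbourhoods cover
[T]. *)
Lemma covering_finite_fibre {T X : topologicalType} (q : T -> X) x :
  covering_map q -> compact [set: T] -> finite_set (q @^-1` [set x]).
Proof.
move=> qcov cT.
have ex t : exists2 V, open_nbhs t V & forall t1 t2, V t1 -> V t2 -> q t1 = q t2 -> t1 = t2.
  have [U [F [UF Ut]]] := evenly_coveredP qcov (q t); have [V FV Vt] := sheet_at UF Ut.
  exists V; first by split=> //; case: UF => _ _ _ /(_ _ FV) [].
  by move=> t1 t2; exact: sheet_inj UF FV.
pose V t := s2val (cid2 (ex t)).
have VP t : open_nbhs t (V t) /\ forall t1 t2, V t t1 -> V t t2 -> q t1 = q t2 -> t1 = t2.
  by rewrite /V; case: (cid2 _).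
have [[t0 _]|nT] := pselect (exists t : T, True); last first.
  by rewrite (_ : q @^-1` _ = set0) // -subset0 => t _; apply: nT; exists t.
(* [T] is inhabited and can be pointed, as the finite subcover requires *)
pose pM := isPointed.Build T t0; pose pT : ptopologicalType := HB.pack (T : Type) T pM.
have : @cover_compact pT setT by rewrite -compact_cover; exact: cT.
move=> /(_ T setT V) [t _|t _|D _ DT].
- by case: (VP t) => -[].
- by exists t => //; case: (VP t) => -[].
pose k t := if pselect (exists t', V t t' /\ q t' = x) is left e then sval (cid e) else t.
have := finite_fset D; set A := (X in finite_set X) => finA.
have fin : finite_set (k @` A) by exact: finite_image.
apply: (sub_finite_set _ fin).
move=> t /= qt; have [d Dd dt] := DT t I; exists d => //.
rewrite /k; case: pselect => [e|ne]; last by case: ne; exists t.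
by case: (cid e) => t' /= [Vt' qt']; apply: (VP d).2 => //; rewrite qt' qt.
Qed.

Section AbelianCover.
Context {R : realType} {Y Z : topologicalType} {E F : normedModType R}.
Variables (U : set E) (phi : E -> Y) (psi : Y -> E) (S : set (Y -> Y)).
Variables (U' : set F) (phi' : F -> Z) (psi' : Z -> F) (S' : set (Z -> Z)).
Hypothesis ch : global_chart U phi psi.
Hypothesis Uconvex : forall x y t, U x -> U y -> 0 <= t <= 1 -> U ((1 - t) *: x + t *: y).
Hypothesis ch' : global_chart U' phi' psi'.
Hypothesis U'convex : forall x y t, U' x -> U' y -> 0 <= t <= 1 -> U' ((1 - t) *: x + t *: y).
Local Notation G := (generated_group S).
Local Notation proj := (orbit_proj S).
Local Notation D := (generated_group S').
Local Notation proj' := (orbit_proj S').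
Hypothesis GG : transformation_group G.
Hypothesis Gc : forall g, G g -> continuous g.
Hypothesis pcov : covering_map proj.
Hypothesis Gfree : acts_freely G.
Hypothesis DD : transformation_group D.
Hypothesis Dc : forall g, D g -> continuous g.
Hypothesis pcov' : covering_map proj'.
Hypothesis Dab : abelian_group D.
Hypothesis Tcompact : compact [set: orbit_space S'].
Variables (q : orbit_space S' -> orbit_space S) (z0 : Z) (y0 : Y).
Hypothesis qcov : covering_map q.
Local Notation P := (q \o proj').
Hypothesis Pz0 : P z0 = proj y0.

Let Pc : continuous P.
Proof.
move=> z; apply: continuous_comp; first exact: orbit_proj_continuous.
by have [qc _ _] := qcov; exact: qc.
Qed.

(** [Z] and [Y] are the universal covers of the two orbit spaces. This relation
is the graph of the lift of [q] to a map from [Z] to [Y] that sends [z0] to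
[y0]: a path from [z0] to [z] is projected, mapped by [q] and lifted from
[y0]. *)
Definition developed (z : Z) (y : Y) :=
  exists (s : R -> Z) (m : R -> Y), [/\ continuous s, continuous m,
    s 0 = z0 /\ m 0 = y0, s 1 = z /\ m 1 = y & forall t, proj (m t) = P (s (clamp 0 1 t))].

Let cl0 : clamp 0 1 0 = 0 :> R. Proof. by rewrite clamp_id ?lexx ?ler01. Qed.
Let cl1 : clamp 0 1 1 = 1 :> R. Proof. by rewrite clamp_id ?lexx ?ler01. Qed.
Let clcl (t : R) : clamp 0 1 (clamp 0 1 t) = clamp 0 1 t :> R.
Proof. by rewrite clamp_id ?clamp_itv. Qed.

Lemma developed_total z : exists y, developed z y.
Proof.
pose s := segment_path phi' psi' z0 z.
have sc : continuous s by exact: (segment_path_continuous1 ch' U'convex).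
have sE t : s (clamp 0 1 t) = s t by exact: segment_path_clamp.
have s0 : s 0 = z0 by exact: (segment_path0 ch').
have s1 : s 1 = z by exact: (segment_path1 ch').
have [|||m [mc m0 mp _]] := @lift_exists R _ _ _ pcov (P \o s) y0 _ _ _.
- by move=> t; apply: continuous_comp; [exact: sc|exact: Pc].
- by move=> t; rewrite /= sE.
- by rewrite /= s0.
by exists (m 1), s, m; split=> // t; rewrite mp /= sE.
Qed.

(** A path from [y0] to [y] is lifted first along [q] and then to [Z]. *)
Lemma developed_onto y : exists z, developed z y.
Proof.
pose m := segment_path phi psi y0 y.
have mc : continuous m by exact: (segment_path_continuous1 ch Uconvex).
have mE t : m (clamp 0 1 t) = m t by exact: segment_path_clamp.
have m0 : m 0 = y0 by exact: (segment_path0 ch).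
have m1 : m 1 = y by exact: (segment_path1 ch).
have [|||n [nc n0 np nE]] := @lift_exists R _ _ _ qcov (proj \o m) (proj' z0) _ _ _.
- by move=> t; apply: continuous_comp; [exact: mc|exact: orbit_proj_continuous].
- by move=> t; rewrite /= mE.
- by rewrite /= m0.
have [|s [sc s0 sp sE]] := @lift_exists R _ _ _ pcov' n z0 nc nE _; first by rewrite n0.
by exists (s 1), s, m; split=> // t; rewrite sE /= sp np.
Qed.

(** Two paths from [z0] to [z] are homotopic along segments, so the lifts of
their images have the same end point. *)
Lemma developed_unique z y y' : developed z y -> developed z y' -> y = y'.
Proof.
move=> [s [m [sc mc [s0 m0] [s1 m1] mp]]] [s' [m' [sc' mc' [s0' m0'] [s1' m1'] mp']]].
pose H (st : R * R) := P (segment_path phi' psi' (s (clamp 0 1 st.2)) (s' (clamp 0 1 st.2)) st.1).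
have scl (r : R -> Z) : continuous r -> continuous (r \o clamp 0 1).
  by move=> rc t; apply: continuous_comp; [exact: clamp_continuous|exact: rc].
have Hc : continuous H.
  have sgc := segment_path_continuous ch' U'convex (scl _ sc) (scl _ sc').
  by move=> st; exact: (continuous_comp (sgc st) (@Pc _)).
have ex r : exists n : R -> Y, [/\ continuous n, n 0 = y0 & forall t, proj (n t) = H (r, t)].
  have [|||n [nc n0 np _]] := @lift_exists R _ _ _ pcov (fun t => H (r, t)) y0 _ _ _.
  - move=> t; apply: (@continuous_comp _ _ _ (fun t => (r, t)) H); last exact: Hc.
    exact: (cvg_pair (cvg_cst r) (@cvg_id _ (nbhs t))).
  - by move=> t; rewrite /H /= clcl.
  - by rewrite /H /= cl0 s0 s0' (segment_path_same ch') -Pz0.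
  by exists n.
pose n r := sval (cid (ex r)).
have nP r : [/\ continuous (n r), n r 0 = y0 & forall t, proj (n r t) = H (r, t)].
  by rewrite /n; case: (cid _).
have n01 : n 0 1 = n 1 1.
  apply: (@lift_homotopy R _ _ _ pcov H n y0 (P z)) => //; try by move=> r; case: (nP r).
  by move=> r; rewrite /H /= cl1 s1 s1' (segment_path_same ch').
have e0 : n 0 1 = m 1.
  have [nc n0 np] := nP 0; apply: (lift_unique pcov nc mc) (ler01) _; last by rewrite m0 n0.
  by move=> t; rewrite mp np /H /= (segment_path0 ch').
have e1 : n 1 1 = m' 1.
  have [nc n0 np] := nP 1; apply: (lift_unique pcov nc mc') (ler01) _; last by rewrite m0' n0.
  by move=> t; rewrite mp' np /H /= (segment_path1 ch').
by rewrite -m1 -m1' -e0 -e1.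
Qed.

Lemma developed_proj z y : developed z y -> proj y = P z.
Proof. by move=> [s [m [_ _ _ [<- <-] ->]]]; rewrite cl1. Qed.

Lemma developed_base : developed z0 y0.
Proof.
exists (cst z0), (cst y0); split=> //; try exact: cst_continuous.
Qed.

(** Equivariance: a path from [z0] to [d z0] is followed by the [d]-translate of
a path from [z0] to [z], and the lift of the result is the corresponding
concatenation in [Y]. *)
Lemma developed_act d g z y : D d -> G g -> developed (d z0) (g y0) ->
  developed z y -> developed (d z) (g y).
Proof.
move=> Dd Gg [s [m [sc mc [s0 m0] [s1 m1] mp]]] [s' [m' [sc' mc' [s0' m0'] [s1' m1'] mp']]].
exists (concat_loops s (d \o s')), (concat_loops m (g \o m')); split.
- apply: concat_continuous => //=; last by rewrite s1 s0'.
  by move=> t; apply: continuous_comp; [exact: sc'|exact: Dc].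
- apply: concat_continuous => //=; last by rewrite m1 m0'.
  by move=> t; apply: continuous_comp; [exact: mc'|exact: Gc].
- by rewrite !concat0.
- by rewrite !concat1 /= s1' m1'.
- move=> t; rewrite (concat_clamp (c := P \o s) (c' := P \o (d \o s'))) //.
    by rewrite /concat_loops; case: ifP.
  by move=> {}t; rewrite /= orbit_proj_act // mp' /= orbit_proj_act.
Qed.

Let Gcomp g h : G g -> G h -> G (g \o h). Proof. by case: GG => _ + _; apply. Qed.

(** Let [H] be the set of the [g] that correspond to a deck transformation of
[Z]; it inherits commutativity from [D]. An element [f] of [G] determines
the point of the fibre of [q] below which [f^-1 y0] is reached, and two
elements that determine the same point differ by an element of [H]. So [H]
has at most as many cosets as the fibre has points. *)
Lemma abelian_cover_finite_index : has_abelian_subgroup_of_finite_index G.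
Proof.
have eqG := free_eq GG Gfree.
have deck d : D d -> exists2 g, G g & developed (d z0) (g y0).
  move=> Dd; have [y dy] := developed_total (d z0).
  have : proj y0 = proj y by rewrite (developed_proj dy) /= orbit_proj_act // -Pz0.
  by move=> /orbit_projE [g Gg gy]; exists g => //; rewrite gy.
pose H := [set g | G g /\ exists2 d, D d & developed (d z0) (g y0)].
have Hab : abelian_group H.
  move=> g g' [Gg [d Dd dg]] [Gg' [d' Dd' dg']].
  apply: (eqG _ _ y0); try exact: Gcomp.
  apply: (@developed_unique (d (d' z0))) => /=; first exact: (developed_act Dd Gg dg dg').
  have -> : d (d' z0) = d' (d z0) by have /= := congr1 (@^~ z0) (Dab Dd Dd').
  exact: (developed_act Dd' Gg' dg' dg).
have HH : transformation_group H.
  split.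
  - split; first by case: GG.
    by exists idfun; [case: DD|exact: developed_base].
  - move=> g g' [Gg [d Dd dg]] [Gg' [d' Dd' dg']]; split; first exact: Gcomp.
    exists (d \o d'); first by case: DD => _ + _; apply.
    exact: (developed_act Dd Gg dg dg').
  - move=> g [Gg [d Dd dg]]; case: (GG) => _ _ /(_ _ Gg) [h [Gh gh hg]].
    exists h; split=> //; split=> //.
    case: (DD) => _ _ /(_ _ Dd) [d' [Dd' dd' d'd]].
    have [g' Gg' dg'] := deck d' Dd'; exists d' => //.
    have := developed_act Dd Gg dg dg'; rewrite d'd => dd.
    have gg'y : g (g' y0) = y0 by apply: developed_unique dd developed_base.
    by rewrite -[y0 in h y0]gg'y gh.
exists H; split=> //; first by move=> g [].
pose x0 := proj y0.
have fF := covering_finite_fibre x0 qcov Tcompact.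
(* [good t f]: the inverse of [f] takes [y0] to a point that corresponds to a
   point of [Z] over [t]; [k] selects one such [f] for each [t] *)
pose good t f := G f /\ exists g z, [/\ G g, cancel f g, cancel g f, developed z (g y0) & proj' z = t].
pose k t := if pselect (exists f, good t f) is left e then sval (cid e) else idfun.
have kP t f : good t f -> good t (k t).
  by move=> gf; rewrite /k; case: pselect => [e|[]]; [case: (cid e)|exists f].
exists (k @` (q @^-1` [set x0])); split; first exact: finite_image.
  move=> _ [t _ <-]; rewrite /k; case: pselect => [e|_]; last by case: GG.
  by case: (cid e) => f [].
move=> f Gf; case: (GG) => _ _ /(_ _ Gf) [g [Gg fg gf]].
have [z dz] := developed_onto (g y0).
have gz : good (proj' z) f by split=> //; exists g, z.
exists (k (proj' z)).
  by exists (proj' z) => //=; have /= <- := developed_proj dz; rewrite orbit_proj_act.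
have [Gk [g1 [z1 [Gg1 kg1 g1k dz1]]]] := kP _ _ gz.
move=> /orbit_projE [d Dd dzz1].
have [h Gh dh] := deck d Dd.
have := developed_act Dd Gh dh dz1; rewrite dzz1 => dz'.
have ghg1 : g = h \o g1.
  by apply: (eqG _ _ y0) => //; [exact: Gcomp|exact: (developed_unique dz dz')].
have hH : H h by split=> //; exists d.
case: (HH) => _ _ /(_ _ hH) [h' [Hh' hh' h'h]]; exists h' => //.
apply/funext => y; apply: (can_inj gf); rewrite fg ghg1 /= kg1 h'h //.
Qed.

End AbelianCover.

(** * Tori *)

Section IntegerVectors.
Context {R : realType}.

Definition int_vect d (z : 'rV[R]_d) := forall i, z 0 i \is a Num.int.

Lemma int_vect0 d : int_vect (0 : 'rV[R]_d).
Proof. by move=> i; rewrite mxE int_num0. Qed.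

Lemma int_vectD d (z w : 'rV[R]_d) : int_vect z -> int_vect w -> int_vect (z + w).
Proof. by move=> Zz Zw i; rewrite mxE rpredD. Qed.

Lemma int_vectN d (z : 'rV[R]_d) : int_vect z -> int_vect (- z).
Proof. by move=> Zz i; rewrite mxE rpredN. Qed.

Lemma finite_int_box d (N : nat) :
  finite_set [set z : 'rV[R]_d | int_vect z /\ forall i, `|z 0 i| <= N%:R].
Proof.
pose f (g : {ffun 'I_d -> 'I_(N + N).+1}) : 'rV[R]_d := \row_i ((g i : nat)%:R - N%:R).
have fin : finite_set (f @` setT) by apply: finite_image; exact: finite_finset.
apply: (sub_finite_set _ fin) => z [Zz zN].
have ex i : exists j : 'I_(N + N).+1, z 0 i = j%:R - N%:R.
  pose m := Num.floor (z 0 i) + N%:Z.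
  have mE : m%:~R = z 0 i + N%:R :> R by rewrite /m intrD floorK // Zz.
  have /andP[z1 z2] : - N%:R <= z 0 i <= N%:R by rewrite -ler_norml.
  have m0 : 0 <= m by rewrite -(ler_int R) mE; lra.
  have mj : (`|m|%N%:R : R) = z 0 i + N%:R by rewrite -mE -[in RHS](gez0_abs m0).
  have jN : (`|m| < (N + N).+1)%N by rewrite ltnS -(ler_nat R) mj natrD lerD2r.
  by exists (Ordinal jN); rewrite /= mj addrK.
exists [ffun i => sval (cid (ex i))] => //.
by apply/rowP => i; rewrite mxE ffunE; case: (cid _).
Qed.

Lemma bounded_coord d (K : set 'rV[R]_d) : compact K -> exists N : nat, forall x i, K x -> `|x 0 i| <= N%:R.
Proof.
move=> /compact_bounded [B [Br KB]].
exists (Num.truncn (B + 1)).+1 => x i Kx.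
have xB : `|x| <= B + 1 by apply: KB => //; rewrite ltrDl.
apply: le_trans (ltW (truncnS_gt _)); apply: le_trans xB.
by rewrite [leRHS]/Num.norm /= mx_normrE; apply/bigmax_geP; right => /=; exists (0, i).
Qed.

Lemma cube_compact d : compact [set x : 'rV[R]_d | forall i, 0 <= x 0 i <= 1].
Proof.
have := @rV_compact R d (fun=> `[0, 1]%classic) (fun=> @segment_compact _ 0 1).
by congr compact; apply/seteqP; split=> x /= h i; have := h i; rewrite ?in_itv.
Qed.

Definition floor_vect d (x : 'rV[R]_d) : 'rV[R]_d := \row_i (Num.floor (x 0 i))%:~R.

Lemma floor_vectP d (x : 'rV[R]_d) : int_vect (floor_vect x) /\
  forall i, 0 <= (x - floor_vect x) 0 i <= 1.
Proof.
split=> i; rewrite !mxE; first by rewrite intr_int.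
have := floor_itv (x 0 i); rewrite intrD => /andP[h1 h2].
by rewrite subr_ge0 h1 /= lerBlDl ltW.
Qed.

End IntegerVectors.

Section Torus.
Context {R : realType} (d : nat).
Local Notation S := (@integer_translations R d).
Local Notation D := (generated_group S).

Lemma integer_translations_group : transformation_group S.
Proof.
split.
- by exists 0; [move=> i; rewrite mxE int_num0|apply/funext => x; rewrite addr0].
- move=> _ _ [z Zz ->] [w Zw ->]; exists (w + z); first by move=> i; rewrite mxE rpredD ?Zz ?Zw.
  by apply/funext => x /=; rewrite addrA.
- move=> _ [z Zz ->]; exists (fun x => x - z); split; last 2 first.
  + by move=> x; rewrite addrK.
  + by move=> x; rewrite subrK.
  by exists (- z) => // i; rewrite mxE rpredN Zz.
Qed.

Lemma generated_translations : D = S.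
Proof.
apply/seteqP; split; last exact: generated_group_sub.
by apply: generated_group_min => //; exact: integer_translations_group.
Qed.

Lemma torus_group : transformation_group D.
Proof. by rewrite generated_translations; exact: integer_translations_group. Qed.

Lemma torus_abelian : abelian_group D.
Proof.
rewrite generated_translations => _ _ [z _ ->] [w _ ->].
by apply/funext => x /=; rewrite addrAC.
Qed.

Lemma torus_chart : global_chart setT (@id 'rV[R]_d) id.
Proof. split => //; [exact: openT|by move=> x _; exact: cvg_id|by move=> x; exact: cvg_id]. Qed.

Lemma torus_smooth g : D g -> smooth_on setT (id \o g \o @id 'rV[R]_d).
Proof.
rewrite generated_translations => -[z _ ->] n.
apply: Ck_D; [exact: openT| |exact: Ck_cst].
exact: (@smooth_lin R _ _ setT idfun (fun x => cvg_id)).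
Qed.

Lemma torus_free : acts_freely D.
Proof.
rewrite generated_translations => _ [z _ ->] x /eqP; rewrite -subr_eq0 addrC addKr => /eqP ->.
by apply/funext => y; rewrite addr0.
Qed.

Lemma torus_pd : acts_properly_discontinuously D.
Proof.
rewrite generated_translations => K cK; have [N KN] := bounded_coord cK.
have fin := finite_image (fun z => (fun x => x + z) : 'rV[R]_d -> 'rV[R]_d) (finite_int_box d (N + N)).
apply: (sub_finite_set _ fin) => _ [[z Zz ->] [_ [[x Kx <-] Kxz]]].
exists z => //; split => // i.
have -> : z 0 i = (x + z) 0 i - x 0 i by rewrite mxE addrAC subrr add0r.
by apply: le_trans (ler_normB _ _) _; rewrite natrD lerD ?KN.
Qed.

Lemma torus_action_continuous g : D g -> continuous g.
Proof. exact: (chart_action_continuous torus_chart torus_smooth). Qed.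

Lemma torus_covering : covering_map (orbit_proj S).
Proof.
apply: orbit_proj_covering.
- exact: torus_group.
- exact: torus_action_continuous.
- exact: global_chart_lcompact (rV_has_coords d) torus_chart.
- exact: global_chart_hausdorff torus_chart.
- exact: torus_pd.
- exact: torus_free.
Qed.

Lemma torus_compact : compact [set: torus R d].
Proof.
have -> : [set: torus R d] = orbit_proj S @` [set x : 'rV[R]_d | forall i, 0 <= x 0 i <= 1].
  apply/seteqP; split=> // t _; have [x <-] := orbit_proj_surj t.
  have [Zx x01] := floor_vectP x; exists (x - floor_vect x) => //.
  apply: (@orbit_proj_act _ S (fun y => y - floor_vect x)).
  rewrite generated_translations; exists (- floor_vect x) => // i.
  by rewrite mxE rpredN; exact: Zx.
apply: continuous_compact; last exact: cube_compact.
by apply: continuous_subspaceT; exact: orbit_proj_continuous.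
Qed.

Lemma torus_manifold : smooth_manifold (torus_atlas R d).
Proof.
apply: (quotient_smooth_manifold (rV_has_coords d) torus_chart).
- exact: torus_smooth.
- exact: torus_pd.
- exact: torus_free.
Qed.

Lemma torus_convex (x y : 'rV[R]_d) (t : R) : [set: 'rV[R]_d] x -> [set: 'rV[R]_d] y -> 0 <= t <= 1 ->
  [set: 'rV[R]_d] ((1 - t) *: x + t *: y).
Proof. by []. Qed.

End Torus.

Section TorusPoints.
Context {R : realType}.

Lemma rV_connected e : connected [set: 'rV[R]_e].
Proof.
have -> : [set: 'rV[R]_e] = \bigcup_(y in [set: 'rV[R]_e]) ((fun s : R => s *: y) @` `[0, 1]).
  apply/seteqP; split=> // y _; exists y => //; exists 1; rewrite ?scale1r //=.
  by rewrite in_itv /= ler01 lexx.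
apply: bigcup_connected.
  by exists 0 => y _; exists 0; rewrite ?scale0r //= in_itv /= ler01 lexx.
move=> y _; apply: connected_continuous_connected; first exact: segment_connected.
by apply: continuous_subspaceT; exact: scalel_continuous.
Qed.

Lemma torus_connected e : connected [set: torus R e].
Proof.
have -> : [set: torus R e] = orbit_proj (@integer_translations R e) @` setT.
  by apply/seteqP; split=> // t _; have [x <-] := orbit_proj_surj t; exists x.
apply: connected_continuous_connected; first exact: rV_connected.
by apply: continuous_subspaceT; exact: orbit_proj_continuous.
Qed.

Definition circle_point (t : R) : torus R 1 := orbit_proj _ (const_mx t : 'rV[R]_1).

Lemma torus_projE e (y y' : 'rV[R]_e) :
  orbit_proj (@integer_translations R e) y = orbit_proj (@integer_translations R e) y' <->
  exists2 z, int_vect z & y' = y + z.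
Proof.
split.
  by move=> /orbit_projE [g]; rewrite generated_translations => -[z Zz ->] <-; exists z.
move=> [z Zz ->]; apply/orbit_projE; exists (fun x => x + z) => //.
by rewrite generated_translations; exists z.
Qed.

Lemma circle_pointE s t : circle_point s = circle_point t <-> exists k : int, t = s + k%:~R.
Proof.
split.
  move=> /torus_projE [z Zz] /rowP /(_ 0); rewrite !mxE => ->.
  by have /intrP [k ->] := Zz 0; exists k.
move=> [k ->]; apply/torus_projE; exists (const_mx k%:~R); first by move=> i; rewrite mxE intr_int.
by apply/rowP => i; rewrite !mxE.
Qed.

Lemma const_mx00 (y : 'rV[R]_1) : const_mx (y 0 0) = y.
Proof. by apply/rowP => i; rewrite mxE ord1. Qed.

Lemma circle_point_surj b : exists t, circle_point t = b.
Proof.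
by have [y <-] := orbit_proj_surj b; exists (y 0 0); rewrite /circle_point const_mx00.
Qed.

Lemma torus_chart_at e (y : 'rV[R]_e) :
  exists c, [/\ torus_atlas R e c, c.1 y & c.2 = orbit_proj (@integer_translations R e)].
Proof.
have [c [Ac cy cE]] := quotient_chart_at (rV_has_coords e) (@torus_chart R e)
  (@torus_smooth R e) (@torus_pd R e) (@torus_free R e) (I : [set: 'rV[R]_e] y).
by exists c.
Qed.

Definition torus_rep d (z : torus R d) : 'rV[R]_d := sval (cid (orbit_proj_surj z)).

Lemma torus_repK d (z : torus R d) : orbit_proj _ (torus_rep z) = z.
Proof. by rewrite /torus_rep; case: (cid _). Qed.

End TorusPoints.

(** * Continuity of smooth maps *)

Section SmoothMapContinuous.
Context {R : realType}.

Lemma smooth_map_continuous (X1 X2 : topologicalType) (E1 E2 : normedModType R)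
    (A1 : atlas X1 E1) (A2 : atlas X2 E2) (h : X1 -> X2) :
  (forall c, A1 c -> parametrization c) -> (forall c, A2 c -> parametrization c) ->
  smooth_map A1 A2 h -> continuous h.
Proof.
move=> p1 p2 sh x W nW; have [c [c' [e [g [Ac Ac' cx [ce c'ge gl]]]]]] := sh x.
have [oc _ _ co] := p1 c Ac; have [_ c'c _ _] := p2 c' Ac'.
have hx : h x = c'.2 (g e) by rewrite -cx; have [-> _] := nbhs_singleton gl.
have gc : {for e, continuous g}.
  by apply: differentiable_continuous; have [_ cg] := nbhs_singleton gl; exact: (cg [::]).
have c'gc : {for e, continuous (c'.2 \o g)} by apply: continuous_comp => //; exact/c'c/mem_set.
have n1 : nbhs e ((c'.2 \o g) @^-1` W) by apply: c'gc; rewrite /= -hx.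
have nN : nbhs e [set y | [/\ W (c'.2 (g y)), h (c.2 y) = c'.2 (g y) & c.1 y]].
  near=> y; split; first by near: y.
  - by near: y; apply: filterS gl => y [].
  - by near: y; exact: open_nbhs_nbhs.
move: nN; rewrite nbhsE => -[B [oB Be] BN].
have oW : open (c.2 @` B) by apply: co => // y /BN [].
have : nbhs x (c.2 @` B) by apply: open_nbhs_nbhs; split=> //; exists e.
suff : c.2 @` B `<=` h @^-1` W by move=> BW; apply: filterS BW.
by move=> _ [y /BN [Wy hy _] <-]; rewrite /= hy.
Unshelve. all: by end_near. Qed.

Lemma homeomorphism_covering (X1 X2 : topologicalType) (h : X1 -> X2) (h' : X2 -> X1) :
  continuous h -> continuous h' -> cancel h h' -> cancel h' h -> covering_map h.
Proof.
move=> hc hc' hK h'K; split=> //.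
  by apply/seteqP; split=> // x _; exists (h' x).
move=> x; exists setT; split; [exact: openT|by []|exists [set setT]; split].
- by rewrite bigcup_set1.
- by move=> V V' -> ->.
- move=> _ ->; split; first exact: openT.
    split=> // [y z _ _|y _]; first by move=> /(congr1 h'); rewrite !hK.
    by exists (h' y).
  move=> B _ oB; rewrite (_ : h @` B = h' @^-1` B); first by apply: open_comp => // z _; exact: hc'.
  apply/seteqP; split=> y /=; first by move=> [z Bz <-]; rewrite hK.
  by move=> Bz; exists (h' y).
Qed.

End SmoothMapContinuous.

(** * Mapping tori *)

(** [Theta] and [F] identify the chart domain with [R * R^d]; the first coordinate
is called the height. The group studied here is generated by the integer
translations of the second coordinate and by a map [a] that raises the height by
one. *)

Section MappingTorus.
Context {R : realType} {X : topologicalType} {E : normedModType R}.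
Variables (U : set E) (phi : E -> X) (psi : X -> E).
Hypothesis Ec : has_coords E.
Hypothesis ch : global_chart U phi psi.
Variables (d : nat) (Theta : E -> R * 'rV[R]_d) (F : R * 'rV[R]_d -> E).
Hypothesis sTheta : smooth_on U Theta.
Hypothesis sF : smooth_on setT F.
Hypothesis UF : forall y, U (F y).
Hypothesis ThetaF : forall y, Theta (F y) = y.
Hypothesis FTheta : forall x, U x -> F (Theta x) = x.

Definition height (x : X) : R := (Theta (psi x)).1.
Definition fibre_coord (x : X) : 'rV[R]_d := (Theta (psi x)).2.
Definition point_at (t : R) (y : 'rV[R]_d) : X := phi (F (t, y)).
Definition translation (z : 'rV[R]_d) (x : X) : X := point_at (height x) (fibre_coord x + z).

Lemma height_point t y : height (point_at t y) = t.
Proof. by case: ch => _ _ _ _ phiK; rewrite /height /point_at phiK // ThetaF. Qed.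

Lemma fibre_point t y : fibre_coord (point_at t y) = y.
Proof. by case: ch => _ _ _ _ phiK; rewrite /fibre_coord /point_at phiK // ThetaF. Qed.

Lemma point_coord x : point_at (height x) (fibre_coord x) = x.
Proof.
case: ch => _ _ _ psiK _; rewrite /point_at /height /fibre_coord -surjective_pairing.
by rewrite FTheta; case: (psiK x).
Qed.

Lemma coord_eq x y : height x = height y -> fibre_coord x = fibre_coord y -> x = y.
Proof. by move=> hxy fxy; rewrite -(point_coord x) hxy fxy point_coord. Qed.

Lemma Theta_continuous x : {for x, continuous (fun x => Theta (psi x))}.
Proof.
case: ch => _ _ psic psiK _; apply: continuous_comp; first exact: psic.
by apply: differentiable_continuous; apply: Ck_diff (sTheta 0%N) _; case: (psiK x).
Qed.

Lemma height_continuous : continuous height.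
Proof.
by move=> x; apply: (@continuous_comp _ _ _ (fun x => Theta (psi x)) fst); [exact: Theta_continuous|exact: cvg_fst].
Qed.

Lemma fibre_continuous : continuous fibre_coord.
Proof.
by move=> x; apply: (@continuous_comp _ _ _ (fun x => Theta (psi x)) snd); [exact: Theta_continuous|exact: cvg_snd].
Qed.

Lemma point_continuous : continuous (fun y : R * 'rV[R]_d => point_at y.1 y.2).
Proof.
case: ch => _ phic _ _ _ y.
apply: (@continuous_comp _ _ _ (fun y : R * 'rV[R]_d => F (y.1, y.2)) phi).
  rewrite (_ : (fun y : R * 'rV[R]_d => F (y.1, y.2)) = F); last by apply/funext => -[].
  by apply: differentiable_continuous; apply: Ck_diff (sF 0%N) _.
exact/phic/mem_set.
Qed.

Lemma height_translation z x : height (translation z x) = height x.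
Proof. exact: height_point. Qed.

Lemma fibre_translation z x : fibre_coord (translation z x) = fibre_coord x + z.
Proof. exact: fibre_point. Qed.

Lemma translation0 : translation 0 = idfun.
Proof. by apply/funext => x; rewrite /translation addr0 point_coord. Qed.

Lemma translationD z w : translation z \o translation w = translation (z + w).
Proof.
apply/funext => x; apply: coord_eq; first by rewrite /= !height_translation.
by rewrite /= !fibre_translation addrAC addrA.
Qed.

Lemma translation_smooth z : smooth_on U (psi \o translation z \o phi).
Proof.
case: (ch) => oU _ _ _ phiK n.
pose h x := F ((Theta x).1, (Theta x).2 + z).
apply: (@eq_Ck _ _ _ _ _ h) => //.
  by move=> x Ux; rewrite /h /= /translation /point_at /height /fibre_coord !phiK.
apply: (@Ck_comp _ _ _ _ _ U setT (fun x => ((Theta x).1, (Theta x).2 + z)) F) => //.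
- exact: prod_has_coords (R_has_coords) (rV_has_coords d).
- apply: Ck_pair => //.
    exact: (Ck_lin_comp (l := fst) oU (fun x => cvg_fst) (sTheta n)).
  apply: Ck_D => //; last exact: Ck_cst.
  exact: (Ck_lin_comp (l := snd) oU (fun x => cvg_snd) (sTheta n)).
Qed.

Variables (a a' : X -> X).
Hypothesis aa' : cancel a a'.
Hypothesis a'a : cancel a' a.
Hypothesis sa : smooth_on U (psi \o a \o phi).
Hypothesis sa' : smooth_on U (psi \o a' \o phi).
Hypothesis height_a : forall x, height (a x) = height x + 1.
(* Conjugation by [a] maps the lattice of integer translations into itself, and
   onto itself. *)
Hypothesis a_translation : forall z, int_vect z ->
  exists2 z', int_vect z' & a \o translation z = translation z' \o a.
Hypothesis translation_a : forall z, int_vect z ->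
  exists2 z', int_vect z' & a \o translation z' = translation z \o a.

Definition mt_generators : set (X -> X) := [set a] `|` translation @` (@int_vect R d).
Local Notation S := mt_generators.
Local Notation G := (generated_group S).

Definition mt_pow (k : int) : X -> X :=
  match k with Posz n => iter n a | Negz n => iter n.+1 a' end.

Lemma mt_powS k : mt_pow (k + 1) = a \o mt_pow k.
Proof.
case: k => n; first by rewrite -PoszD addn1.
case: n => [|n]; first by apply/funext => x /=; rewrite a'a.
have -> : Negz n.+1 + 1 = Negz n by rewrite !NegzE; lia.
by apply/funext => x /=; rewrite a'a.
Qed.

Lemma mt_powB k : mt_pow (k - 1) = a' \o mt_pow k.
Proof. by rewrite -{2}(subrK 1 k) mt_powS; apply/funext => x /=; rewrite aa'. Qed.

Lemma mt_powD j k : mt_pow (j + k) = mt_pow j \o mt_pow k.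
Proof.
elim/int_ind: j => [|j IH|j IH].
- by rewrite add0r; exact: erefl.
- have -> : j.+1%:Z + k = (j%:Z + k) + 1 by lia.
  have -> : j.+1%:Z = j%:Z + 1 by lia.
  by rewrite !mt_powS IH.
- have -> : - j.+1%:Z + k = (- j%:Z + k) - 1 by lia.
  have -> : - j.+1%:Z = - j%:Z - 1 by lia.
  by rewrite !mt_powB IH.
Qed.

Lemma mt_powNK k : mt_pow (- k) \o mt_pow k = idfun.
Proof. by rewrite -mt_powD addNr. Qed.

Lemma mt_powKN k : mt_pow k \o mt_pow (- k) = idfun.
Proof. by rewrite -mt_powD addrN. Qed.

Lemma height_pow k x : height (mt_pow k x) = height x + k%:~R.
Proof.
elim/int_ind: k => [|k IH|k IH]; first by rewrite addr0.
- by rewrite -addn1 PoszD mt_powS /= height_a IH rmorphD /= addrA.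
- rewrite -addn1 PoszD opprD mt_powB.
  have := height_a (a' (mt_pow (- k%:Z) x)); rewrite a'a IH => h.
  by rewrite /= rmorphB /= addrA h addrK.
Qed.

Lemma pow_translation k z : int_vect z ->
  exists2 z', int_vect z' & mt_pow k \o translation z = translation z' \o mt_pow k.
Proof.
elim/int_ind: k z => [|k IH|k IH] z Zz; first by exists z.
- have [z' Zz' E1] := IH z Zz; have [z2 Zz2 E2] := a_translation Zz'.
  exists z2 => //; rewrite -addn1 PoszD mt_powS.
  by rewrite -[LHS]/(a \o (mt_pow k \o translation z)) E1 -[LHS]/((a \o translation z') \o mt_pow k) E2.
- have [z' Zz' E1] := IH z Zz; have [z2 Zz2 E2] := translation_a Zz'.
  exists z2 => //; rewrite -addn1 PoszD opprD mt_powB.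
  rewrite -[LHS]/(a' \o (mt_pow (- k%:Z) \o translation z)) E1.
  apply/funext => x /=; apply: (can_inj aa'); rewrite a'a.
  by have /= -> := congr1 (@^~ (a' (mt_pow (- k%:Z) x))) E2; rewrite a'a.
Qed.

Definition mt_group : set (X -> X) :=
  [set g | exists k z, int_vect z /\ g = translation z \o mt_pow k].

Lemma mt_group_group : transformation_group mt_group.
Proof.
split.
- by exists 0, 0; split; [exact: int_vect0|rewrite translation0].
- move=> _ _ [k [z [Zz ->]]] [l [w [Zw ->]]].
  have [w' Zw' E1] := pow_translation k Zw.
  exists (k + l), (z + w'); split; first exact: int_vectD.
  rewrite -translationD mt_powD -[RHS]/(translation z \o (translation w' \o mt_pow k) \o mt_pow l).
  by rewrite -E1.
- move=> _ [k [z [Zz ->]]]; have ZNz := int_vectN Zz.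
  have [w Zw E1] := pow_translation (- k) ZNz.
  exists (mt_pow (- k) \o translation (- z)); split.
  + by exists (- k), w.
  + move=> x /=; have /= -> := congr1 (@^~ (mt_pow k x)) (translationD (- z) z).
    by rewrite addNr translation0; have /= -> := congr1 (@^~ x) (mt_powNK k).
  + move=> x /=; have /= -> := congr1 (@^~ (translation (- z) x)) (mt_powKN k).
    by have /= -> := congr1 (@^~ x) (translationD z (- z)); rewrite addrN translation0.
Qed.

(** Normal form: [a] normalizes the integer translations, so in any product of
generators they can be moved to the left. *)
Lemma mt_generated : G = mt_group.
Proof.
apply/seteqP; split.
  apply: generated_group_min; first exact: mt_group_group.
  move=> _ [->|[z Zz <-]].
    by exists 1, 0; split; [exact: int_vect0|rewrite translation0].
  by exists 0, z.
have GG : transformation_group G.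
  apply: generated_group_group mt_group_group _.
  move=> _ [->|[z Zz <-]].
    by exists 1, 0; split; [exact: int_vect0|rewrite translation0].
  by exists 0, z.
case: (GG) => G1 Gcomp Ginv.
have Ga : G a by apply: generated_group_sub; left.
have Ga' : G a'.
  have [h [Gh ah ha]] := Ginv _ Ga; suff -> : a' = h by [].
  by apply/funext => x; rewrite -{1}(ha x) aa'.
have Gpow k : G (mt_pow k).
  elim/int_ind: k => [|k IH|k IH]; first exact: G1.
    by rewrite -addn1 PoszD mt_powS; exact: Gcomp.
  by rewrite -addn1 PoszD opprD mt_powB; exact: Gcomp.
move=> _ [k [z [Zz ->]]]; apply: Gcomp => //.
by apply: generated_group_sub; right; exists z.
Qed.

Lemma mt_transformation_group : transformation_group G.
Proof. by rewrite mt_generated; exact: mt_group_group. Qed.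

Lemma smooth_compose f g : smooth_on U (psi \o f \o phi) -> smooth_on U (psi \o g \o phi) ->
  smooth_on U (psi \o (f \o g) \o phi).
Proof.
case: (ch) => oU _ _ psiK phiK sf sg n.
have -> : psi \o (f \o g) \o phi = (psi \o f \o phi) \o (psi \o g \o phi).
  by apply/funext => x /=; rewrite (psiK (g (phi x))).2.
by apply: (Ck_comp Ec oU _ (sg n) (sf n)) => x Ux /=; case: (psiK (g (phi x))).
Qed.

Lemma mt_smooth g : G g -> smooth_on U (psi \o g \o phi).
Proof.
rewrite mt_generated => -[k [z [_ ->]]].
apply: smooth_compose; first exact: translation_smooth.
have s1 : smooth_on U (psi \o idfun \o phi).
  by rewrite -[idfun]translation0; exact: translation_smooth.
elim/int_ind: k => [|k IH|k IH] //.
  by rewrite -addn1 PoszD mt_powS; exact: smooth_compose.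
by rewrite -addn1 PoszD opprD mt_powB; exact: smooth_compose.
Qed.

Lemma mt_continuous g : G g -> continuous g.
Proof. exact: (chart_action_continuous ch mt_smooth). Qed.

Lemma mt_free : acts_freely G.
Proof.
rewrite mt_generated => _ [k [z [_ ->]]] x gx.
have k0 : k = 0.
  have := congr1 height gx; rewrite /= height_translation height_pow => /eqP.
  by rewrite -subr_eq0 addrC addKr intr_eq0 => /eqP.
rewrite k0 in gx *; have := congr1 fibre_coord gx; rewrite /= fibre_translation => /eqP.
by rewrite -subr_eq0 addrC addKr => /eqP ->; rewrite translation0.
Qed.

(** On a compact set the height bounds the exponent of [a], and for each of the
finitely many exponents the fibre coordinate bounds the translation. *)
Lemma mt_pd : acts_properly_discontinuously G.
Proof.
rewrite mt_generated => K cK.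
have [B hB] : exists B : nat, forall x, K x -> `|height x| <= B%:R.
  have cH : compact (height @` K).
    by apply: continuous_compact => //; apply: continuous_subspaceT; exact: height_continuous.
  have [B [_ KB]] := compact_bounded cH.
  exists (Num.truncn (B + 1)).+1 => x Kx; apply: le_trans (ltW (truncnS_gt _)).
  by apply: KB; [rewrite ltrDl|exists x].
have fB k : exists N : nat, forall x i, K x -> `|fibre_coord (mt_pow k x) 0 i| <= N%:R.
  have cH : compact ((fibre_coord \o mt_pow k) @` K).
    apply: continuous_compact => //; apply: continuous_subspaceT => x.
    apply: continuous_comp; last exact: fibre_continuous.
    apply: mt_continuous; rewrite mt_generated.
    by exists k, 0; split; [exact: int_vect0|rewrite translation0].
  have [N hN] := bounded_coord cH; exists N => x i Kx; apply: hN; by exists x.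
pose N k := sval (cid (fB k)).
have NP k x i : K x -> `|fibre_coord (mt_pow k x) 0 i| <= (N k)%:R.
  by rewrite /N; case: (cid _) => n /= hn; exact: hn.
pose A := [set k : int | `|k| <= (B + B)%:Z].
have fA : finite_set A.
  have fin : finite_set ((fun i : 'I_((B + B) + (B + B)).+1 => (i : nat)%:Z - (B + B)%:Z) @` setT).
    by apply: finite_image; exact: finite_finset.
  apply: (sub_finite_set _ fin) => k; rewrite /A /= => kB.
  have k0 : 0 <= k + (B + B)%:Z by lia.
  have jN : (`|(k + (B + B)%:Z)%R|%N < ((B + B) + (B + B)).+1)%N by lia.
  by exists (Ordinal jN) => //=; lia.
have fin : finite_set (\bigcup_(k in A) ((fun z => translation z \o mt_pow k) @`
    [set z : 'rV[R]_d | int_vect z /\ forall i, `|z 0 i| <= (N k + N 0)%:R])).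
  by apply: bigcup_finite => // k _; apply: finite_image; exact: finite_int_box.
apply: (sub_finite_set _ fin) => _ [[k [z [Zz ->]]] [_ [[x Kx <-] Kgx]]].
have kE : k%:~R = height ((translation z \o mt_pow k) x) - height x :> R.
  by rewrite /= height_translation height_pow addrAC subrr add0r.
exists k.
  rewrite /A /= -(ler_int R) intr_norm kE; apply: le_trans (ler_normB _ _) _.
  by rewrite PoszD rmorphD /= lerD ?hB.
exists z => //; split=> // i.
have zE : z = fibre_coord (mt_pow 0 ((translation z \o mt_pow k) x)) - fibre_coord (mt_pow k x).
  by rewrite /= fibre_translation addrAC subrr add0r.
rewrite {1}zE !mxE; apply: le_trans (ler_normB _ _) _.
by rewrite addrC natrD lerD ?NP.
Qed.

(** Every orbit meets the unit cube: first the height is brought into [[0, 1]]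
by a power of [a], then the fibre coordinate by a translation. *)
Lemma mt_compact : compact [set: orbit_space S].
Proof.
pose C : set (R * 'rV[R]_d) := `[0, 1] `*` [set x : 'rV[R]_d | forall i, 0 <= x 0 i <= 1].
have cC : compact C by apply: compact_setX; [exact: segment_compact|exact: cube_compact].
have -> : [set: orbit_space S] = (orbit_proj S \o (fun y : R * 'rV[R]_d => point_at y.1 y.2)) @` C.
  apply/seteqP; split=> // m _; have [x <-] := orbit_proj_surj m.
  pose k := - Num.floor (height x); pose y := mt_pow k x.
  have [Zf f01] := floor_vectP (fibre_coord y).
  exists (height y, fibre_coord y - floor_vect (fibre_coord y)).
    split=> //=; rewrite in_itv /= /y height_pow /k mulrNz subr_ge0.
    have /andP[h1 h2] := floor_itv (height x); rewrite h1 /= lerBlDl.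
    by move: h2; rewrite intrD => /ltW.
  rewrite /= -[point_at _ _]/(translation (- floor_vect (fibre_coord y)) y).
  apply: (@orbit_proj_act _ S (translation (- floor_vect (fibre_coord y)) \o mt_pow k)).
  by rewrite mt_generated; exists k, (- floor_vect (fibre_coord y)); split=> //; exact: int_vectN.
apply: continuous_compact => //; apply: continuous_subspaceT => y.
by apply: continuous_comp; [exact: point_continuous|exact: orbit_proj_continuous].
Qed.

Lemma mt_manifold : smooth_manifold (quotient_atlas [set (U, phi)] S).
Proof.
exact: (quotient_smooth_manifold Ec ch mt_smooth mt_pd mt_free).
Qed.

Lemma mt_covering : covering_map (orbit_proj S).
Proof.
apply: orbit_proj_covering.
- exact: mt_transformation_group.
- exact: mt_continuous.
- exact: global_chart_lcompact Ec ch.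
- exact: global_chart_hausdorff ch.
- exact: mt_pd.
- exact: mt_free.
Qed.

(** Some positive power of every element lies in a given subgroup of finite
index. *)
Lemma mt_abelian_finite_index : has_abelian_subgroup_of_finite_index G ->
  exists2 p : nat, (0 < p)%N & forall z, int_vect z ->
    exists2 N : nat, (0 < N)%N & mt_pow p \o translation (z *+ N) = translation (z *+ N) \o mt_pow p.
Proof.
move=> [H [[H1 Hcomp Hinv] HG Hab [A [fA AG GA]]]].
(* two of the elements [g n] lie in the same coset of [H] *)
have fin_pow (g : nat -> X -> X) : (forall n, G (g n)) ->
    (forall i j, g (i + j)%N = g i \o g j) ->
    exists2 n, (0 < n)%N & H (g n).
  move=> Gg gD.
  have ex n : exists f, A f /\ exists2 h, H h & g n = f \o h.
    by have [f Af hf] := GA _ (Gg n); exists f.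
  pose k n := sval (cid (ex n)).
  have kP n : A (k n) /\ exists2 h, H h & g n = k n \o h by rewrite /k; case: (cid _).
  have [i [j [ij kij]]] : exists i j, (i < j)%N /\ k i = k j.
    apply: contrapT => nk.
    have kinj : injective k.
      move=> i j kij; have [ij|ij|//] := ltngtP i j; case: nk; [by exists i, j|by exists j, i].
    apply: infinite_nat.
    have := finite_preimage (f := k) (in2W kinj) fA; apply: sub_finite_set => n _ /=.
    by case: (kP n).
  exists (j - i)%N; first by rewrite subn_gt0.
  have [Ak [hi Hhi Ei]] := kP i; have [_ [hj Hhj Ej]] := kP j.
  case: (mt_transformation_group) => _ _ /(_ _ (AG _ Ak)) [f' [_ kf fk]].
  have [hi' [Hhi' hh' h'h]] := Hinv _ Hhi.
  have -> : g (j - i)%N = hi' \o hj; last exact: Hcomp.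
  apply/funext => x /=; rewrite -[LHS]hh'; congr hi'.
  have := congr1 (@^~ x) (gD i (j - i)%N); rewrite /= (subnKC (ltnW ij)) Ei Ej -kij /=.
  by move/(can_inj kf).
have Gpow k : G (mt_pow k).
  by rewrite mt_generated; exists k, 0; split; [exact: int_vect0|rewrite translation0].
have [p p0 Hp] : exists2 n, (0 < n)%N & H (mt_pow n%:Z).
  by apply: fin_pow => // i j; rewrite PoszD mt_powD.
exists p => // z Zz.
have [N N0 HN] : exists2 n, (0 < n)%N & H (translation (z *+ n)).
  apply: (fin_pow (fun n => translation (z *+ n))) => [n|i j]; last by rewrite mulrnDr translationD.
  rewrite mt_generated; exists 0, (z *+ n); split=> //.
  by elim: n => [|n IH]; [rewrite mulr0n; exact: int_vect0|rewrite mulrS; exact: int_vectD].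
by exists N => //; exact: Hab.
Qed.

(** * The projection of a mapping torus to the circle *)

Lemma mt_projE x y : orbit_proj S x = orbit_proj S y <->
  exists k z, int_vect z /\ y = translation z (mt_pow k x).
Proof.
split.
  by move=> /orbit_projE [g]; rewrite mt_generated => -[k [z [Zz ->]]] <-; exists k, z.
move=> [k [z [Zz ->]]]; apply/orbit_projE; exists (translation z \o mt_pow k) => //.
by rewrite mt_generated; exists k, z.
Qed.

Definition mt_pi (m : orbit_space S) : torus R 1 :=
  circle_point (height (sval (cid (orbit_proj_surj m)))).

Lemma mt_pi_proj x : mt_pi (orbit_proj S x) = circle_point (height x).
Proof.
rewrite /mt_pi; case: (cid _) => y /= /mt_projE [k [z [_ ->]]].
by apply/circle_pointE; exists k; rewrite height_translation height_pow.
Qed.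

(** This makes [fibre_map] independent of the choice of representatives in the
torus. *)
Lemma proj_point_eq t y z : int_vect z ->
  orbit_proj S (point_at t (y + z)) = orbit_proj S (point_at t y).
Proof.
move=> Zz; apply/esym/mt_projE; exists 0, z; split=> //=.
by rewrite /translation height_point fibre_point.
Qed.

Lemma same_height_proj x y : `|height x - height y| < 1 ->
  orbit_proj S x = orbit_proj S y -> height x = height y /\
  exists2 z, int_vect z & fibre_coord y = fibre_coord x + z.
Proof.
move=> hxy /mt_projE [k [z [Zz yE]]].
have k0 : k = 0.
  move: hxy; rewrite yE height_translation height_pow opprD addrA subrr add0r normrN.
  rewrite -intr_norm -[1]/(1%:~R) ltr_int; lia.
by rewrite k0 /= in yE; rewrite yE height_translation fibre_translation; split=> //; exists z.
Qed.

Lemma height_shift x t : circle_point (height x) = circle_point t ->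
  exists2 y, orbit_proj S y = orbit_proj S x & height y = t.
Proof.
move=> /circle_pointE [k ->]; exists (mt_pow k x); last exact: height_pow.
apply/esym/mt_projE; exists k, 0; split; first exact: int_vect0.
by rewrite translation0.
Qed.

Local Notation AM := (quotient_atlas [set (U, phi)] S).

Lemma mt_chart_at e : U e -> exists c, [/\ AM c, c.1 e & c.2 = orbit_proj S \o phi].
Proof. exact: (quotient_chart_at Ec ch mt_smooth mt_pd mt_free). Qed.

Lemma smooth_height : smooth_on U (fun e => (Theta e).1).
Proof.
case: (ch) => oU _ _ _ _ n.
exact: (Ck_lin_comp (l := fst) oU (fun x => cvg_fst) (sTheta n)).
Qed.

Lemma smooth_height_row : smooth_on U (fun e => const_mx (Theta e).1 : 'rV[R]_1).
Proof.
case: (ch) => oU _ _ _ _ n; apply: Ck_rV => // i.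
rewrite (_ : (fun _ => _) = fun e => (Theta e).1); first exact: smooth_height.
by apply/funext => e; rewrite mxE.
Qed.

Lemma near_U e : U e -> \forall y \near e, U y.
Proof. by case: ch => oU _ _ _ _ Ue; exact: open_nbhs_nbhs. Qed.

Lemma mt_pi_smooth : smooth_map AM (torus_atlas R 1) mt_pi.
Proof.
case: (ch) => oU _ _ psiK phiK m; have [x <-] := orbit_proj_surj m.
have [Ux xE] := psiK x.
have [c [Ac cx cE]] := mt_chart_at Ux.
have [c' [Ac' cx' cE']] := @torus_chart_at R 1 (const_mx (Theta (psi x)).1).
exists c, c', (psi x), (fun e => const_mx (Theta e).1); split=> //; first by rewrite cE /= xE.
split=> //; near=> y.
have Uy : U y by near: y; exact: near_U.
split; last exact: smooth_on_cinfty smooth_height_row Uy.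
by rewrite cE cE' /= mt_pi_proj /height phiK.
Unshelve. all: by end_near. Qed.

Definition fibre_map (t : R) (z : torus R d) : orbit_space S :=
  orbit_proj S (point_at t (torus_rep z)).

Lemma fibre_mapE t y : fibre_map t (orbit_proj _ y) = orbit_proj S (point_at t y).
Proof.
have : orbit_proj (@integer_translations R d) (torus_rep (orbit_proj _ y)) = orbit_proj _ y.
  exact: torus_repK.
by move=> /torus_projE [z Zz yE]; rewrite {2}yE proj_point_eq.
Qed.

(** Over an open arc of length one the height is determined by its class in the
circle, and the points of that height in a given orbit differ by integer
translations only. So the height and the fibre coordinate trivialize the
projection. *)
Lemma mt_bundle : smooth_fibre_bundle AM (torus_atlas R 1) (torus_atlas R d) mt_pi.
Proof.
case: (ch) => oU _ _ psiK phiK.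
split=> [|b]; first exact: mt_pi_smooth.
have [t0 <-] := circle_point_surj b.
pose I := [set t : R | t0 - 2^-1 < t < t0 + 2^-1].
have Idist s t : I s -> I t -> `|s - t| < 1.
  by move=> /andP[s1 s2] /andP[t1 t2]; rewrite ltr_norml; apply/andP; split; lra.
have oI : open I.
  rewrite (_ : I = [set t | t0 - 2^-1 < t] `&` [set t | t < t0 + 2^-1]).
    by apply: openI; [exact: open_gt|exact: open_lt].
  by apply/seteqP; split=> t /=; [move=> /andP[]|move=> [? ?]; apply/andP].
have It0 : I t0 by rewrite /I /=; lra.
exists (circle_point @` I); split; last 2 first.
- by exists t0.
- (* the height in [I] over a point of the arc; [t0] is a default value *)
pose ht (b' : torus R 1) := xget t0 [set t | I t /\ circle_point t = b'].
  have htE t : I t -> ht (circle_point t) = t.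
    move=> It; have : [set s | I s /\ circle_point s = circle_point t] (ht (circle_point t)).
      by rewrite /ht; apply: xgetPex; exists t.
    move=> [Is /circle_pointE [k tE]]; have := Idist _ _ It Is; rewrite {1}tE addrAC subrr add0r.
    rewrite -intr_norm -[1]/(1%:~R) ltr_int => k1; have k0 : k = 0 by lia.
    by rewrite {2}tE k0 addr0.
  pose lift_ok m y := orbit_proj S y = m /\ I (height y).
  have ex m : exists y, (circle_point @` I) (mt_pi m) -> lift_ok m y.
    have [x xm] := orbit_proj_surj m.
    have [[t It tE]|nI] := pselect ((circle_point @` I) (mt_pi m)); last by exists x.
    have [y yx yt] : exists2 y, orbit_proj S y = orbit_proj S x & height y = t.
      by apply: height_shift; rewrite -mt_pi_proj xm.
    by exists y => _; split; rewrite ?yx ?yt.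
  (* a representative of [m] with height in [I] *)
pose rep m := sval (cid (ex m)).
  have repP m : (circle_point @` I) (mt_pi m) -> lift_ok m (rep m).
    by rewrite /rep; case: (cid _).
  pose h (w : torus R 1 * torus R d) := fibre_map (ht w.1) w.2.
  pose h' (m : orbit_space S) : torus R 1 * torus R d :=
    (mt_pi m, orbit_proj _ (fibre_coord (rep m))).
  have hE t y : I t -> h (circle_point t, orbit_proj _ y) = orbit_proj S (point_at t y).
    by move=> It; rewrite /h /= htE // fibre_mapE.
  have h'E y : I (height y) ->
      h' (orbit_proj S y) = (circle_point (height y), orbit_proj _ (fibre_coord y)).
    move=> Iy; have pI : (circle_point @` I) (mt_pi (orbit_proj S y)).
      by rewrite mt_pi_proj; exists (height y).
    have [ry Iry] := repP _ pI; rewrite /h' mt_pi_proj; congr pair.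
    by have [_ [z Zz E1]] := same_height_proj (Idist _ _ Iry Iy) ry; apply/torus_projE; exists z.
  exists h, h'; split.
  + move=> [b' z] /= [t It <-]; have [y <-] := orbit_proj_surj z.
    rewrite hE // mt_pi_proj height_point h'E ?height_point // fibre_point; split=> //.
    have [c1 [Ac1 c1t c1E]] := @torus_chart_at R 1 (const_mx t).
    have [c2 [Ac2 c2y c2E]] := torus_chart_at y.
    have [c' [Ac' cF cE']] := mt_chart_at (UF (t, y)).
    pose g (p : 'rV[R]_1 * 'rV[R]_d) := F (p.1 0 0, p.2).
    have sg : smooth_on setT g.
      move=> n; apply: (@Ck_comp _ _ _ _ _ setT setT (fun p : 'rV[R]_1 * 'rV[R]_d => (p.1 0 0, p.2)) F) => //.
      - exact: prod_has_coords (R_has_coords) (rV_has_coords d).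
      - exact: openT.
      apply: Ck_pair; [exact: openT| |].
        apply: (@Ck_coord _ _ n setT 1 fst 0); first exact: openT.
        exact: (@smooth_lin R _ _ setT fst (fun x => cvg_fst)).
      exact: (@smooth_lin R _ _ setT snd (fun x => cvg_snd)).
    exists (c1.1 `*` c2.1, fun p : 'rV[R]_1 * 'rV[R]_d => (c1.2 p.1, c2.2 p.2)), c', (const_mx t, y), g.
    split=> //; first by exists c1, c2.
      by rewrite /= c1E c2E.
    split=> //=; first by rewrite /g /= mxE.
    have nI : nbhs ((const_mx t : 'rV[R]_1), y) [set p : 'rV[R]_1 * 'rV[R]_d | I (p.1 0 0)].
      have cc : {for ((const_mx t : 'rV[R]_1), y), continuous (fun p : 'rV[R]_1 * 'rV[R]_d => p.1 0 0)}.
        apply: (@continuous_comp _ _ _ fst (fun v : 'rV[R]_1 => v 0 0)); first exact: cvg_fst.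
        exact: coord_continuous.
      by apply: cc; apply: open_nbhs_nbhs; split=> //=; rewrite mxE.
    apply: filterS nI => -[s y'] /= Is; split; last exact: smooth_on_cinfty sg _.
    by rewrite c1E c2E cE' /g /= -hE // /circle_point const_mx00.
  + move=> m pm; have [mE Im] := repP m pm; rewrite -mE h'E // mt_pi_proj; split=> //.
      by rewrite hE // point_coord.
    set x := rep m in mE Im *.
    have [Ux xE] := psiK x.
    have [c [Ac cx cE]] := mt_chart_at Ux.
    have [c1 [Ac1 c1t c1E]] := @torus_chart_at R 1 (const_mx (height x)).
    have [c2 [Ac2 c2y c2E]] := torus_chart_at (fibre_coord x).
    exists c, (c1.1 `*` c2.1, fun p : 'rV[R]_1 * 'rV[R]_d => (c1.2 p.1, c2.2 p.2)), (psi x),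
      (fun e => (const_mx (Theta e).1, (Theta e).2)); split=> //.
    - by exists c1, c2.
    - by rewrite cE /= xE.
    split=> //.
    have nI : \forall e \near psi x, I (Theta e).1.
      have cc : {for psi x, continuous (fun e => (Theta e).1)}.
        by apply: differentiable_continuous; exact: Ck_diff (smooth_height 0%N) Ux.
      by apply: cc; exact: open_nbhs_nbhs.
    near=> y; have Uy : U y by near: y; exact: near_U.
    have Iy : I (Theta y).1 by near: y.
    split.
      by rewrite cE c1E c2E /= h'E /height /fibre_coord phiK.
    apply: (@smooth_on_cinfty _ _ _ U) Uy => n; apply: Ck_pair => //; first exact: smooth_height_row.
    exact: (Ck_lin_comp (l := snd) oU (fun x => cvg_snd) (sTheta n)).
- rewrite (_ : circle_point @` I = orbit_proj _ @` [set v : 'rV[R]_1 | I (v 0 0)]).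
    apply: orbit_proj_open; first exact: torus_action_continuous.
    by apply: open_comp => // v _; exact: coord_continuous.
  apply/seteqP; split=> _ /= [t It <-]; first by exists (const_mx t); rewrite ?mxE.
  by exists (t 0 0) => //; rewrite /circle_point const_mx00.
Unshelve. all: by end_near. Qed.

(** * Leaves of the kernel of the height differential *)

Variable D : E -> set E.
Hypothesis DE : forall y, U y -> D y = [set v | ('d Theta y v).1 = 0].

Lemma diff_height y v : U y -> 'd (fun e => (Theta e).1) y v = ('d Theta y v).1.
Proof.
move=> Uy; have dT := Ck_diff (sTheta 0%N) Uy.
have df : differentiable (fst : R * 'rV[R]_d -> R) (Theta y).
  by apply: linear_differentiable => x; exact: cvg_fst.
have := diff_comp dT df; rewrite -[fst \o Theta]/(fun e => (Theta e).1) => ->.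
by rewrite /= (@diff_lin R _ _ fst) // => x; exact: cvg_fst.
Qed.

(** Tangent vectors of an integral manifold have zero height component, so in
local expressions the height is locally constant; connectedness makes its
class constant. *)
Lemma integral_manifold_height N : connected_integral_manifold AM D N ->
  forall x y, N x -> N y -> mt_pi x = mt_pi y.
Proof.
case: (ch) => oU _ _ psiK phiK.
move=> [e [Y [B [i [BM cY [_ im] ->]]]]] _ _ [y _ <-] [y' _ <-].
apply: (@locally_constant_connected Y _ (mt_pi \o i) cY) => z.
have [c [c' [a0 [g [Bc Ac' caz [ca c'ga gl] gD]]]]] := im z.
have [c0 [_ oc' c'U c'E _]] := Ac'.
have [_ _ Bp _ _] := BM; have [oc cc _ co] := Bp c Bc.
have := Ac'; move=> [c1 [c1E {}oc' {}c'U {}c'E _]]; rewrite c1E /= in c'U c'E.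
have gc : {for a0, continuous g}.
  apply: differentiable_continuous; have [_ cg] := nbhs_singleton gl.
  exact: (cg [::]).
have ng : \forall y \near a0, c'.1 (g y) by apply: gc; exact: open_nbhs_nbhs.
have nc : \forall y \near a0, c.1 y by exact: open_nbhs_nbhs.
have /nbhs_ballP [r /= r0 rP] : nbhs a0 [set y | [/\ i (c.2 y) = c'.2 (g y),
    cinfty_at g y, range ('d g y) = D (g y), c'.1 (g y) & c.1 y]].
  near=> y1; split.
  - by near: y1; apply: filterS gl => y1 [].
  - by near: y1; apply: filterS gl => y1 [].
  - by near: y1; apply: filterS gD => y1 [].
  - by near: y1.
  - by near: y1.
pose u y := (Theta (g y)).1.
have ucst y0 : ball a0 r y0 -> u y0 = u a0.
  apply: zero_differential_cst => y1 /rP [_ cg gr /c'U Ug _].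
  have dg : differentiable g y1 by exact: (cg [::]).
  have dh := Ck_diff (smooth_height 0%N) Ug.
  split; first exact: (differentiable_comp dg dh).
  move=> v; rewrite (diff_comp dg dh) /= diff_height //.
  have : range ('d g y1) ('d g y1 v) by exists v.
  by rewrite gr DE.
have pic y1 : ball a0 r y1 -> mt_pi (i (c.2 y1)) = circle_point (u y1).
  move=> /rP [-> _ _ /c'U Ug _].
  by rewrite c'E /= mt_pi_proj /height phiK.
have a0r : ball a0 r a0 by exact: ballxx.
have oW : open (c.2 @` (ball a0 r)).
  by apply: co; [move=> y1 /rP []|exact: ball_open].
have : nbhs z (c.2 @` (ball a0 r)) by apply: open_nbhs_nbhs; split=> //; exists a0.
apply: filterS => _ [y1 y1r <-] /=; by rewrite -caz !pic // ucst.
Unshelve. all: by end_near. Qed.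

(** The differential of [F (t, _)] is injective onto the kernel of the height
component of ['d Theta], because [Theta] and [F] are inverse to each other. *)
Lemma fibre_integral_manifold t :
  connected_integral_manifold AM D (mt_pi @^-1` [set circle_point t]).
Proof.
case: (ch) => oU _ _ psiK phiK.
exists d, (torus R d), (torus_atlas R d), (fibre_map t); split.
- exact: torus_manifold.
- exact: torus_connected.
- split.
    move=> z1 z2; have [y1 <-] := orbit_proj_surj z1; have [y2 <-] := orbit_proj_surj z2.
    rewrite !fibre_mapE => /same_height_proj; rewrite !height_point subrr normr0 => /(_ ltr01).
    by move=> [_]; rewrite !fibre_point => ?; apply/torus_projE.
  move=> z; have [y <-] := orbit_proj_surj z.
  have [c [Ac cy cE]] := torus_chart_at y.
  have [c' [Ac' cF cE']] := mt_chart_at (UF (t, y)).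
  pose g (y : 'rV[R]_d) := F (t, y).
  pose l (y : 'rV[R]_d) : R * 'rV[R]_d := (t, y).
  have sl : smooth_on setT l.
    move=> n; apply: Ck_pair; [exact: openT|exact: Ck_cst|].
    exact: (@smooth_lin R _ _ setT idfun (fun x => cvg_id)).
  have sg : smooth_on setT g.
    move=> n; apply: (@Ck_comp _ _ _ _ _ setT setT l F) => //.
    - exact: prod_has_coords (R_has_coords) (rV_has_coords d).
    - exact: openT.
  exists c, c', y, g; split=> //; first by rewrite cE.
    split=> //; apply: filterE => y'; split; last exact: smooth_on_cinfty sg _.
    by rewrite cE cE' /= fibre_mapE.
  apply: filterE => y'.
  have dl v : 'd l y' v = (0, v).
    have did : differentiable (idfun : 'rV[R]_d -> 'rV[R]_d) y'.
      by apply: linear_differentiable => x; exact: cvg_id.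
    have := diff_pair (@differentiable_cst R 'rV[R]_d R t y') did.
    rewrite -/l => ->; rewrite diff_cst.
    by rewrite (@diff_lin R _ _ idfun) // => x; exact: cvg_id.
  have dF := Ck_diff (sF 0%N) (I : setT (t, y')).
  have dT := Ck_diff (sTheta 0%N) (UF (t, y')).
  have dll := Ck_diff (sl 0%N) (I : setT y').
  have dgE v : 'd g y' v = 'd F (t, y') (0, v).
    by have := diff_comp dll dF; rewrite -[F \o l]/g => ->; rewrite /= dl.
  have TF v : 'd Theta (F (t, y')) ('d F (t, y') v) = v.
    have := diff_comp dF dT; have -> : Theta \o F = idfun by apply/funext => p; exact: ThetaF.
    by move=> /(congr1 (@^~ v)) /= <-; rewrite (@diff_lin R _ _ idfun) // => x; exact: cvg_id.
  have FT v : 'd F (t, y') ('d Theta (F (t, y')) v) = v.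
    have dF' : differentiable F (Theta (F (t, y'))) by rewrite ThetaF.
    have := diff_comp dT dF'; rewrite ThetaF => /(congr1 (@^~ v)) /= <-.
    have idn : \forall e \near F (t, y'), e = (F \o Theta) e.
      by near=> e; rewrite /= FTheta //; near: e; exact: near_U.
    have did : differentiable (idfun : E -> E) (F (t, y')).
      by apply: linear_differentiable => x; exact: cvg_id.
    have dc : differentiable (F \o Theta) (F (t, y')) by exact: near_eq_differentiable idn did.
    rewrite -deriveE // -(near_eq_derive _ idn) deriveE //.
    by rewrite (@diff_lin R _ _ idfun) // => x; exact: cvg_id.
  split.
    move=> v w; rewrite !dgE => /(congr1 ('d Theta (F (t, y')))).
    by rewrite !TF => -[].
  rewrite (DE (y := g y') (UF _)); apply/seteqP; split=> [_ [v _ <-]|v /= v0].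
    by rewrite /= dgE TF.
  exists ('d Theta (g y') v).2 => //.
  have pE (w : R * 'rV[R]_d) : w.1 = 0 -> (0, w.2) = w by case: w => w1 w2 /= ->.
  by rewrite dgE (pE _ v0) FT.
- apply/seteqP; split=> [m /= mt|_ [z _ <-]]; last first.
    by have [y <-] := orbit_proj_surj z; rewrite fibre_mapE /= mt_pi_proj height_point.
  have [x xm] := orbit_proj_surj m; rewrite -xm mt_pi_proj in mt.
  have [y yx yt] := height_shift mt.
  exists (orbit_proj _ (fibre_coord y)) => //.
  by rewrite fibre_mapE -xm -yx -yt point_coord.
Unshelve. all: by end_near. Qed.

(** A connected integral manifold lies in a fibre, and the fibres are connected
integral manifolds, so these are the maximal ones. *)
Lemma mt_leaf N : leaf AM D N <-> exists b, N = mt_pi @^-1` [set b].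
Proof.
have fibre_ne t : mt_pi (orbit_proj S (point_at t 0)) = circle_point t.
  by rewrite mt_pi_proj height_point.
have sub N' t : connected_integral_manifold AM D N' ->
    N' (orbit_proj S (point_at t 0)) -> N' `<=` mt_pi @^-1` [set circle_point t].
  move=> cN' N't x N'x; rewrite /= -(fibre_ne t).
  exact: integral_manifold_height cN' _ _ N'x N't.
split.
  move=> [cN Nmax]; have [[x Nx]|N0] := pselect (N !=set0).
    have [t tx] := circle_point_surj (mt_pi x); exists (circle_point t).
    apply/esym/Nmax; first exact: fibre_integral_manifold.
    by move=> y Ny; rewrite /= tx; exact: integral_manifold_height cN _ _ Ny Nx.
  (* an empty integral manifold would lie in every fibre, so it is not maximal *)
  exists (circle_point 0); apply/esym/Nmax; first exact: fibre_integral_manifold.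
  by move=> y Ny; case: N0; exists y.
move=> [b ->]; have [t <-] := circle_point_surj b.
split; first exact: fibre_integral_manifold.
move=> N' cN' fN'; apply/seteqP; split=> //.
by apply: sub => //; apply: fN'; rewrite /= fibre_ne.
Qed.

(** * Coverings by tori *)

Hypothesis Uconvex : forall (x y : E) (t : R), U x -> U y -> 0 <= t <= 1 -> U ((1 - t) *: x + t *: y).

Lemma mt_fundamental_group (x : orbit_space S) : fundamental_group_is R G x.
Proof.
exact: (orbit_space_fundamental_group ch Uconvex mt_transformation_group mt_continuous mt_covering mt_free).
Qed.

Lemma mt_torus_cover e (p : torus R e -> orbit_space S) :
  covering_map p -> has_abelian_subgroup_of_finite_index G.
Proof.
move=> pcov.
have [y0 y0E] := orbit_proj_surj (p (orbit_proj _ (0 : 'rV[R]_e))).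
apply: (abelian_cover_finite_index ch Uconvex (@torus_chart R e) (@torus_convex R e)
  mt_transformation_group mt_continuous mt_covering mt_free (@torus_group R e)
  (@torus_action_continuous R e) (@torus_covering R e) (@torus_abelian R e) (@torus_compact R e)
  (q := p) (z0 := 0) (y0 := y0) pcov).
by rewrite /= y0E.
Qed.

Lemma mt_torus_diffeomorphic e :
  diffeomorphic (torus_atlas R e) AM -> has_abelian_subgroup_of_finite_index G.
Proof.
move=> [h [h' [hh' h'h sh sh']]].
have [_ _ pT _ _] := @torus_manifold R e; have [_ _ pM _ _] := mt_manifold.
apply: (@mt_torus_cover e h); apply: homeomorphism_covering hh' h'h.
  exact: smooth_map_continuous pT pM sh.
exact: smooth_map_continuous pM pT sh'.
Qed.

Lemma mt_conclusion : ~ has_abelian_subgroup_of_finite_index G ->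
  [/\ acts_freely G,
      acts_properly_discontinuously G &
      [/\ smooth_manifold AM,
          compact [set: orbit_space S],
          exists2 pi : orbit_space S -> torus R 1,
            smooth_fibre_bundle AM (torus_atlas R 1) (torus_atlas R d) pi &
            forall N, leaf AM D N <-> exists c, N = pi @^-1` [set c],
          (forall x : orbit_space S, fundamental_group_is R G x) /\
          ~ has_abelian_subgroup_of_finite_index G &
          forall k : nat,
            ~ diffeomorphic (torus_atlas R k) AM /\
            ~ (exists p : torus R k -> orbit_space S, covering_map p)]].
Proof.
move=> nab; split; [exact: mt_free|exact: mt_pd|split].
- exact: mt_manifold.
- exact: mt_compact.
- by exists mt_pi; [exact: mt_bundle|exact: mt_leaf].
- by split=> // x; exact: mt_fundamental_group.
- move=> k; split; first by move=> /mt_torus_diffeomorphic.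
  by move=> [p /mt_torus_cover].
Qed.

End MappingTorus.

(** * Symmetric forms and differentials *)

Section Form.
Context {R : realType} {V : normedModType R} (ip : {symmetric V}).

Lemma ipC u v : ip u v = ip v u.
Proof. by rewrite hermC /= expr0 mul1r. Qed.

Lemma ipDl u v w : ip (u + v) w = ip u w + ip v w.
Proof. exact: linearDl. Qed.

Lemma ipDr u v w : ip u (v + w) = ip u v + ip u w.
Proof. by rewrite ipC ipDl !(ipC u). Qed.

Lemma ipZl (k : R) u v : ip (k *: u) v = k * ip u v.
Proof. by rewrite linearZl_LR. Qed.

Lemma ipZr (k : R) u v : ip u (k *: v) = k * ip u v.
Proof. by rewrite ipC ipZl (ipC u). Qed.

Lemma ip0l v : ip 0 v = 0.
Proof. by rewrite -(scale0r 0) ipZl mul0r. Qed.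

Lemma ip_suml I (r : seq I) (F : I -> V) v :
  ip (\sum_(i <- r) F i) v = \sum_(i <- r) ip (F i) v.
Proof.
elim: r => [|i r IH]; first by rewrite !big_nil ip0l.
by rewrite !big_cons ipDl IH.
Qed.

Lemma ip_sumr I (r : seq I) (F : I -> V) v :
  ip v (\sum_(i <- r) F i) = \sum_(i <- r) ip v (F i).
Proof. by rewrite ipC ip_suml; apply: eq_bigr => i _; rewrite ipC. Qed.

Lemma findim_lin_continuous (W : normedModType R) (l : {linear V -> W}) :
  has_coords V -> continuous l.
Proof.
move=> [d [b [phi [phic phiE]]]].
have -> : (l : V -> W) = fun w => \sum_i phi i w *: l (b i).
  apply/funext => w; rewrite {1}(phiE w) linear_sum.
  by apply: eq_bigr => i _; rewrite linearZ.
apply: continuous_big => [|i _]; first exact: add_continuous.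
move=> x; apply: (@continuous_comp _ R _ (phi i) ( *:%R ^~ (l (b i)))); first exact: phic.
exact: scalel_continuous.
Qed.

Hypothesis Vc : has_coords V.

Lemma Ck_ip (E : normedModType R) n (U : set E) (g h : E -> V) : open U ->
  Ck n U g -> Ck n U h -> Ck n U (fun x => ip (g x) (h x)).
Proof.
move=> oU Cg Ch; have [d [b [phi [phic phiE]]]] := Vc.
have -> : (fun x => ip (g x) (h x)) =
    fun x => \sum_i \sum_j phi i (g x) * phi j (h x) * ip (b i) (b j).
  apply/funext => x; rewrite {1}(phiE (g x)) ip_suml; apply: eq_bigr => i _.
  rewrite {1}(phiE (h x)) ip_sumr; apply: eq_bigr => j _.
  by rewrite ipZl ipZr mulrA.
apply: Ck_sum => // i _; apply: Ck_sum => // j _.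
apply: Ck_M => //; last exact: Ck_cst.
by apply: Ck_M => //; [exact: (Ck_lin_comp oU (phic i) Cg)|exact: (Ck_lin_comp oU (phic j) Ch)].
Qed.

Lemma ip_is_bilinear :
  bilinear_for
    (GRing.Scale.Law.clone _ _ *:%R _) (GRing.Scale.Law.clone _ _ *:%R _)
    (ip : V -> V -> R).
Proof.
split=> [u'|u] a x y /=; first by rewrite ipDl ipZl.
by rewrite ipDr ipZr.
Qed.

Lemma is_diff_ip (E : normedModType R) (g h dg dh : E -> V) x :
  is_diff x g dg -> is_diff x h dh ->
  is_diff x (fun y => ip (g y) (h y)) (fun X => ip (dg X) (h x) + ip (g x) (dh X)).
Proof.
move=> Hg Hh.
pose bM := bilinear_isBilinear.Build R V V R _ _ (ip : V -> V -> R) ip_is_bilinear.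
pose b : {bilinear V -> V -> R} := HB.pack (ip : V -> V -> R) bM.
have bc : continuous (fun p : V * V => b p.1 p.2).
  move=> p; apply: differentiable_continuous.
  apply: (@Ck_diff _ _ _ 0 setT) => //; apply: (@Ck_ip _ 0 setT fst snd); first exact: openT.
    exact: (@smooth_lin R _ _ setT fst (fun x => cvg_fst)).
  exact: (@smooth_lin R _ _ setT snd (fun x => cvg_snd)).
have dg' : differentiable g x by exact: (@ex_diff _ _ _ _ _ _ _ Hg).
have dh' : differentiable h x by exact: (@ex_diff _ _ _ _ _ _ _ Hh).
have db := @differentiable_bilin R V V R b (g x, h x) bc.
have dbE := @diff_bilin R V V R b (g x, h x) bc.
have dp := differentiable_pair dg' dh'.
apply: DiffDef; first exact: (differentiable_comp dp db).
have := diff_comp dp db; rewrite -[_ \o _]/(fun y => ip (g y) (h y)) => ->.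
rewrite dbE diff_pair //; apply/funext => X /=.
by rewrite (@diff_val _ _ _ _ _ _ _ Hg) (@diff_val _ _ _ _ _ _ _ Hh) addrC.
Qed.

End Form.

Section DiffRules.
Context {R : realType} {E F : normedModType R}.

Lemma is_diff_lin_comp (G : normedModType R) (l : {linear F -> G}) (g dg : E -> F) x :
  continuous l -> is_diff x g dg -> is_diff x (fun y => l (g y)) (fun X => l (dg X)).
Proof.
move=> lc Hg; have dg' : differentiable g x by exact: (@ex_diff _ _ _ _ _ _ _ Hg).
have dl : differentiable l (g x) by exact: linear_differentiable.
apply: DiffDef; first exact: (differentiable_comp dg' dl).
have := diff_comp dg' dl; rewrite -[_ \o _]/(fun y => l (g y)) => ->.
by rewrite diff_lin // (@diff_val _ _ _ _ _ _ _ Hg).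
Qed.

Lemma is_diff_lin (l : {linear E -> F}) x : continuous l -> is_diff x l l.
Proof. by move=> lc; apply: DiffDef; [exact: linear_differentiable|rewrite diff_lin]. Qed.

Lemma is_diff_curve (u : R -> F) (h dh : E -> R) x :
  differentiable u (h x) -> is_diff x h dh ->
  is_diff x (fun y => u (h y)) (fun X => dh X *: derive1 u (h x)).
Proof.
move=> du Hh; have dh' : differentiable h x by exact: (@ex_diff _ _ _ _ _ _ _ Hh).
apply: DiffDef; first exact: (differentiable_comp dh' du).
have := diff_comp dh' du; rewrite -[_ \o _]/(fun y => u (h y)) => ->.
by rewrite diff1E // (@diff_val _ _ _ _ _ _ _ Hh).
Qed.

Lemma is_diff_add (g h dg dh : E -> F) x : is_diff x g dg -> is_diff x h dh ->
  is_diff x (fun y => g y + h y) (fun X => dg X + dh X).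
Proof. by move=> Hg Hh; exact: is_diffD. Qed.

Lemma is_diff_scale (k : R) (g dg : E -> F) x : is_diff x g dg ->
  is_diff x (fun y => k *: g y) (fun X => k *: dg X).
Proof. by apply: (is_diff_lin_comp (l := *:%R k)); exact: scaler_continuous. Qed.

Lemma near_is_diff (g h dg : E -> F) x : (\near x, g x = h x) -> is_diff x g dg -> is_diff x h dg.
Proof.
move=> gh Hg; have dg' : differentiable g x by exact: (@ex_diff _ _ _ _ _ _ _ Hg).
have dh' := near_eq_differentiable gh dg'.
apply: DiffDef => //; rewrite -(@diff_val _ _ _ _ _ _ _ Hg); apply/funext => v.
by rewrite -!deriveE //; apply/esym/near_eq_derive.
Qed.

End DiffRules.

Lemma derive1_lin_scaled {R : realType} (V W : normedModType R) (B : {linear V -> W}) (u : R -> V) (lam t : R) :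
  continuous B -> differentiable u (lam * t) ->
  is_diff t (fun t => B (u (lam * t))) (fun h => h *: (lam *: B (derive1 u (lam * t)))).
Proof.
move=> Bc du.
have H1 : is_diff t (fun s => lam *: s) (fun h => lam *: h : R) by exact: is_diff_scaler.
have H2 := is_diff_lin_comp Bc (is_diff_curve (h := fun s => lam *: s) du H1).
apply: is_diff_eq H2 _; apply/funext => h.
by rewrite linearZ /= scalerA [lam *: h]mulrC.
Qed.

(** * The model manifold in its global chart *)

Section HalfSpace.
Context {R : realType} {V : normedModType R}.
Local Notation E := (R * R * V)%type.
Local Notation H := (@half_space R V).
Hypothesis Vc : has_coords V.

Lemma space_has_coords : has_coords (E : normedModType R).
Proof. exact: prod_has_coords (prod_has_coords (R_has_coords) (R_has_coords)) Vc. Qed.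

Lemma time_continuous : continuous (fun x : E => x.1.1).
Proof.
by move=> x; apply: (@continuous_comp _ _ _ fst fst); [exact: cvg_fst|exact: cvg_fst].
Qed.

Lemma open_half_space : open H.
Proof.
rewrite (_ : H = (fun x : E => x.1.1) @^-1` pos) //.
by apply: open_comp; [move=> x _; exact: time_continuous|exact: open_pos].
Qed.

Lemma to_MhatK x : H x -> val (to_Mhat x) = x.
Proof. by move=> Hx; rewrite /to_Mhat val_insubd ifT //; exact/mem_set. Qed.

Lemma valMhatK (x : Mhat V) : to_Mhat (val x) = x.
Proof. by rewrite /to_Mhat valKd. Qed.

Lemma val_half_space (x : Mhat V) : H (val x).
Proof. exact/set_mem/valP. Qed.

Lemma Mhat_chart : global_chart H (@to_Mhat R V) val.
Proof.
split.
- exact: open_half_space.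
- move=> x /set_mem Hx W; rewrite nbhsE => -[B [[C oC CB] Bx] BW].
  have nC : nbhs x (C `&` H).
    apply: open_nbhs_nbhs; split; first exact: openI oC open_half_space.
    have Cx : C (val (to_Mhat x)) by move: Bx; rewrite -CB.
    by split=> //; rewrite to_MhatK in Cx.
  suff : nbhs x (@to_Mhat R V @^-1` W) by [].
  apply: filterS nC => y [Cy Hy]; apply: BW; rewrite -CB.
  have Cy' : C (val (to_Mhat y)) by rewrite to_MhatK.
  exact: Cy'.
- exact: initial_continuous.
- by move=> x; split; [exact: val_half_space|exact: valMhatK].
- exact: to_MhatK.
Qed.

Lemma half_space_convex (x y : E) (t : R) : H x -> H y -> 0 <= t <= 1 -> H ((1 - t) *: x + t *: y).
Proof.
rewrite /half_space /= => x0 y0 /andP[t0 t1].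
have [->|tn] := eqVneq t 0; first by rewrite subr0 [_ *: x.1.1]mul1r [_ *: y.1.1]mul0r addr0.
apply: ltr_wpDl; first by rewrite mulr_ge0 ?subr_ge0 ?(ltW x0).
by apply: mulr_gt0 => //; rewrite lt_def tn.
Qed.

Lemma val_Mhat_map (F : E -> E) x : H (F (val x)) -> val (Mhat_map F x) = F (val x).
Proof. by move=> HF; rewrite /Mhat_map to_MhatK. Qed.

Lemma Mhat_eq (x y : Mhat V) : val x = val y -> x = y.
Proof. exact: val_inj. Qed.

Definition Mhat_expr (g : Mhat V -> Mhat V) : E -> E := val \o g \o @to_Mhat R V.

(** The atlas consists of one chart, so a smooth map has a smooth expression in
that chart. *)
Lemma Mhat_smoothP g : smooth_map (Mhat_atlas V) (Mhat_atlas V) g <-> smooth_on H (Mhat_expr g).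
Proof.
split=> [sg|sg x].
  apply: cinfty_smooth_on => x Hx.
  have [_ [_ [a0 [g0 [-> -> /= ax [/= Ha Hg0 gl]]]]]] := sg (to_Mhat x).
  have {}ax : a0 = x by rewrite -(to_MhatK Ha) ax to_MhatK.
  rewrite ax in Ha Hg0 gl.
  have g0c : {for x, continuous g0}.
    by apply: differentiable_continuous; have [_ cg] := nbhs_singleton gl; exact: (cg [::]).
  have nN : nbhs x [set y | [/\ g (to_Mhat y) = to_Mhat (g0 y), cinfty_at g0 y & H (g0 y)]].
    near=> y; split.
    - by near: y; apply: filterS gl => y [].
    - by near: y; apply: filterS gl => y [].
    - by near: y; apply: g0c; apply: open_nbhs_nbhs; split=> //; exact: open_half_space.
  move: nN; rewrite nbhsE => -[B [oB Bx] BN].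
  apply: (@smooth_on_cinfty _ _ _ B) Bx => n.
  apply: (@eq_Ck _ _ _ n B g0) => //; last by apply: cinfty_smooth_on => y /BN [].
  by move=> y /BN [gy _ Hy]; rewrite /Mhat_expr /= gy to_MhatK.
exists (H, @to_Mhat R V), (H, @to_Mhat R V), (val x), (Mhat_expr g); split=> //.
  exact: valMhatK.
split=> //=.
- exact: val_half_space.
- exact: val_half_space.
near=> y; split; first by rewrite /Mhat_expr /= valMhatK.
apply: smooth_on_cinfty sg _; near: y; apply: open_nbhs_nbhs; split; first exact: open_half_space.
exact: val_half_space.
Unshelve. all: by end_near. Qed.

Lemma Mhat_expr_comp g h : Mhat_expr (g \o h) = Mhat_expr g \o Mhat_expr h.
Proof. by apply/funext => x; rewrite /Mhat_expr /= valMhatK. Qed.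

Lemma Mhat_smooth_comp g h : smooth_on H (Mhat_expr g) -> smooth_on H (Mhat_expr h) ->
  smooth_on H (Mhat_expr (g \o h)).
Proof.
move=> sg sh n; rewrite Mhat_expr_comp.
apply: (@Ck_comp _ _ _ _ _ H H) => //; [exact: space_has_coords|exact: open_half_space|].
by move=> x _; exact: val_half_space.
Qed.

Variables (ip : V -> V -> R) (f : R -> R) (A : V -> V).

Definition Mhat_diff (g : Mhat V -> Mhat V) (x X : E) : E := 'd (Mhat_expr g) x X.

Lemma isometry_groupP g : isometry_group ip f A g <->
  (exists h, [/\ cancel g h, cancel h g, smooth_on H (Mhat_expr g) & smooth_on H (Mhat_expr h)]) /\
  forall x X Y, H x -> ghat ip f A (Mhat_expr g x) (Mhat_diff g x X) (Mhat_diff g x Y) =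
    ghat ip f A x X Y.
Proof.
split=> -[[h [gh hg sg sh]] iso]; split.
- by exists h; split=> //; exact/Mhat_smoothP.
- by move=> x X Y Hx; have := iso (to_Mhat x) X Y; rewrite to_MhatK.
- by exists h; split=> //; exact/Mhat_smoothP.
- move=> x X Y /=; have := iso (val x) X Y (val_half_space x).
  by rewrite {1}/Mhat_expr /= valMhatK.
Qed.

Lemma isometry_group_group : transformation_group (isometry_group ip f A).
Proof.
have diffH g x : smooth_on H (Mhat_expr g) -> H x -> differentiable (Mhat_expr g) x.
  by move=> sg; exact: Ck_diff (sg 0%N).
have chain g h x X : smooth_on H (Mhat_expr g) -> smooth_on H (Mhat_expr h) -> H x ->
    Mhat_diff (g \o h) x X = Mhat_diff g (Mhat_expr h x) (Mhat_diff h x X).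
  move=> sg sh Hx; have dh := diffH h x sh Hx.
  have dg := diffH g (Mhat_expr h x) sg (val_half_space (h (to_Mhat x))).
  rewrite /Mhat_diff Mhat_expr_comp; exact: (congr1 (fun k : E -> E => k X) (diff_comp dh dg)).
have expr_id g x : g = idfun -> H x -> Mhat_expr g x = x /\ forall X, Mhat_diff g x X = X.
  move=> -> Hx; split=> [|X]; first exact: to_MhatK.
  have idn : \forall e \near x, e = Mhat_expr idfun e.
    apply: filterS (open_nbhs_nbhs (conj open_half_space Hx)) => e He.
    by rewrite /Mhat_expr /= to_MhatK.
  have := @near_is_diff _ _ _ _ _ _ _ idn (is_diff_id x) => Hd.
  by rewrite /Mhat_diff; have -> := @diff_val _ _ _ _ _ _ _ Hd.
have sid : smooth_on H (Mhat_expr idfun).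
  move=> n; apply: (@eq_Ck _ _ _ n H idfun); first exact: open_half_space.
    by move=> x Hx; rewrite /Mhat_expr /= to_MhatK.
  exact: (@smooth_lin R _ _ H idfun (fun x => cvg_id)).
split.
- apply/isometry_groupP; split; first by exists idfun.
  by move=> x X Y Hx; have [-> dE] := expr_id idfun x erefl Hx; rewrite !dE.
- move=> g h /isometry_groupP [[g' [gg' g'g sg sg']] ig] /isometry_groupP [[h' [hh' h'h sh sh']] ih].
  apply/isometry_groupP; split.
    exists (h' \o g'); split; [exact: can_comp|exact: can_comp|exact: Mhat_smooth_comp|exact: Mhat_smooth_comp].
  move=> x X Y Hx; rewrite (chain g h x X sg sh Hx) (chain g h x Y sg sh Hx) Mhat_expr_comp.
  rewrite -(ih x X Y Hx).
  exact: (ig (Mhat_expr h x) _ _ (val_half_space (h (to_Mhat x)))).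
- move=> g /isometry_groupP [[h [gh hg sg sh]] ig]; exists h; split=> //.
  apply/isometry_groupP; split; first by exists g.
  move=> x X Y Hx.
  have ghid : g \o h = idfun by apply/funext => z /=; rewrite hg.
  have [gE dE] := expr_id _ x ghid Hx.
  rewrite -(ig (Mhat_expr h x) _ _ (val_half_space (h (to_Mhat x)))).
  rewrite -(chain g h x X sg sh Hx) -(chain g h x Y sg sh Hx) !dE.
  have -> : Mhat_expr g (Mhat_expr h x) = x by rewrite -[RHS]gE Mhat_expr_comp.
  by [].
Qed.

End HalfSpace.

(** * Isometries of the model *)

Section ModelIsometries.
Context {R : realType} {V : normedModType R} (ip : {symmetric V}) (f : R -> R) (A : {linear V -> V}).
Local Notation E := (R * R * V)%type.
Local Notation H := (@half_space R V).
Hypothesis Vc : has_coords V.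
Hypothesis Asym : forall v w, ip (A v) w = ip v (A w).

(** The common form of the two kinds of isometries: [gamma] has [lam = 1] and
[B] the identity, [gamma_hat] has [lam = q] and [B = C]. *)
Definition model_map (lam : R) (B : V -> V) (r : R) (u : R -> V) : E -> E := fun x =>
  ((lam * x.1.1, - ip (derive1 u (lam * x.1.1)) (2 *: B x.2 + u (lam * x.1.1)) + r + x.1.2 / lam),
   B x.2 + u (lam * x.1.1)).

Lemma smooth_time : smooth_on H (fun x : E => x.1.1).
Proof. exact: (@smooth_lin R _ _ H (fst \o fst) time_continuous). Qed.

Lemma shift_continuous : continuous (fun x : E => x.1.2).
Proof.
by move=> x; apply: (@continuous_comp _ _ _ fst snd); [exact: cvg_fst|exact: cvg_snd].
Qed.

Lemma smooth_shift : smooth_on H (fun x : E => x.1.2).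
Proof. exact: (@smooth_lin R _ _ H (snd \o fst) shift_continuous). Qed.

Lemma smooth_fibre : smooth_on H (fun x : E => x.2).
Proof. exact: (@smooth_lin R _ _ H snd (fun x => cvg_snd)). Qed.

Lemma smooth_curve (W : normedModType R) (u : R -> W) lam : 0 < lam -> smooth_on pos u ->
  smooth_on H (fun x : E => u (lam * x.1.1)).
Proof.
move=> l0 su n; apply: (@Ck_comp _ _ _ _ _ H pos (fun x : E => lam * x.1.1) u) => //.
- exact: R_has_coords.
- exact: open_half_space.
- by move=> x Hx; rewrite /pos /= mulr_gt0.
- by apply: Ck_M; [exact: open_half_space|exact: Ck_cst|exact: smooth_time].
Qed.

Section OneMap.
Variables (lam : R) (B : {linear V -> V}) (r : R) (u : R -> V).
Hypothesis lam0 : 0 < lam.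
Hypothesis su : smooth_on pos u.
Hypothesis su' : smooth_on pos (derive1 u).

Lemma model_map_half_space x : H x -> H (model_map lam B r u x).
Proof. by move=> Hx; rewrite /half_space /= mulr_gt0. Qed.

Lemma model_map_smooth : smooth_on H (model_map lam B r u).
Proof.
move=> n; have oH := @open_half_space R V.
have Bv : Ck n H (fun x : E => B x.2).
  by apply: (Ck_lin_comp (l := B) oH (findim_lin_continuous (l := B) Vc) (smooth_fibre n)).
have uv : Ck n H (fun x : E => B x.2 + u (lam * x.1.1)).
  by apply: Ck_D => //; exact: smooth_curve.
apply: Ck_pair => //; apply: Ck_pair => //.
  by apply: Ck_M => //; [exact: Ck_cst|exact: smooth_time].
apply: Ck_D => //; last by apply: Ck_M => //; [exact: smooth_shift|exact: Ck_cst].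
apply: Ck_D => //; last exact: Ck_cst.
apply: (@eq_Ck _ _ _ n H (fun x : E => (-1) *
  ip (derive1 u (lam * x.1.1)) (2 *: B x.2 + u (lam * x.1.1)))) => //.
  by move=> x _; rewrite mulN1r.
apply: Ck_M => //; first exact: Ck_cst.
apply: Ck_ip => //; first exact: smooth_curve.
apply: Ck_D => //; last exact: smooth_curve.
by apply: Ck_Z => //; exact: Ck_cst.
Qed.

Definition model_diff (x X : E) : E :=
  let t := lam * x.1.1 in let dt := lam * X.1.1 in
  ((dt, - (ip (dt *: derive1 (derive1 u) t) (2 *: B x.2 + u t) +
           ip (derive1 u t) (2 *: B X.2 + dt *: derive1 u t)) + X.1.2 / lam),
   B X.2 + dt *: derive1 u t).

Lemma model_map_diff x : H x -> is_diff x (model_map lam B r u) (model_diff x).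
Proof.
move=> Hx; have px : pos (lam * x.1.1) by rewrite /pos /= mulr_gt0.
have du := Ck_diff (su 0%N) px; have du' := Ck_diff (su' 0%N) px.
have dt : is_diff x (fun y : E => lam * y.1.1) (fun X => lam * X.1.1).
  apply: is_diff_scale.
  exact: (is_diff_lin (l := fst \o fst) x time_continuous).
have ds : is_diff x (fun y : E => lam^-1 *: y.1.2) (fun X => lam^-1 *: X.1.2).
  apply: is_diff_scale; exact: (is_diff_lin (l := snd \o fst) x shift_continuous).
have dB : is_diff x (fun y : E => B y.2) (fun X => B X.2).
  apply: is_diff_lin_comp; first exact: findim_lin_continuous.
  exact: (is_diff_lin (l := snd) x (fun x => cvg_snd)).
have uu := is_diff_curve (h := fun y : E => lam * y.1.1) du dt.
have uu' := is_diff_curve (h := fun y : E => lam * y.1.1) du' dt.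
have d2 := is_diff_add (is_diff_scale 2 dB) uu.
have dip := is_diff_scale (-1) (is_diff_ip ip Vc uu' d2).
have dcst : is_diff x (fun y : E => r) (fun X => 0) by exact: is_diff_cst.
have dsh := is_diff_add (is_diff_add dip dcst) ds.
have dall := is_diff_pair (is_diff_pair dt dsh) (is_diff_add dB uu).
have E1 : (fun y : E => ((lam * y.1.1, - ip (derive1 u (lam * y.1.1)) (2 *: B y.2 + u (lam * y.1.1)) + r + y.1.2 / lam),
   B y.2 + u (lam * y.1.1))) = model_map lam B r u by [].
rewrite -E1; move: dall.
have -> : (fun y : E => (lam * y.1.1, -1 *: ip (derive1 u (lam * y.1.1)) (2 *: B y.2 + u (lam * y.1.1)) + r + lam^-1 *: y.1.2,
   B y.2 + u (lam * y.1.1))) = (fun y : E => ((lam * y.1.1, - ip (derive1 u (lam * y.1.1)) (2 *: B y.2 + u (lam * y.1.1)) + r + y.1.2 / lam),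
   B y.2 + u (lam * y.1.1))).
  by apply/funext => y; rewrite scaleN1r [lam^-1 *: _]mulrC.
move=> dall; apply: is_diff_eq dall _; apply/funext => X.
by rewrite /model_diff /= scaleN1r addr0 [lam^-1 *: _]mulrC.
Qed.

Hypothesis ode : forall t, 0 < t -> derive1 (derive1 u) t = f t *: u t + A (u t).
Hypothesis Biso : forall v w, ip (B v) (B w) = ip v w.
Hypothesis BA : forall v, B (A v) = lam ^+ 2 *: A (B v).
Hypothesis flam : forall t, 0 < t -> f t = lam ^+ 2 * f (lam * t).

(** The terms of the pulled back metric that involve [u'] come from the shift in
the second coordinate and cancel against those of the inner product; those
that involve [u''] cancel against the change of [kappa] because [u'' = f u +
A u] and [A] is self-adjoint. In the remaining part of [kappa] the factor
[lam ^ 2] is compensated by the scaling of [f] and by [B \o A = lam ^ 2 (A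
\o B)]. *)
Lemma model_map_isometry x X Y : H x ->
  ghat ip f A (model_map lam B r u x) (model_diff x X) (model_diff x Y) = ghat ip f A x X Y.
Proof.
move=> Hx; rewrite /ghat /kappa /model_map /model_diff /=.
rewrite (flam Hx) ode ?mulr_gt0 //.
have -> : ip (A x.2) x.2 = lam ^+ 2 * ip (A (B x.2)) (B x.2) by rewrite -Biso BA ipZl.
rewrite -[ip x.2 x.2]Biso -[ip X.2 Y.2]Biso.
set t := lam * x.1.1; set w := derive1 u t; set z := u t; set b := B x.2.
set bX := B X.2; set bY := B Y.2; set dX := X.1.1; set dY := Y.1.1.
set sX := X.1.2; set sY := Y.1.2; set li := lam^-1.
have hl : lam * li = 1 by rewrite mulfV ?gt_eqF.
have h1 : lam * dX * (sY * li) = dX * sY.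
  by rewrite -[RHS]mulr1 -hl; lra.
have h2 : lam * dY * (sX * li) = dY * sX.
  by rewrite -[RHS]mulr1 -hl; lra.
have -> : A (b + z) = A b + A z by rewrite linearD.
rewrite !(ipDl, ipDr, ipZl, ipZr) (ipC ip z b) (ipC ip (A z) z) (Asym z b) (ipC ip z (A b)).
rewrite (ipC ip bX w).
lra.
Qed.

Variable B' : {linear V -> V}.
Hypothesis BB' : cancel B B'.
Hypothesis B'B : cancel B' B.

Definition model_inv (y : E) : E :=
  ((lam^-1 * y.1.1, lam * (y.1.2 - r + ip (derive1 u y.1.1) (2 *: y.2 - u y.1.1))), B' (y.2 - u y.1.1)).

Lemma model_inv_half_space x : H x -> H (model_inv x).
Proof. by move=> Hx; rewrite /half_space /= mulr_gt0 // invr_gt0. Qed.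

Lemma model_mapK x : model_inv (model_map lam B r u x) = x.
Proof.
have l0 : lam != 0 by rewrite gt_eqF.
rewrite /model_inv /model_map /= mulKf // addrK BB'.
have -> : 2 *: (B x.2 + u (lam * x.1.1)) - u (lam * x.1.1) = 2 *: B x.2 + u (lam * x.1.1).
  by rewrite scalerDr -addrA -{2}[u _]scale1r -scalerBl (_ : 2 - 1 = 1) ?scale1r //; lra.
case: x => -[t s] v /=; congr ((_, _), _).
have hs : lam * (s / lam) = s by rewrite mulrC divfK.
by lra.
Qed.

Lemma model_invK x : model_map lam B r u (model_inv x) = x.
Proof.
have l0 : lam != 0 by rewrite gt_eqF.
rewrite /model_inv /model_map /= mulVKf // B'B subrK.
have -> : 2 *: (x.2 - u x.1.1) + u x.1.1 = 2 *: x.2 - u x.1.1.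
  rewrite scalerBr -addrA; congr (_ + _).
  by rewrite -{2}[u _]scale1r -scaleNr -scalerDl -[RHS]scaleN1r; congr (_ *: _); lra.
case: x => -[t s] v /=; congr ((_, _), _).
by rewrite [lam * _]mulrC mulfK //; lra.
Qed.

Lemma model_inv_smooth : smooth_on H model_inv.
Proof.
move=> n; have oH := @open_half_space R V.
have ut (W : normedModType R) (k : R -> W) : smooth_on pos k -> Ck n H (fun x : E => k x.1.1).
  move=> sk; have := smooth_curve ltr01 sk n; apply: eq_Ck => // x _.
  by rewrite mul1r.
have vu : Ck n H (fun y : E => y.2 - u y.1.1).
  apply: (@eq_Ck _ _ _ n H (fun y : E => y.2 + (-1) *: u y.1.1)) => //.
    by move=> y _; rewrite scaleN1r.
  apply: Ck_D => //; first exact: smooth_fibre.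
  by apply: Ck_Z => //; [exact: Ck_cst|exact: ut].
have v2u : Ck n H (fun y : E => 2 *: y.2 - u y.1.1).
  apply: (@eq_Ck _ _ _ n H (fun y : E => 2 *: y.2 + (-1) *: u y.1.1)) => //.
    by move=> y _; rewrite scaleN1r.
  apply: Ck_D => //.
    by apply: Ck_Z => //; [exact: Ck_cst|exact: smooth_fibre].
  by apply: Ck_Z => //; [exact: Ck_cst|exact: ut].
apply: Ck_pair => //; last first.
  by apply: (Ck_lin_comp (l := B') oH (findim_lin_continuous (l := B') Vc) vu).
apply: Ck_pair => //; first by apply: Ck_M => //; [exact: Ck_cst|exact: smooth_time].
apply: Ck_M => //; first exact: Ck_cst.
apply: Ck_D => //; last by apply: Ck_ip => //; exact: ut.
by apply: Ck_D => //; [exact: smooth_shift|exact: Ck_cst].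
Qed.

Local Notation g := (Mhat_map (model_map lam B r u)).
Local Notation h := (Mhat_map model_inv).

Lemma Mhat_model_mapK : cancel g h.
Proof.
move=> x; apply: Mhat_eq; have Hx := val_half_space x.
rewrite val_Mhat_map; rewrite val_Mhat_map ?model_mapK //; exact: model_map_half_space.
Qed.

Lemma Mhat_model_invK : cancel h g.
Proof.
move=> x; apply: Mhat_eq; have Hx := val_half_space x.
rewrite val_Mhat_map; rewrite val_Mhat_map ?model_invK //; exact: model_inv_half_space.
Qed.

Lemma Mhat_model_map_expr x : H x -> Mhat_expr g x = model_map lam B r u x.
Proof.
move=> Hx; rewrite /Mhat_expr /= val_Mhat_map to_MhatK //; exact: model_map_half_space.
Qed.

Lemma Mhat_model_map_smooth : smooth_on H (Mhat_expr g).
Proof.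
move=> n; apply: (@eq_Ck _ _ _ n H (model_map lam B r u)); [exact: open_half_space| |exact: model_map_smooth].
by move=> x Hx; rewrite Mhat_model_map_expr.
Qed.

Lemma Mhat_model_inv_smooth : smooth_on H (Mhat_expr h).
Proof.
move=> n; apply: (@eq_Ck _ _ _ n H model_inv); [exact: open_half_space| |exact: model_inv_smooth].
move=> x Hx; rewrite /Mhat_expr /= val_Mhat_map to_MhatK //; exact: model_inv_half_space.
Qed.

Lemma model_isometry : isometry_group ip f A g.
Proof.
apply/isometry_groupP; split.
  exists h; split; [exact: Mhat_model_mapK|exact: Mhat_model_invK|exact: Mhat_model_map_smooth|exact: Mhat_model_inv_smooth].
move=> x X Y Hx.
have nx : \forall y \near x, model_map lam B r u y = Mhat_expr g y.
  apply: filterS (open_nbhs_nbhs (conj (@open_half_space R V) Hx)) => y Hy.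
  by rewrite Mhat_model_map_expr.
have Hd := @near_is_diff _ _ _ _ _ _ _ nx (model_map_diff Hx).
have dE Z : Mhat_diff g x Z = model_diff x Z.
  by rewrite /Mhat_diff; have -> := @diff_val _ _ _ _ _ _ _ Hd.
by rewrite !dE Mhat_model_map_expr // model_map_isometry.
Qed.

End OneMap.
End ModelIsometries.

(** * Exponential, logarithm, derivatives of combinations *)

Section ElementarySmooth.
Context {R : realType}.

Lemma smooth_expR : smooth_on setT (@expR R).
Proof.
have dexp x : differentiable (@expR R) x by apply/derivable1_diffP; exact: derivable_expR.
elim=> [|n IH]; first by split.
split=> [x _|v]; first exact: dexp.
apply: (@eq_Ck _ _ _ n setT (fun x => v *: expR x)); first exact: openT.
  move=> x _; rewrite deriveE // diff1E //; congr (_ *: _).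
  by rewrite derive1E; have [_ ->] := is_derive_expR x.
by apply: Ck_Z => //; [exact: openT|exact: Ck_cst].
Qed.

Lemma smooth_ln : smooth_on (@pos R) (@ln R).
Proof.
have dln x : pos x -> is_derive x 1 (@ln R) x^-1 by move=> x0; exact: is_derive1_ln.
have dln' x : pos x -> differentiable (@ln R) x.
  by move=> x0; apply/derivable1_diffP; case: (dln x x0).
case=> [|n]; first by split.
split=> [x x0|v]; first exact: dln'.
apply: (@eq_Ck _ _ _ n pos (fun x => v *: x^-1)); first exact: open_pos.
  move=> x x0; rewrite deriveE; last exact: dln'.
  rewrite diff1E; last exact: dln'.
  by rewrite derive1E; have [_ ->] := dln x x0.
apply: Ck_Z; [exact: open_pos|exact: Ck_cst|].
apply: Ck_V; [exact: open_pos|by move=> x x0; rewrite gt_eqF|].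
exact: (@smooth_lin R _ _ pos idfun (fun x => cvg_id)).
Qed.

Lemma derive1_comb (V : normedModType R) I (r : seq I) (y : I -> R) (u : I -> R -> V) t :
  (forall i, differentiable (u i) t) ->
  differentiable (\sum_(i <- r) y i *: u i) t /\
  derive1 (\sum_(i <- r) y i *: u i) t = \sum_(i <- r) y i *: derive1 (u i) t.
Proof.
move=> du; elim: r => [|i r [IH1 IH2]].
  by rewrite !big_nil; split; [exact: (@differentiable_cst R R V 0)|exact: derive1_cst].
rewrite !big_cons; have dyi : differentiable (y i *: u i) t by exact: differentiableZ.
split; first exact: differentiableD.
rewrite -IH2 !derive1E deriveD; [|exact: diff_derivable|exact: diff_derivable].
by rewrite deriveZ //; exact: diff_derivable.
Qed.

End ElementarySmooth.

(** * The isometries given by solutions and their conjugation relation *)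

Section GammaAction.
Context {R : realType} {V : normedModType R} (ip : {symmetric V}) (f : R -> R).
Variables (A C C' : {linear V -> V}) (q : R).
Local Notation E := (R * R * V)%type.
Local Notation H := (@half_space R V).
Hypothesis Vc : has_coords V.
Hypothesis hf : smooth_on_pos f.
Hypothesis hf1 : condition_f1 q f.
Hypothesis q0 : 0 < q.
Hypothesis q1 : q != 1.
Hypothesis Asym : forall v w, ip (A v) w = ip v (A w).
Hypothesis CC' : cancel C C'.
Hypothesis C'C : cancel C' C.
Hypothesis Ciso : forall v w, ip (C v) (C w) = ip v w.
Hypothesis CA : forall v, C (A v) = q ^+ 2 *: A (C v).

Let linc (l : {linear V -> V}) : continuous l := findim_lin_continuous (l := l) Vc.

Lemma E_space_smooth u : E_space f A u -> smooth_on pos u /\ smooth_on pos (derive1 u).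
Proof. by move=> Eu; apply: (solution_smooth (A := A)) Eu => //; exact: linc. Qed.

Lemma E_space_ode u (t : R) : E_space f A u -> 0 < t -> derive1 (derive1 u) t = f t *: u t + A (u t).
Proof. by move=> [_ hu] /hu []. Qed.

Lemma E_space_diff u (t : R) : E_space f A u -> 0 < t -> differentiable u t /\ differentiable (derive1 u) t.
Proof.
by move=> /E_space_smooth [su su'] t0; split; [exact: Ck_diff (su 0%N) t0|exact: Ck_diff (su' 0%N) t0].
Qed.

(** The derivative is [<u1'', u2> - <u1, u2''>], which vanishes because [u |-> f
u + A u] is self-adjoint. *)
Lemma Omega_constant u1 u2 (t : R) : E_space f A u1 -> E_space f A u2 -> 0 < t ->
  ip (derive1 u1 t) (u2 t) - ip (u1 t) (derive1 u2 t) = Omega ip u1 u2.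
Proof.
move=> E1 E2 t0.
pose W s := ip (derive1 u1 s) (u2 s) + -1 *: ip (u1 s) (derive1 u2 s).
have WE s : ip (derive1 u1 s) (u2 s) - ip (u1 s) (derive1 u2 s) = W s by rewrite /W scaleN1r.
have d1 (u : R -> V) (s : R) : differentiable u s -> is_diff s u (fun h => h *: derive1 u s).
  by move=> du; apply: DiffDef => //; rewrite diff1E.
have dW (s : R) : 0 < s -> differentiable W s /\ forall v, 'd W s v = 0.
  move=> s0; have [du1 du1'] := E_space_diff E1 s0; have [du2 du2'] := E_space_diff E2 s0.
  have D1 := is_diff_ip ip Vc (d1 _ _ du1') (d1 _ _ du2).
  have D2 := is_diff_scale (-1) (is_diff_ip ip Vc (d1 _ _ du1) (d1 _ _ du2')).
  have HW := is_diff_add D1 D2.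
  split; first exact: (@ex_diff _ _ _ _ _ _ _ HW).
  move=> v; rewrite (@diff_val _ _ _ _ _ _ _ HW) (E_space_ode E1 s0) (E_space_ode E2 s0).
  rewrite !(ipDl, ipDr, ipZl, ipZr) Asym scaleN1r; lra.
pose c := (t + 1) / 2.
have Wc (s : R) : 0 < s -> s < t + 1 -> W s = W c.
  move=> s0 s1; apply: (@zero_differential_cst R R W c c); last first.
    by rewrite -ball_normE /= ltr_norml /c; apply/andP; split; lra.
  move=> y; rewrite -ball_normE /= ltr_norml => /andP[y1 y2]; apply: dW; lra.
by rewrite /Omega !WE !Wc //; lra.
Qed.

Variables (rhat : R) (uhat : R -> V).
Hypothesis huhat : E_space f A uhat.

Local Notation gam := (gamma ip).
Local Notation ghat := (gamma_hat ip q C rhat uhat).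

Lemma gammaE r u : gam (r, u) = Mhat_map (model_map ip 1 idfun r u).
Proof.
rewrite /gamma; congr Mhat_map; apply/funext => x.
by rewrite /model_map /= mul1r divr1.
Qed.

Lemma gamma_hatE : ghat = Mhat_map (model_map ip q C rhat uhat).
Proof. by []. Qed.

Lemma gamma_isometry r u : E_space f A u -> isometry_group ip f A (gam (r, u)).
Proof.
move=> Eu; have [su su'] := E_space_smooth Eu; rewrite gammaE.
apply: (@model_isometry R V ip f A Vc Asym 1 idfun r u ltr01 su su' _ _ _ _ idfun) => //.
- by move=> t t0; exact: E_space_ode.
- by move=> v; rewrite expr1n scale1r.
- by move=> t t0; rewrite expr1n !mul1r.
Qed.

Lemma gamma_hat_isometry : isometry_group ip f A ghat.
Proof.
have [su su'] := E_space_smooth huhat; rewrite gamma_hatE.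
apply: (@model_isometry R V ip f A Vc Asym q C rhat uhat q0 su su' _ _ _ _ C') => //.
by move=> t t0; exact: E_space_ode.
Qed.

Definition gamma_hat_inv : Mhat V -> Mhat V := Mhat_map (model_inv ip q rhat uhat C').

Lemma gamma_hatK : cancel ghat gamma_hat_inv.
Proof. exact: (Mhat_model_mapK ip rhat uhat q0 CC'). Qed.

Lemma gamma_hat_invK : cancel gamma_hat_inv ghat.
Proof. exact: (Mhat_model_invK ip rhat uhat q0 C'C). Qed.

Lemma gamma_hat_smooth : smooth_on H (Mhat_expr ghat).
Proof.
have [su su'] := E_space_smooth huhat.
exact: (Mhat_model_map_smooth ip Vc C rhat q0 su su').
Qed.

Lemma gamma_hat_inv_smooth : smooth_on H (Mhat_expr gamma_hat_inv).
Proof.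
have [su su'] := E_space_smooth huhat.
exact: (Mhat_model_inv_smooth ip Vc rhat q0 su su' C').
Qed.

Lemma val_gamma r u x : val (gam (r, u) x) = model_map ip 1 idfun r u (val x).
Proof.
rewrite gammaE val_Mhat_map //; exact: (model_map_half_space ip idfun r u ltr01 (val_half_space x)).
Qed.

Lemma val_gamma_hat x : val (ghat x) = model_map ip q C rhat uhat (val x).
Proof.
rewrite gamma_hatE val_Mhat_map //; exact: (model_map_half_space ip C rhat uhat q0 (val_half_space x)).
Qed.

Lemma CT_derive1 u (t : R) : E_space f A u -> 0 < t ->
  derive1 (CT q C u) (q * t) = q^-1 *: C (derive1 u t).
Proof.
move=> Eu t0; have q_neq0 : q != 0 by rewrite gt_eqF.
have qt : q^-1 * (q * t) = t by rewrite mulKf.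
have du : differentiable u (q^-1 * (q * t)) by rewrite qt; case: (E_space_diff Eu t0).
have -> : CT q C u = fun s => C (u (q^-1 * s)).
  by apply/funext => s; rewrite /CT /T_op /= mulrC.
have Hd := derive1_lin_scaled (@linc C) du.
have dd := @ex_diff _ _ _ _ _ _ _ Hd.
by rewrite derive1E' // (@diff_val _ _ _ _ _ _ _ Hd) scale1r qt.
Qed.

Lemma CT_at u t : CT q C u (q * t) = C (u t).
Proof. by rewrite /CT /T_op /= mulrC mulKf // gt_eqF. Qed.

(** Interchanging the two maps changes the shift of the second coordinate by [2
Omega (CT u) uhat], computed at the time [q t]; the result is a constant
because [Omega] does not depend on the time. *)
Lemma model_conj r u y : E_space f A u -> E_space f A (CT q C u) -> H y ->
  model_map ip q C rhat uhat (model_map ip 1 idfun r u y) =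
  model_map ip 1 idfun (2 * Omega ip (CT q C u) uhat + r / q) (CT q C u)
    (model_map ip q C rhat uhat y).
Proof.
case: y => -[t s] v Eu ECu; rewrite /half_space /= => t0.
have qt0 : 0 < q * t by rewrite mulr_gt0.
have Om := Omega_constant ECu huhat qt0.
have Cv : C (v + u t) = C v + C (u t) by rewrite linearD.
rewrite /model_map /= !mul1r !divr1 CT_derive1 // CT_at Cv.
move: Om; rewrite CT_derive1 // CT_at => <-.
have -> : ip (derive1 u t) (2 *: v + u t) = 2 * ip (C (derive1 u t)) (C v) + ip (C (derive1 u t)) (C (u t)).
  by rewrite ipDr ipZr !Ciso.
set w := derive1 uhat (q * t); set z := uhat (q * t).
set a := C v; set p := C (u t); set p' := C (derive1 u t).
congr ((_, _), _); last by rewrite addrAC.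
rewrite !(ipDl, ipDr, ipZl, ipZr) (ipC ip p w).
lra.
Qed.

Lemma gamma_conj r u : E_space f A u -> E_space f A (CT q C u) ->
  ghat \o gam (r, u) = gam (Pi_op ip q C uhat (r, u)) \o ghat.
Proof.
move=> Eu ECu; apply/funext => x; apply: Mhat_eq => /=.
rewrite val_gamma_hat val_gamma /Pi_op /= val_gamma val_gamma_hat.
exact: (model_conj r Eu ECu (val_half_space x)).
Qed.

(** * Coordinates in which the lattice acts by integer translations *)

Variables (m : nat) (L : set (R -> V)) (ell : 'I_m -> R -> V).
Hypothesis Lbasis : is_basis ell L.
Hypothesis LE : L `<=` E_space f A.
Hypothesis LCT : forall u, L u -> L (CT q C u).
Hypothesis Lom : forall u u', L u -> L u' -> Omega ip u u' = 0.
Hypothesis Lev : forall t, 0 < t -> set_bij L setT (fun u => u t).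
Variables (d : nat) (b : 'I_d -> R * (R -> V)).
Hypothesis bbasis : is_basis b (setT `*` L).

Lemma L_comb (a : 'I_m -> R) : L (\sum_i a i *: ell i).
Proof. by case: Lbasis => _ ->; exists a. Qed.

Lemma L_inj (t : R) u u' : 0 < t -> L u -> L u' -> u t = u' t -> u = u'.
Proof.
by move=> t0 Lu Lu' uu'; have [_ inj _] := Lev t0; apply: inj => //; exact/mem_set.
Qed.

Lemma L_Omega u u' (t : R) : L u -> L u' -> 0 < t -> ip (derive1 u t) (u' t) = ip (u t) (derive1 u' t).
Proof.
move=> Lu Lu' t0; apply/eqP; rewrite -subr_eq0; apply/eqP.
by rewrite (Omega_constant (LE Lu) (LE Lu') t0) Lom.
Qed.

(** In these coordinates on [R * L] the elements of [Sigma] are the integer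
vectors. *)
Definition ru (y : 'rV[R]_d) : R * (R -> V) := \sum_i y 0 i *: b i.

Lemma ruL y : L (ru y).2.
Proof.
case: bbasis => _ bE; have : (setT `*` L) (ru y) by rewrite bE; exists (y 0).
by case.
Qed.

Lemma ru_span r u : L u -> exists y, ru y = (r, u).
Proof.
move=> Lu; case: bbasis => _ bE.
have : (setT `*` L) (r, u) by split.
rewrite bE => -[a ->]; exists (\row_i a i); apply: eq_bigr => i _; by rewrite mxE.
Qed.

Lemma ru_inj y y' : ru y = ru y' -> y = y'.
Proof.
move=> ruyy; case: bbasis => bfree _; apply/rowP => i; apply/eqP; rewrite -subr_eq0; apply/eqP.
apply: (bfree (fun i => y 0 i - y' 0 i)).
rewrite -[RHS](subrr (ru y')) -{1}ruyy /ru -sumrB.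
by apply: eq_bigr => j _; rewrite scalerBl.
Qed.

Lemma ruD y y' : ru (y + y') = ru y + ru y'.
Proof. by rewrite /ru -big_split; apply: eq_bigr => i _; rewrite mxE scalerDl. Qed.

Lemma ruZ k y : ru (k *: y) = k *: ru y.
Proof. by rewrite /ru scaler_sumr; apply: eq_bigr => i _; rewrite mxE scalerA. Qed.

Lemma b2L i : L (b i).2.
Proof.
case: bbasis => _ bE; have : (setT `*` L) (b i).
  rewrite bE; exists (fun j => (j == i)%:R); rewrite (bigD1 i) //= eqxx scale1r big1 ?addr0 //.
  by move=> j /negbTE ->; rewrite scale0r.
by case.
Qed.

Lemma ru1E y : (ru y).1 = \sum_i y 0 i * (b i).1.
Proof. by rewrite /ru fst_sum. Qed.

Lemma ru2E y : (ru y).2 = \sum_i y 0 i *: (b i).2.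
Proof. by rewrite /ru snd_sum. Qed.

Lemma ru2_at y t : (ru y).2 t = \sum_i y 0 i *: (b i).2 t.
Proof. by rewrite ru2E fct_sumE. Qed.

Lemma ru2_derive1 y (t : R) : 0 < t -> derive1 (ru y).2 t = \sum_i y 0 i *: derive1 (b i).2 t.
Proof.
move=> t0; rewrite ru2E; have [] // := @derive1_comb R V _ (index_enum 'I_d) (y 0) (fun i => (b i).2) t.
by move=> i; case: (E_space_diff (LE (b2L i)) t0).
Qed.

Lemma derive1_addL u u' (t : R) : L u -> L u' -> 0 < t -> derive1 (u + u') t = derive1 u t + derive1 u' t.
Proof.
move=> Lu Lu' t0; have [du _] := E_space_diff (LE Lu) t0; have [du' _] := E_space_diff (LE Lu') t0.
by rewrite !derive1E deriveD //; exact: diff_derivable.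
Qed.

(** [tau] is the logarithm of the time to base [q], so that [t |-> q t] becomes
[tau |-> tau + 1]. *)
Definition clock (tau : R) : R := expR (tau * ln q).

Lemma clock_gt0 tau : 0 < clock tau. Proof. exact: expR_gt0. Qed.

Lemma lnq_neq0 : ln q != 0.
Proof.
apply: contra q1 => /eqP lq; apply/eqP; apply: (ln_inj (R := R)); rewrite ?posrE // lq ln1 //.
Qed.

Lemma clockK tau : ln (clock tau) / ln q = tau.
Proof. by rewrite /clock expRK mulfK // lnq_neq0. Qed.

Lemma lnK_clock (t : R) : 0 < t -> clock (ln t / ln q) = t.
Proof. by move=> t0; rewrite /clock divfK ?lnq_neq0 // lnK. Qed.

(** [param (tau, y)] is the image of the point [((q ^ tau, 0), 0)] under the
isometry given by [ru y]. So the curve of these points meets every orbit of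
[R * L] once. *)
Definition param (p : R * 'rV[R]_d) : E :=
  let t := clock p.1 in let u := (ru p.2).2 in
  ((t, - ip (derive1 u t) (u t) + (ru p.2).1), u t).

Lemma param_half_space p : H (param p).
Proof. exact: clock_gt0. Qed.

Lemma param_smooth : smooth_on setT param.
Proof.
move=> n; have oT := @openT (R * 'rV[R]_d)%type.
have Cy i : Ck n setT (fun p : R * 'rV[R]_d => p.2 0 i).
  by apply: Ck_coord => //; exact: (@smooth_lin R _ _ setT snd (fun x => cvg_snd)).
have Ct : Ck n setT (fun p : R * 'rV[R]_d => clock p.1).
  apply: (@Ck_comp _ _ _ _ _ setT setT (fun p : R * 'rV[R]_d => p.1 * ln q) (@expR R)) => //.
  - exact: R_has_coords.
  - apply: Ck_M => //; last exact: Ck_cst.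
    exact: (@smooth_lin R _ _ setT fst (fun x => cvg_fst)).
  - exact: smooth_expR.
have Cc (u : R -> V) : smooth_on pos u -> Ck n setT (fun p : R * 'rV[R]_d => u (clock p.1)).
  move=> su; apply: (@Ck_comp _ _ _ _ _ setT pos (fun p : R * 'rV[R]_d => clock p.1) u) => //.
  - exact: R_has_coords.
  - by move=> p _; exact: clock_gt0.
have Cu : Ck n setT (fun p : R * 'rV[R]_d => (ru p.2).2 (clock p.1)).
  rewrite (_ : (fun _ => _) = fun p : R * 'rV[R]_d => \sum_i p.2 0 i *: (b i).2 (clock p.1)); last first.
    by apply/funext => p; rewrite ru2_at.
  apply: Ck_sum => // i _; apply: Ck_Z => //; apply: Cc.
  by have [] := E_space_smooth (LE (b2L i)).
have Cu' : Ck n setT (fun p : R * 'rV[R]_d => derive1 (ru p.2).2 (clock p.1)).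
  rewrite (_ : (fun _ => _) = fun p : R * 'rV[R]_d => \sum_i p.2 0 i *: derive1 (b i).2 (clock p.1)); last first.
    by apply/funext => p; rewrite ru2_derive1 //; exact: clock_gt0.
  apply: Ck_sum => // i _; apply: Ck_Z => //; apply: Cc.
  by have [] := E_space_smooth (LE (b2L i)).
apply: Ck_pair => //; apply: Ck_pair => //.
rewrite (_ : (fun _ => _) = fun p : R * 'rV[R]_d => -1 * ip (derive1 (ru p.2).2 (clock p.1)) ((ru p.2).2 (clock p.1))
   + \sum_i p.2 0 i * (b i).1); last first.
  by apply/funext => p; rewrite mulN1r ru1E.
apply: Ck_D => //; first by apply: Ck_M => //; [exact: Ck_cst|exact: Ck_ip].
apply: Ck_sum => // i _; apply: Ck_M => //; exact: Ck_cst.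
Qed.

Variables (e : 'I_m -> V) (phi : 'I_m -> {linear V -> R}).
Hypothesis phic : forall i, continuous (phi i).
Hypothesis phiE : forall w, w = \sum_i phi i w *: e i.

Definition frame (t : R) : 'M[R]_m := \matrix_(j, i) phi i (ell j t).

(** Evaluation at [t] is injective on [L]. *)
Lemma frame_unit t : 0 < t -> frame t \in unitmx.
Proof.
move=> t0; rewrite -row_free_unit; apply: inj_row_free => w /rowP wB.
have wt : (\sum_j w 0 j *: ell j) t = 0.
  rewrite fct_sumE [LHS]phiE big1 // => i _.
  have := wB i; rewrite !mxE => wBi.
  rewrite linear_sum (_ : \sum_j _ = 0) ?scale0r // -[RHS]wBi.
  by apply: eq_bigr => j _; rewrite linearZ mxE.
have w0 : \sum_j w 0 j *: ell j = 0.
  have L0 : L 0 by have := L_comb (fun=> 0); rewrite big1 // => i _; rewrite scale0r.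
  by apply: (L_inj t0 (L_comb _) L0); rewrite wt.
by case: Lbasis => Lfree _; apply/rowP => j; rewrite mxE; exact: Lfree w0 j.
Qed.

Definition weights (x : E) : 'rV[R]_m := (\row_i phi i x.2) *m invmx (frame x.1.1).

(** This is the element of [L] whose value at the time of [x] is the
[V]-component of [x]; the weights solve the linear system for its
coefficients. *)
Definition curve_of (x : E) : R -> V := \sum_j weights x 0 j *: ell j.

Lemma curve_ofL x : L (curve_of x). Proof. exact: L_comb. Qed.

Lemma curve_of_at x : H x -> curve_of x x.1.1 = x.2.
Proof.
move=> t0; rewrite /curve_of fct_sumE [LHS]phiE [RHS]phiE; apply: eq_bigr => i _; congr (_ *: _).
have : weights x *m frame x.1.1 = \row_i phi i x.2 by rewrite /weights mulmxKV // frame_unit.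
move=> /rowP/(_ i); rewrite [LHS]mxE [RHS]mxE => <-; rewrite linear_sum.
by apply: eq_bigr => j _; rewrite linearZ [frame x.1.1 j i]mxE.
Qed.

Lemma curve_of_eq x u : H x -> L u -> u x.1.1 = x.2 -> curve_of x = u.
Proof.
move=> Hx Lu ux; by apply: (L_inj Hx (curve_ofL x) Lu); rewrite curve_of_at // ux.
Qed.

Lemma ell_comb j : \sum_i (i == j)%:R *: ell i = ell j.
Proof.
rewrite (bigD1 j) //= eqxx scale1r big1 ?addr0 // => i /negbTE ->.
by rewrite scale0r.
Qed.

Lemma L_ell j : L (ell j).
Proof. by rewrite -ell_comb; exact: L_comb. Qed.

Definition coord_unit : 'rV[R]_d := sval (cid (ru_span 1 (L_comb (fun=> 0)))).
Definition coord_ell (j : 'I_m) : 'rV[R]_d :=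
  sval (cid (ru_span 0 (L_ell j))).

Lemma ru_unit : ru coord_unit = (1, 0).
Proof.
rewrite /coord_unit; case: (cid _) => y /= ->; congr pair.
by rewrite big1 // => i _; rewrite scale0r.
Qed.

Lemma ru_ell j : ru (coord_ell j) = (0, ell j).
Proof.
by rewrite /coord_ell; case: (cid _) => y /= ->.
Qed.

(** The equation [s = - <u' t, u t> + r] of [param] solved for [r]. *)
Definition lift_coord (x : E) : 'rV[R]_d :=
  (x.1.2 + ip (derive1 (curve_of x) x.1.1) x.2) *: coord_unit +
  \sum_j weights x 0 j *: coord_ell j.

Lemma ru_sum I (r : seq I) (F : I -> 'rV[R]_d) : ru (\sum_(i <- r) F i) = \sum_(i <- r) ru (F i).
Proof.
elim: r => [|i r IH]; last by rewrite !big_cons ruD IH.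
by rewrite !big_nil /ru big1 // => i _; rewrite mxE scale0r.
Qed.

Lemma ru_lift x : ru (lift_coord x) = (x.1.2 + ip (derive1 (curve_of x) x.1.1) x.2, curve_of x).
Proof.
rewrite /lift_coord ruD ruZ ru_unit ru_sum.
have -> : \sum_j ru (weights x 0 j *: coord_ell j) = (0, curve_of x).
  apply: injective_projections; rewrite ?fst_sum ?snd_sum /=.
    by rewrite big1 // => j _; rewrite ruZ ru_ell /= scaler0.
  by apply: eq_bigr => j _; rewrite ruZ ru_ell.
apply: injective_projections => /=; first by rewrite addr0 [_ *: _]mulr1.
by rewrite scaler0 add0r.
Qed.

Definition chart_coord (x : E) : R * 'rV[R]_d := (ln x.1.1 / ln q, lift_coord x).

Lemma chart_coordK x : H x -> param (chart_coord x) = x.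
Proof.
move=> Hx; rewrite /param /= lnK_clock // ru_lift /= curve_of_at //.
by case: x Hx => -[t s] v Hx /=; congr ((_, _), _); rewrite addrC addrK.
Qed.

Lemma paramK p : chart_coord (param p) = p.
Proof.
case: p => tau y; rewrite /chart_coord {1}/param /= clockK; congr pair.
apply: ru_inj; rewrite ru_lift (@curve_of_eq _ (ru y).2) //; last 2 first.
- exact: param_half_space.
- exact: ruL.
by rewrite /param /= addrAC addNr add0r -surjective_pairing.
Qed.

Lemma chart_coord_smooth : smooth_on H chart_coord.
Proof.
move=> n; have oH := @open_half_space R V.
have Ct (W : normedModType R) (k : R -> W) : smooth_on pos k -> Ck n H (fun x : E => k x.1.1).
  move=> sk; have := smooth_curve (V := V) ltr01 sk n; apply: eq_Ck => // x _.
  by rewrite mul1r.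
have Cw j : Ck n H (fun x => weights x 0 j).
  rewrite (_ : (fun _ => _) = fun x : E => \sum_i phi i x.2 * invmx (frame x.1.1) i j); last first.
    by apply/funext => x; rewrite mxE; apply: eq_bigr => i _; rewrite mxE.
  apply: Ck_sum => // i _; apply: Ck_M => //.
    by apply: (@Ck_lin_comp _ _ _ R n H (fun x : E => x.2) (phi i)) => //; exact: smooth_fibre.
  apply: Ck_invmx => //; first by move=> x Hx; exact: frame_unit.
  move=> k l; rewrite (_ : (fun _ => _) = fun x : E => (phi l \o ell k) x.1.1); last first.
    by apply/funext => x; rewrite mxE.
  apply: (Ct R (phi l \o ell k)) => n'; apply: (@Ck_lin_comp _ _ _ R n' pos (ell k) (phi l)) => //.
  have Lk := L_ell k.
  by have [sl _] := E_space_smooth (LE Lk); exact: sl.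
apply: Ck_pair => //.
  by apply: Ck_M => //; [exact: Ct smooth_ln|exact: Ck_cst].
apply: Ck_D => //; last first.
  by apply: Ck_sum => // j _; apply: Ck_Z => //; exact: Ck_cst.
apply: Ck_Z => //; last exact: Ck_cst.
apply: Ck_D => //; first exact: smooth_shift.
apply: (@eq_Ck _ _ _ n H (fun x : E => ip (\sum_j weights x 0 j *: derive1 (ell j) x.1.1) x.2)) => //.
  move=> x Hx; congr (ip _ _); rewrite /curve_of.
  have [] // := @derive1_comb R V _ (index_enum 'I_m) (weights x 0) ell x.1.1.
  move=> j; have Lj := L_ell j.
  by case: (E_space_diff (LE Lj) Hx).
apply: Ck_ip => //; last exact: smooth_fibre.
apply: Ck_sum => // j _; apply: Ck_Z => //; apply: Ct.
have Lj := L_ell j.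
by have [] := E_space_smooth (LE Lj).
Qed.

(** * The group generated by the lattice and the dilational isometry *)

Local Notation transl := (translation (@to_Mhat R V) val chart_coord param).
Local Notation hgt := (height (X := Mhat V) val chart_coord).

(** Since [L] is isotropic, [<u', w> = <u, w'>] for [u] and [w] in [L], so the
shifts of the second coordinate add up. *)
Lemma model_param tau y z :
  model_map ip 1 idfun (ru z).1 (ru z).2 (param (tau, y)) = param (tau, y + z).
Proof.
have t0 := clock_gt0 tau; rewrite /model_map /param /= !mul1r !divr1 ruD.
have L1 := ruL y; have L2 := ruL z; have Om := L_Omega L2 L1 t0.
have -> : (ru y + ru z).2 = (ru y).2 + (ru z).2 by [].
have -> : (ru y + ru z).1 = (ru y).1 + (ru z).1 by [].
rewrite derive1_addL //; set u := (ru y).2 in L1 Om *; set w := (ru z).2 in L2 Om *.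
congr ((_, _), _).
rewrite -[(u + w) (clock tau)]/(u (clock tau) + w (clock tau)).
rewrite !(ipDl, ipDr, ipZl, ipZr) Om (ipC ip (w (clock tau)) (derive1 u (clock tau))); lra.
Qed.

Lemma gamma_translation z : gam (ru z) = transl z.
Proof.
apply/funext => x; apply: Mhat_eq; have Hx := val_half_space x.
rewrite [ru z]surjective_pairing val_gamma /translation /point_at to_MhatK; last exact: param_half_space.
by rewrite -{1}(chart_coordK Hx) [chart_coord (val x)]surjective_pairing model_param.
Qed.

Lemma height_gamma_hat x : hgt (ghat x) = hgt x + 1.
Proof.
have := val_half_space x; rewrite /half_space => t0.
by rewrite /height val_gamma_hat /= lnM ?posrE // mulrDl mulfV ?lnq_neq0 // addrC.
Qed.

Variable Sigma : set (R * (R -> V)).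
Hypothesis SigmaE : Sigma = [set u | exists z : 'I_d -> int, u = \sum_(i < d) (z i)%:~R *: b i].
Hypothesis PiSigma : Pi_op ip q C uhat @` Sigma = Sigma.

Lemma Sigma_ru w : Sigma w <-> exists2 z, int_vect z & ru z = w.
Proof.
rewrite SigmaE; split=> [[z ->]|[z Zz <-]].
  exists (\row_i (z i)%:~R); first by move=> i; rewrite mxE intr_int.
  by apply: eq_bigr => i _; rewrite mxE.
exists (fun i => Num.floor (z 0 i)); apply: eq_bigr => i _.
by rewrite floorK // Zz.
Qed.

Lemma L_E_CT u : L u -> E_space f A u /\ E_space f A (CT q C u).
Proof. by move=> Lu; split; [exact: LE|exact/LE/LCT]. Qed.

Lemma gamma_hat_translation z : int_vect z ->
  exists2 z', int_vect z' & ghat \o transl z = transl z' \o ghat.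
Proof.
move=> Zz; have Sz : Sigma (ru z) by apply/Sigma_ru; exists z.
have : Sigma (Pi_op ip q C uhat (ru z)) by rewrite -PiSigma; exists (ru z).
move=> /Sigma_ru [z' Zz' ruz']; exists z' => //.
have [Eu ECu] := L_E_CT (ruL z).
by rewrite -!gamma_translation ruz' {1}[ru z]surjective_pairing gamma_conj // -surjective_pairing.
Qed.

Lemma translation_gamma_hat z : int_vect z ->
  exists2 z', int_vect z' & ghat \o transl z' = transl z \o ghat.
Proof.
move=> Zz; have : Sigma (ru z) by apply/Sigma_ru; exists z.
rewrite -PiSigma => -[w /Sigma_ru [z' Zz' <-] Piz']; exists z' => //.
have [Eu ECu] := L_E_CT (ruL z').
by rewrite -!gamma_translation -Piz' {1}[ru z']surjective_pairing gamma_conj // -surjective_pairing.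
Qed.

Lemma Gamma_generatorsE : Gamma_generators ip q C rhat uhat Sigma =
  mt_generators (@to_Mhat R V) val chart_coord param ghat.
Proof.
rewrite /Gamma_generators /mt_generators; congr (_ `|` _).
apply/seteqP; split=> [_ [w /Sigma_ru [z Zz <-] <-]|_ [z Zz <-]].
  by exists z => //; rewrite gamma_translation.
by exists (ru z); [apply/Sigma_ru; exists z|rewrite gamma_translation].
Qed.

(** Orthogonality to the line spanned by the second coordinate vector is the
vanishing of [dt], and the height is a function of [t] alone. *)
Lemma perp_differential y : H y -> P_perp ip f A y = [set v | ('d chart_coord y v).1 = 0].
Proof.
move=> Hy; have dln : differentiable (@ln R) y.1.1 by exact: Ck_diff (smooth_ln 0%N) Hy.
have dt : is_diff y (fun x : E => x.1.1) (fun X => X.1.1).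
  exact: (is_diff_lin (l := fst \o fst) y time_continuous).
have dh := is_diff_scale (ln q)^-1 (is_diff_curve (h := fun x : E => x.1.1) dln dt).
have dhE v : ('d chart_coord y v).1 = (ln q)^-1 *: (v.1.1 *: y.1.1^-1).
  rewrite -(diff_height chart_coord_smooth) //.
  have <- : 'd (fun x : E => (ln q)^-1 *: ln x.1.1) y v = (ln q)^-1 *: (v.1.1 *: y.1.1^-1).
    rewrite (@diff_val _ _ _ _ _ _ _ dh); congr (_ *: (_ *: _)).
    by rewrite derive1E; have [_ ->] := is_derive1_ln Hy.
  by congr ('d _ y v); apply/funext => x; rewrite /chart_coord /= mulrC.
apply/seteqP; split=> v /=.
  move=> /(_ ((0, 1), 0)) vP; have : P_line y ((0, 1), 0) by exists 1.
  move=> /vP; rewrite /Defs.ghat /= (ipC ip) ip0l => v0'.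
  have v0 : v.1.1 = 0 by lra.
  by rewrite dhE v0 scale0r scaler0.
rewrite dhE => /eqP; rewrite scaler_eq0 invr_eq0 (negbTE lnq_neq0) /= scaler_eq0 invr_eq0.
rewrite (gt_eqF Hy) orbF => /eqP v0 Y [c ->].
by rewrite /Defs.ghat /= v0 !(mul0r, mulr0, addr0, add0r) (ipC ip) ip0l.
Qed.

Local Notation Pi := (Pi_op ip q C uhat).

Lemma derive1_linL (k : R) u u' (t : R) : L u -> L u' -> 0 < t ->
  derive1 (k *: u + u') t = k *: derive1 u t + derive1 u' t.
Proof.
move=> Lu Lu' t0; have [du _] := E_space_diff (LE Lu) t0; have [du' _] := E_space_diff (LE Lu') t0.
have dku : differentiable (k *: u) t by exact: differentiableZ.
by rewrite !derive1E deriveD ?deriveZ //; exact: diff_derivable.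
Qed.

Lemma CT_lin (k : R) u u' : CT q C (k *: u + u') = k *: CT q C u + CT q C u'.
Proof. by apply/funext => t; rewrite /CT /T_op /= linearP. Qed.

Lemma Pi_lin (k : R) w w' : L w.2 -> L w'.2 -> Pi (k *: w + w') = k *: Pi w + Pi w'.
Proof.
move=> Lw Lw'; rewrite /Pi_op [(k *: w + w').2]/= CT_lin.
apply: injective_projections => //=.
rewrite /Omega derive1_linL ?ltr01 //; [|exact: LCT|exact: LCT].
rewrite -[(k *: CT q C w.2 + CT q C w'.2) 1]/(k *: (CT q C w.2 1) + CT q C w'.2 1).
rewrite !(ipDl, ipZl) /GRing.scale /=.
set x1 := ip _ _; set x2 := ip _ _; set x3 := ip _ _; set x4 := ip _ _; set qi := q^-1.
lra.
Qed.

Lemma iter_PiL p w : L w.2 -> L (iter p Pi w).2.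
Proof. by move=> Lw; elim: p => //= p IH; exact: LCT. Qed.

Lemma iter_Pi_lin p (k : R) w w' : L w.2 -> L w'.2 ->
  iter p Pi (k *: w + w') = k *: iter p Pi w + iter p Pi w'.
Proof.
by move=> Lw Lw'; elim: p => //= p ->; rewrite Pi_lin //; exact: iter_PiL.
Qed.

Lemma iter_Pi_unit p r : iter p Pi (r, 0) = (r / q ^+ p, 0).
Proof.
elim: p => [|p IH]; first by rewrite expr0 divr1.
rewrite iterS IH /Pi_op /=; have -> : CT q C (0 : R -> V) = 0.
  by apply/funext => t; rewrite /CT /T_op /= linear0.
congr pair; rewrite /Omega (_ : derive1 (0 : R -> V) 1 = 0); last exact: derive1_cst.
rewrite -[(0 : R -> V) 1]/(0 : V) !ip0l subrr mulr0 add0r exprSr invfM mulrA //.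
Qed.

Lemma iter_gamma_conj p w : L w.2 -> iter p ghat \o gam w = gam (iter p Pi w) \o iter p ghat.
Proof.
elim: p w => [//|p IH] w Lw; have Lp := iter_PiL p Lw; have [Eu ECu] := L_E_CT Lp.
have := gamma_conj (iter p Pi w).1 Eu ECu; rewrite -surjective_pairing => Hc.
rewrite -[LHS]/(ghat \o (iter p ghat \o gam w)) IH //.
by rewrite -[LHS]/((ghat \o gam (iter p Pi w)) \o iter p ghat) Hc.
Qed.

Lemma gamma_inj w w' : L w.2 -> L w'.2 -> gam w = gam w' -> w = w'.
Proof.
move=> Lw Lw'; have [y yE] := ru_span w.1 Lw; have [y' yE'] := ru_span w'.1 Lw'.
rewrite -surjective_pairing in yE; rewrite -surjective_pairing in yE'.
rewrite -yE -yE' !gamma_translation => tt; congr ru.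
pose x : Mhat V := to_Mhat (param (0, 0)).
have ft z : fibre_coord (X := Mhat V) val chart_coord (transl z x) = fibre_coord (X := Mhat V) val chart_coord x + z.
  exact: (fibre_translation Mhat_chart param_half_space paramK).
by apply: (@addrI _ (fibre_coord (X := Mhat V) val chart_coord x)); rewrite -!ft tt.
Qed.

Local Notation S := (Gamma_generators ip q C rhat uhat Sigma).

Lemma Gamma_isometries : generated_group S `<=` isometry_group ip f A.
Proof.
apply: generated_group_min; first exact: isometry_group_group.
move=> _ [->|[[r u] Sru <-]]; first exact: gamma_hat_isometry.
apply: gamma_isometry; apply: LE.
by have /Sigma_ru [z _ zE] := Sru; have := ruL z; rewrite zE.
Qed.

Lemma delta_int (i : 'I_d) : int_vect (delta_mx 0 i : 'rV[R]_d).
Proof. by move=> j; rewrite mxE; case: (_ && _); rewrite ?int_num0 ?int_num1. Qed.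

(** If a power of [gamma_hat] commutes with multiples of all elements of
[Sigma], then by linearity the same power of [Pi] fixes every element of
[Sigma], hence all of [R * L]. But [Pi (1, 0) = (1 / q, 0)]. *)
Lemma Gamma_not_virtually_abelian : ~ has_abelian_subgroup_of_finite_index (generated_group S).
Proof.
rewrite Gamma_generatorsE => /(mt_abelian_finite_index Mhat_chart param_half_space paramK chart_coordK
  gamma_hatK gamma_hat_invK gamma_hat_translation translation_gamma_hat) [p p0 Hp].
have iterK j x : iter j ghat (iter j gamma_hat_inv x) = x.
  by elim: j x => //= j IH x; rewrite -iterS iterSr gamma_hat_invK IH.
have fixI z : int_vect z -> iter p Pi (ru z) = ru z.
  move=> Zz; have [N N0] := Hp z Zz; rewrite /= -gamma_translation iter_gamma_conj; last exact: ruL.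
  move=> E1; have LP := iter_PiL p (ruL (z *+ N)).
  have E2 : iter p Pi (ru (z *+ N)) = ru (z *+ N).
    apply: gamma_inj LP (ruL _) _; apply/funext => x.
    have := congr1 (@^~ (iter p gamma_hat_inv x)) E1; rewrite /=.
    by rewrite iterK.
  have L0 : L (ru 0).2 by exact: ruL.
  have Nn : (N%:R : R) != 0 by rewrite pnatr_eq0 -lt0n.
  have zE : z = N%:R^-1 *: (z *+ N) + 0.
    by rewrite -(scaler_nat N z) scalerA mulVf // scale1r addr0.
  have ru0 : ru 0 = 0 by rewrite -(scale0r 0) ruZ scale0r.
  have i0 : iter p Pi 0 = 0.
    by have := iter_Pi_unit p 0; rewrite mul0r.
  rewrite {1}zE ruD ruZ iter_Pi_lin; [|exact: ruL|exact: ruL].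
  by rewrite E2 ru0 i0 -ruZ -ru0 -ruD -zE.
have fix1 y : iter p Pi (ru y) = ru y.
  rewrite (row_sum_delta y); elim: (index_enum _) => [|i r IH].
    by rewrite big_nil; apply: fixI; exact: int_vect0.
  rewrite big_cons ruD ruZ iter_Pi_lin; [|exact: ruL|exact: ruL].
  by rewrite IH fixI //; exact: delta_int.
have := fix1 coord_unit; rewrite ru_unit iter_Pi_unit => -[/eqP].
by rewrite mul1r invr_eq1 pexpr_eq1 ?(ltW q0) // (negbTE q1).
Qed.

Lemma Gamma_conclusion :
  let Mq := M ip q C rhat uhat Sigma in
  let atl := M_atlas ip q C rhat uhat Sigma in
  let Gam := Gamma ip q C rhat uhat Sigma in
  [/\ acts_freely Gam,
      acts_properly_discontinuously Gam &
      [/\ smooth_manifold atl,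
          compact [set: Mq],
          exists2 pi : Mq -> torus R 1,
            smooth_fibre_bundle atl (torus_atlas R 1) (torus_atlas R d) pi &
            forall N : set Mq,
              leaf atl (P_perp ip f A) N <-> exists c, N = pi @^-1` [set c],
          (forall x : Mq, fundamental_group_is R Gam x) /\
          ~ has_abelian_subgroup_of_finite_index Gam &
          forall k : nat,
            ~ diffeomorphic (torus_atlas R k) atl /\
            ~ (exists p : torus R k -> Mq, covering_map p)]].
Proof.
have nab := Gamma_not_virtually_abelian.
rewrite /Gamma /M /M_atlas /Mhat_atlas; rewrite Gamma_generatorsE in nab *.
exact: (mt_conclusion (space_has_coords Vc) Mhat_chart chart_coord_smooth param_smooth
  param_half_space paramK chart_coordK gamma_hatK gamma_hat_invK gamma_hat_smooth
  gamma_hat_inv_smooth height_gamma_hat gamma_hat_translation translation_gamma_hat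
  perp_differential (@half_space_convex R V) nab).
Qed.

End GammaAction.

(** * The exponents of a spectral system *)

Section SpectralAlgebra.
Context {R : realType}.

Lemma basis_expand (U : lmodType R) d (b : 'I_d -> U) d' (b' : 'I_d' -> U) S :
  is_basis b S -> is_basis b' S ->
  exists P : 'M[R]_(d', d), forall i, b' i = \sum_j P i j *: b j.
Proof.
move=> [_ SE] [_ SE'].
have ex i : exists a : 'I_d -> R, b' i = \sum_j a j *: b j.
  suff : S (b' i) by rewrite SE.
  rewrite SE'; exists (fun j => (i == j)%:R).
  rewrite (bigD1 i) //= eqxx scale1r big1 ?addr0 // => j /negbTE ji.
  by rewrite eq_sym ji scale0r.
exists (\matrix_(i, j) sval (cid (ex i)) j) => i.
under eq_bigr do rewrite mxE.
by case: (cid _).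
Qed.

Lemma basis_free_mx (U : lmodType R) d (b : 'I_d -> U) S d' (b' : 'I_d' -> U)
    (P : 'M[R]_(d', d)) (Q : 'M[R]_(d, d')) :
  is_basis b S -> (forall i, b' i = \sum_j P i j *: b j) ->
  (forall i, b i = \sum_j Q i j *: b' j) -> Q *m P = 1%:M.
Proof.
move=> [free _] bP bQ; apply/matrixP => i j; apply/eqP.
rewrite -subr_eq0; apply/eqP; move: j.
apply: (free (fun j => (Q *m P) i j - 1%:M i j)).
under eq_bigr do rewrite scalerBl.
rewrite sumrB; apply/eqP; rewrite subr_eq0; apply/eqP.
rewrite [RHS](bigD1 i) //= mxE eqxx scale1r [X in _ = _ + X]big1 ?addr0; last first.
  by move=> j /negbTE ji; rewrite mxE eq_sym ji scale0r.
rewrite [RHS]bQ; under eq_bigr do rewrite mxE scaler_suml.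
rewrite exchange_big; apply: eq_bigr => j _.
by rewrite bP scaler_sumr; apply: eq_bigr => l _; rewrite scalerA.
Qed.

Lemma basis_dim (U : lmodType R) d (b : 'I_d -> U) d' (b' : 'I_d' -> U) S :
  is_basis b S -> is_basis b' S -> d = d'.
Proof.
move=> Hb Hb'; have [P bP] := basis_expand Hb Hb'; have [Q bQ] := basis_expand Hb' Hb.
apply/eqP; rewrite eqn_leq (mulmx1_min (basis_free_mx Hb bP bQ)).
by rewrite (mulmx1_min (basis_free_mx Hb' bQ bP)).
Qed.

(** This determines the rank of [Sigma], so that the fibres of [M] have
dimension [m + 1]. *)
Lemma basis_line_prod (U : lmodType R) d (b : 'I_d -> U) S : is_basis b S ->
  is_basis (fun i : 'I_d.+1 => if unlift ord0 i is Some j then (0, b j)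
                               else (1, 0) : R * U) (setT `*` S).
Proof.
move=> [free SE].
set b1 := fun i => _.
have sumE (a : 'I_d.+1 -> R) :
    \sum_i a i *: b1 i = (a ord0, \sum_j a (lift ord0 j) *: b j).
  rewrite big_ord_recl /b1 unlift_none.
  under eq_bigr do rewrite liftK.
  apply/pair_equal_spec; rewrite /= fst_sum snd_sum /=; split.
    by rewrite big1 ?addr0 => [|j _]; [exact: mulr1|exact: mulr0].
  by rewrite scaler0 add0r.
split=> [a|].
  rewrite sumE => /pair_equal_spec [a0 as0] i.
  by case: (unliftP ord0 i) => [j|] ->; [exact: (free (a \o lift ord0))|].
rewrite SE; apply/seteqP; split=> -[r u] /=.
  move=> [_ [a uE]]; exists (fun i => if unlift ord0 i is Some j then a j else r).
  rewrite sumE unlift_none uE; congr (_, _).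
  by apply: eq_bigr => j _; rewrite liftK.
by move=> [a]; rewrite sumE => -[_ uE]; split => //; exists (a \o lift ord0).
Qed.

(** [E (2i + 1) + E (2 (m - i)) = -1] because the two arguments add up to [2m +
1], and [E (2 (m - i)) = E (2 (m - i) - 1) - k] because the two arguments
are consecutive and the larger one is even. *)
Lemma spectral_exponents m k E J : Z_spectral_system m k E J ->
  let a (j : nat) : R := (E (2 * j - 1)%N)%:~R + (1 - k%:R) / 2 in
  [/\ a 1%N = 1 & forall i, (i < m)%N -> a i.+1 + a (m - i)%N = 0].
Proof.
move=> [[m2 k2 _ _] Ea Eb Ec _] a.
split.
  rewrite /a muln1 subn1 /=.
  have : ((k%:Z + 1)%:~R : R) = (2 * E 1%N)%:~R by rewrite Ea.
  rewrite rmorphD rmorphM /= -pmulrn => h; lra.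
move=> i im.
have [] := Eb (2 * i.+1 - 1)%N (2 * (m - i))%N; rewrite ?inE /inV; [lia..|].
move=> h1 _.
have [] := Ec (2 * (m - i) - 1)%N (2 * (m - i))%N; rewrite ?inE /inV; [lia|lia|lia|lia|].
move=> h2 _.
have := congr1 (intmul (1 : R)) h1; have := congr1 (intmul (1 : R)) h2.
rewrite rmorphB rmorphD /= -pmulrn mulrNz /= /a => g2 g1; lra.
Qed.

Section Data.
Context {V : normedModType R} (ip : {symmetric V}) (A C : {linear V -> V}) (q : R).
Variables (m k : nat) (E : nat -> int) (J : nat -> bool) (e : 'I_m -> V).
Hypothesis hEJ : Z_spectral_system m k E J.
Hypothesis hV : algebraic_data k E q ip e A C.

Let a (j : nat) : R := (E (2 * j - 1)%N)%:~R + (1 - k%:R) / 2.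

Let espan w : exists c : 'I_m -> R, w = \sum_i c i *: e i.
Proof.
by case: hV => eb _ _ _ _; have [phi [_ phiE _]] := basis_coords eb; exists (phi^~ w).
Qed.

Let first_ord : exists j : 'I_m, j.+1 = 1%N.
Proof.
have m0 : (0 < m)%N by case: hEJ => -[m2 _ _ _] _ _ _ _; exact: ltnW.
by exists (Ordinal m0).
Qed.

Let linear_comb (l : {linear V -> V}) (c : 'I_m -> R) (b : 'I_m -> V) :
  l (\sum_i c i *: b i) = \sum_i c i *: l (b i).
Proof. by rewrite linear_sum; apply: eq_bigr => i _; rewrite linearZ. Qed.

Lemma bilinear_basis_eq (A1 B1 A2 B2 : {linear V -> V}) :
  (forall i j, ip (A1 (e i)) (B1 (e j)) = ip (A2 (e i)) (B2 (e j))) ->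
  forall v w, ip (A1 v) (B1 w) = ip (A2 v) (B2 w).
Proof.
move=> h v w; have [x ->] := espan v; have [y ->] := espan w.
rewrite !linear_comb !ip_suml; apply: eq_bigr => i _.
by rewrite !ip_sumr; apply: eq_bigr => j _; rewrite !ipZl !ipZr h.
Qed.

(** The only nonzero value of [<A e_i, e_j>] is at [i = j = m], since [A e_m =
e_1] pairs with [e_m] only. *)
Lemma A_selfadjoint v w : ip (A v) w = ip v (A w).
Proof.
apply: (bilinear_basis_eq (A1 := A) (B1 := idfun) (A2 := idfun) (B2 := A)) => i j /=.
case: hV => _ [eps _ epsE] Alast A0 _; have [j0 j0E] := first_ord.
have Ae (l : 'I_m) : A (e l) = if (l.+1 == m) then e j0 else 0.
  by case: eqP => [lm|lm]; [exact: Alast|apply: A0; have := ltn_ord l; lia].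
rewrite !Ae; case: eqP => im; case: eqP => jm; rewrite ?ip0l //.
- by rewrite !epsE !j0E im jm addnC.
- by rewrite [RHS]ipC ip0l epsE j0E add1n eqSS (introF eqP jm).
- by rewrite epsE j0E addn1 eqSS (introF eqP im).
by rewrite [RHS]ipC ip0l.
Qed.

Hypothesis q0 : 0 < q.

(** [e_i] pairs nontrivially only with [e_(m+1-i)], and [a i + a (m + 1 - i) =
0]. *)
Lemma C_isometry v w : ip (C v) (C w) = ip v w.
Proof.
apply: (bilinear_basis_eq (A1 := C) (B1 := C) (A2 := idfun) (B2 := idfun)) => i j /=.
case: hV => _ [eps _ epsE] _ _ Ce; have [_ aK] := spectral_exponents hEJ.
rewrite !Ce ipZl ipZr mulrA -powRD; last by rewrite (gt_eqF q0) implybT.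
rewrite epsE; case: eqP => ij; last by rewrite mulr0.
have := aK i (ltn_ord i); have -> : (m - i = j.+1)%N by lia.
by move=> ->; rewrite powRr0 mul1r.
Qed.

(** On [e_m]: [A e_m = e_1], where [C] scales [e_1] by [q] and [e_m] by [q^-1],
since [a 1 = 1] and [a m = -1]. *)
Lemma C_A v : C (A v) = q ^+ 2 *: A (C v).
Proof.
case: hV => _ _ Alast A0 Ce; have [a1 aK] := spectral_exponents hEJ.
have [c ->] := espan v; rewrite !linear_comb; apply: eq_bigr => i _; congr (_ *: _).
rewrite Ce linearZ /= scalerA.
have [im|im] := eqVneq i.+1 m; last first.
  by rewrite A0 ?linear0 ?scaler0 //; have := ltn_ord i; lia.
have [j0 j0E] := first_ord; rewrite (Alast i j0 im j0E) Ce j0E; congr (_ *: _).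
have : a i.+1 = -1.
  have := aK i (ltn_ord i); have -> : (m - i = 1)%N by lia.
  by rewrite a1 -/(a i.+1) => h; lra.
rewrite /a a1 => ->.
by rewrite powRr1 ?ltW // powR_inv1 ?ltW // expr2 mulfK // gt_eqF.
Qed.

Lemma C_inverse : exists C' : {linear V -> V}, cancel C C' /\ cancel C' C.
Proof.
case: hV => eb _ _ _ Ce; have [phi [_ phiE phiK]] := basis_coords eb.
pose mu (i : 'I_m) : R := q `^ (a i.+1).
have mu0 i : mu i != 0 by rewrite gt_eqF // powR_gt0.
pose C' v := \sum_i phi i v *: ((mu i)^-1 *: e i).
have C'l : linear C'.
  move=> r u v; rewrite /C' scaler_sumr -big_split; apply: eq_bigr => i _ /=.
  by rewrite linearP scalerDl; congr (_ + _); rewrite [RHS]scalerA.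
pose C'lin := GRing.isLinear.Build R V V *:%R C' C'l.
pose C'L : {linear V -> V} := HB.pack C' C'lin.
have C'E v : C'L v = C' v by [].
exists C'L; split=> v; rewrite C'E /C'.
  rewrite [RHS]phiE; apply: eq_bigr => i _; rewrite scalerA; congr (_ *: _).
  rewrite {1}(phiE v) linear_sum.
  under [X in phi i X]eq_bigr do rewrite linearZ /= Ce scalerA.
  by rewrite phiK -/(mu i) mulfK.
rewrite linear_sum [RHS]phiE; apply: eq_bigr => i _.
by rewrite !linearZ /= Ce -/(mu i) [_^-1 *: _]scalerA mulVf // scale1r.
Qed.

End Data.
End SpectralAlgebra.

Theorem theorem5p1 (R : realType)
  (m k n : nat) (E : nat -> int) (J : nat -> bool)
  (hEJ : Z_spectral_system m k E J) (hn : n = (m + 2)%N)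
  (q : R) (hq0 : 0 < q) (hq1 : q != 1) (hq : q + q^-1 \is a Num.int)
  (f : R -> R) (hf : smooth_on_pos f)
  (hf1 : condition_f1 q f) (hf2 : condition_f2 q k f)
  (V : normedModType R) (ip : {symmetric V}) (e : 'I_m -> V)
  (A C : {linear V -> V}) (hV : algebraic_data k E q ip e A C)
  (rhat : R) (uhat : R -> V) (huhat : E_space f A uhat)
  (L : set (R -> V)) (Sigma : set (R * (R -> V)))
  (hLS : conditions_A_E ip f A q C uhat L Sigma (n - 2)) :
  let Gam := Gamma ip q C rhat uhat Sigma in
  let Mq := M ip q C rhat uhat Sigma in
  let atl := M_atlas ip q C rhat uhat Sigma in
  [/\ Gam `<=` isometry_group ip f A,
      acts_freely Gam,
      acts_properly_discontinuously Gam &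
      [/\ smooth_manifold atl,
          compact [set: Mq],
          exists2 pi : Mq -> torus R 1,
            smooth_fibre_bundle atl (torus_atlas R 1) (torus_atlas R (n - 1)) pi &
            forall N : set Mq,
              leaf atl (P_perp ip f A) N <-> exists b, N = pi @^-1` [set b],
          (forall x : Mq, fundamental_group_is R Gam x) /\
          ~ has_abelian_subgroup_of_finite_index Gam &
          forall d : nat,
            ~ diffeomorphic (torus_atlas R d) atl /\
            ~ (exists p : torus R d -> Mq, covering_map p)]].
Proof.
have [C' [CC' C'C]] := C_inverse hV hq0.
have eb : is_basis e setT by case: hV.
have Vc := basis_has_coords eb; have [phi [phic phiE _]] := basis_coords eb.
have Asym := A_selfadjoint hEJ hV; have Ciso := C_isometry hEJ hV hq0.
have CA := C_A hEJ hV hq0.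
have nm : (n - 2)%N = m by rewrite hn addnK.
case: hLS; rewrite nm => -[LE [ell Lb]] LCT [[d [b bb SigmaE]] PiS] Lom Lev.
have -> : (n - 1)%N = d.
  by rewrite -(basis_dim (basis_line_prod Lb) bb) hn addn2 subn1.
move=> Gam Mq atl.
have [free pd concl] := Gamma_conclusion Vc hf hq0 hq1 Asym CC' C'C Ciso rhat
  huhat Lb LE LCT Lom Lev bb phic phiE SigmaE PiS.
split=> //; exact: (Gamma_isometries Vc hf hf1 hq0 Asym CC' C'C Ciso CA huhat LE bb SigmaE).
Qed.
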